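(* Let $G$ be a simple, connected, locally finite, unimodular, quasi-transitive, non-amenable, regular, bipartite graph. Then $G$ has a factor-of-iid perfect matching.
   Context: Non-amenable: let $p_n(x,y)$ be the probability that the simple random walk on $G$ started at $x$ is at $y$ after $n$ steps, and $\rho=\limsup_{n\to\infty}p_n(x,y)^{1/n}$ (independent of $x,y$); $G$ is non-amenable if $\rho<1$. Let $\Gamma=\mathrm{Aut}(G)$. Quasi-transitive: $\Gamma$ has finitely many orbits on $V(G)$. Unimodular: $|\mathrm{Stab}_\Gamma(x).y|=|\mathrm{Stab}_\Gamma(y).x|$ for all $x,y$ in the same $\Gamma$-orbit. Let $\mathtt{u}$ be Lebesgue measure on $[0,1]$; $\Gamma$ acts on $[0,1]^{V(G)}$ by $(\gamma.f)(v)=f(\gamma^{-1}.v)$. A factor-of-iid perfect matching of $G$ is a measurable, $\Gamma$-equivariant map from $([0,1]^{V(G)},\mathtt{u}^{V(G)})$ to the space of perfect matchings of $G$ (a subset of $\{0,1\}^{E(G)}$ with its natural $\Gamma$-action), where the map is allowed to be undefined on a $\mathtt{u}^{V(G)}$-null set. *)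

(* Defs.v *)
From HB Require Import structures.
From mathcomp Require Import all_boot all_order all_algebra finmap.
From mathcomp Require Import all_classical all_reals all_analysis.

Set Implicit Arguments.
Unset Strict Implicit.
Unset Printing Implicit Defensive.

Import Order.TTheory GRing.Theory Num.Theory.

Local Open Scope classical_set_scope.
Local Open Scope ring_scope.

Section Graph.
Variables (V : choiceType) (e : rel V).

Definition neighbors (x : V) : set V := [set y | e x y].

Definition locally_finite : Prop := forall x, finite_set (neighbors x).

(* [fset_set] is only meaningful on finite sets. *)
Definition degree (x : V) : nat := (#|` fset_set (neighbors x)|)%fset.

Definition regular_graph : Prop := exists d : nat, forall x, degree x = d.

Definition connected_graph : Prop :=
  forall x y : V, exists p : seq V, path e x p /\ last x p = y.

Definition bipartite : Prop :=
  exists c : V -> bool, forall x y, e x y -> c x != c y.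

Record graph_aut : Type := GraphAut {
  aut_fun :> V -> V;
  aut_inv : V -> V;
  aut_funK : cancel aut_fun aut_inv;
  aut_invK : cancel aut_inv aut_fun;
  aut_adj : forall x y, e (aut_fun x) (aut_fun y) = e x y }.

Definition aut_orbit (x : V) : set V := [set g x | g in [set: graph_aut]].

Definition stab_orbit (x y : V) : set V :=
  [set g y | g in [set g : graph_aut | g x = x]].

Definition quasi_transitive : Prop :=
  finite_set [set aut_orbit x | x in [set: V]].

Definition unimodular : Prop :=
  forall x y, aut_orbit x y -> (stab_orbit x y #= stab_orbit y x)%card.

Definition edges : set (set V) :=
  [set a | exists x y, e x y /\ a = [set x; y]].

Definition perfect_matching (M : set (set V)) : Prop :=
  M `<=` edges /\ forall x, exists! a, M a /\ a x.

(* {0,1}^E, presented as sets of subsets of V under the sigma-algebra generated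
   by the coordinate events of the edges; non-edges are not observed. *)
Definition edge_events : set (set (set (set V))) :=
  [set [set M : set (set V) | M a] | a in edges].

Definition edge_config := g_sigma_algebraType edge_events.

Definition act_edge_config (g : graph_aut) (M : edge_config) : edge_config :=
  [set g @` a | a in (M : set (set V))].

End Graph.

Section SimpleRandomWalk.
Variables (R : realType) (V : choiceType) (e : rel V).

(* The walk stays put at an isolated vertex, so that the one-vertex graph has
   spectral radius 1, as every other finite connected graph. *)
Definition srw_step (x y : V) : R :=
  if degree e x == 0%N then (x == y)%:R else (e x y)%:R / (degree e x)%:R.

Fixpoint srw (n : nat) (x y : V) : R :=
  if n is m.+1 then \sum_(z \in [set: V]) srw_step x z * srw m z y
  else (x == y)%:R.

Definition spectral_radius (x y : V) : \bar R :=
  limn_esup (fun n => (srw n x y `^ n%:R^-1)%:E).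

(* For a connected graph [spectral_radius x y] does not depend on x and y. *)
Definition nonamenable : Prop := exists x y, (spectral_radius x y < 1)%E.

End SimpleRandomWalk.

HB.instance Definition _ (R : realType) :=
  isPointed.Build {i01 R} (0%:i01 : {i01 R}).

Section FactorOfIID.
Variables (R : realType) (V : choiceType) (e : rel V).

Definition label_events : set (set (V -> {i01 R})) :=
  [set E | exists (v : V) (B : set R),
     measurable B /\ E = [set f | B (f v)%:num]].

(* [0,1]^V with its product sigma-algebra. *)
Definition label_config := g_sigma_algebraType label_events.

Definition act_label_config (g : graph_aut e) (f : label_config) :
  label_config := fun v => f (aut_inv g v).

(* The values on finite-dimensional boxes characterize the product of copies
   of Lebesgue measure on [0,1] among probability measures. *)
Definition product_of_uniform (u : probability label_config R) : Prop :=
  forall (S : {fset V}) (B : V -> set R), (forall v, measurable (B v)) ->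
    u [set f : label_config | forall v, v \in S -> B v (f v)%:num] =
    (\prod_(v <- S) lebesgue_measure (B v `&` `[0%R, 1%R]))%E.

(* D is the domain of definition of the factor map F. *)
Definition has_fiid_perfect_matching (u : probability label_config R) : Prop :=
  exists (D : set label_config) (F : label_config -> edge_config e),
    [/\ measurable D /\ u (~` D) = 0%E,
        measurable_fun D F,
        forall (g : graph_aut e) f, D f ->
          D (act_label_config g f) /\
          F (act_label_config g f) = act_edge_config g (F f)
      & forall f, D f -> perfect_matching e (F f)].

End FactorOfIID.

(* Main.v *)
Require Import Defs.
From HB Require Import structures.
From mathcomp Require Import all_boot all_order all_algebra finmap.
From mathcomp Require Import all_classical all_reals all_analysis.
From mathcomp Require Import measurable_realfun.
From mathcomp Require Import ring lra zify.

(** The perfect matching is the limit of a sequence of partial matchings, each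
    an equivariant function of the labels; the idea of improving matchings
    along short augmenting paths in a non-amenable graph is due to Lyons and
    Nazarov.

    A stage starts from a partial matching and flips augmenting paths of
    bounded length until none is left. To choose equivariantly between paths
    that meet, the labels are rounded to digits, and at each time the flipped
    paths are those whose digits form a prescribed list; paths with the same
    list cannot meet if the digits are distinct on a large ball. Every flip
    matches a new vertex and no vertex becomes unmatched, so each vertex
    changes its mate finitely often ([run_settles]). Every list of digits
    comes up infinitely often, so no short augmenting path survives
    ([stage_no_aug]).

    After a stage few vertices are unmatched. Starting from the unmatched
    vertices of one side of the bipartition, let [A k] be the set reached by
    alternating walks with [k] non-matching edges. If there is no short
    augmenting path then all neighbours of [A k] are matched and their mates
    belong to [A (k + 1)] ([alt_side_next]), while [A k] is disjoint from the
    neighbours of the corresponding set from the other side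
    ([alt_side_disjoint]). By expansion the densities of these sets would
    approach that of the whole side at a geometric rate, were the initial
    density not geometrically small; as two disjoint sets cannot both have
    more than half of the density, the density of the unmatched vertices
    decays geometrically in the number of stages ([unmatched_density]). A
    vertex that changes its mate lies on a path flipped from an unmatched
    vertex, so by mass transport the density of such vertices is at most twice
    the length bound times the density of the unmatched ones
    ([changed_density]). This is summable, and by the Borel-Cantelli lemma
    almost surely all mates converge ([converges_null]).

    The expansion inequality ([expansion]) concerns the density of an
    invariant random set on one side and of its neighbourhood. Densities are
    averages over the finitely many orbits, with weights for which the mass
    transport principle holds ([mass_transport_exists]); then averaging over
    neighbours is a self-adjoint operator on the invariant processes. It
    contracts the centered indicators of invariant sets
    ([centered_contraction]): for a process without correlations beyond some
    distance, the squared norms of the iterated averages are bounded by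
    transition probabilities, which decay exponentially by non-amenability
    ([srw_decay]), and as these norms form a log-convex sequence, already the
    first step contracts ([walk_contraction_decorrelated]); general events are
    approximated by averages of events that depend on finitely many labels. On
    the expectations, which are functions of the finitely many orbits, the
    operator contracts the part of mean zero on each side ([poincare]).
    Cauchy-Schwarz combines the two contractions. *)

Set Implicit Arguments.
Unset Strict Implicit.
Unset Printing Implicit Defensive.

Import Order.TTheory GRing.Theory Num.Theory.
Import numFieldNormedType.Exports.

Local Open Scope classical_set_scope.
Local Open Scope ring_scope.

(** * Balls and automorphisms *)

Section Balls.
Variables (V : choiceType) (e : rel V).
Hypotheses (e_sym : symmetric e) (e_conn : connected_graph e)
  (e_lf : locally_finite e).

Definition nbr (x : V) : seq V := fset_set (neighbors e x).

Lemma mem_nbr x y : (y \in nbr x) = e x y.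
Proof. by rewrite /nbr in_fset_set ?inE //; apply/idP/idP; rewrite ?inE ?mem_setE. Qed.

Lemma uniq_nbr x : uniq (nbr x).
Proof. exact: fset_uniq. Qed.

Fixpoint ball_seq n x : seq V :=
  if n is m.+1 then ball_seq m x ++ flatten [seq nbr y | y <- ball_seq m x]
  else [:: x].

Lemma ball_step n x y z : y \in ball_seq n x -> e y z -> z \in ball_seq n.+1 x.
Proof.
move=> yb eyz /=; rewrite mem_cat; apply/orP; right.
by apply/flattenP; exists (nbr y); [apply: map_f | rewrite mem_nbr].
Qed.

Lemma ball_leS n x y : y \in ball_seq n x -> y \in ball_seq n.+1 x.
Proof. by move=> yb /=; rewrite mem_cat yb. Qed.

Lemma ball_le n m x y : (n <= m)%N -> y \in ball_seq n x -> y \in ball_seq m x.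
Proof.
move=> /subnK <-; elim: (m - n)%N => // k IH yb; rewrite addSn.
by apply: ball_leS; apply: IH.
Qed.

Lemma ball_ind n x y : y \in ball_seq n.+1 x ->
  y \in ball_seq n x \/ exists2 z, z \in ball_seq n x & e z y.
Proof.
rewrite /= mem_cat => /orP[->|]; first by left.
case/flattenP => s /mapP[z zb ->]; rewrite mem_nbr => ezy.
by right; exists z.
Qed.

Lemma ball0 n x : x \in ball_seq n x.
Proof. by apply: (@ball_le 0) => //; rewrite inE. Qed.

Lemma ball_trans n m x y z :
  y \in ball_seq n x -> z \in ball_seq m y -> z \in ball_seq (n + m) x.
Proof.
move=> yb; elim: m z => [|m IH] z; first by rewrite addn0 inE => /eqP ->.
rewrite addnS => /ball_ind[zb|[t tb etz]]; first by apply/ball_leS/IH.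
by apply: ball_step etz; apply: IH.
Qed.

Lemma ball1 x y : e x y -> y \in ball_seq 1 x.
Proof. by move=> exy; apply: ball_step exy; rewrite inE. Qed.

Lemma ball_sym n x y : y \in ball_seq n x -> x \in ball_seq n y.
Proof.
elim: n y => [|n IH] y; first by rewrite !inE eq_sym.
move=> /ball_ind[yb|[t tb ety]]; first by apply/ball_leS/IH.
rewrite -[n.+1]add1n; apply: (@ball_trans _ _ _ t); last exact: IH.
by apply: ball1; rewrite e_sym.
Qed.

Lemma ball_path x p : path e x p -> last x p \in ball_seq (size p) x.
Proof.
elim/last_ind: p => [|p y IH]; first by rewrite inE.
rewrite rcons_path last_rcons size_rcons => /andP[/IH yb].
exact: ball_step.
Qed.

Lemma ball_ex x y : exists n, y \in ball_seq n x.
Proof. by have [p [/ball_path + <-]] := e_conn x y; exists (size p). Qed.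

Lemma ball_seqs_common (r : seq V) (S : V -> seq V) :
  exists n, forall x, x \in r -> {subset S x <= ball_seq n x}.
Proof.
have one x (s : seq V) : exists n, {subset s <= ball_seq n x}.
  elim: s => [|a s [n IH]]; first by exists 0%N.
  have [m am] := ball_ex x a; exists (maxn n m) => y; rewrite inE => /orP[/eqP ->|].
    by apply: ball_le am; rewrite leq_maxr.
  by move/IH; apply: ball_le; rewrite leq_maxl.
elim: r => [|x r [n IH]]; first by exists 0%N.
have [m hm] := one x (S x); exists (maxn m n) => y.
rewrite inE => /orP[/eqP ->|yr] v vS.
  by apply: ball_le (hm v vS); exact: leq_maxl.
by apply: ball_le (IH y yr v vS); exact: leq_maxr.
Qed.

Lemma countable_vertices : countable [set: V].
Proof.
have [[x _]|VP] := pselect (exists x : V, True); last first.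
  rewrite (_ : [set: V] = set0) //; last by apply/seteqP; split => // x; case: VP; exists x.
rewrite (_ : [set: V] = \bigcup_(n in [set: nat]) [set` ball_seq n x]).
  apply: bigcup_countable; first exact: countableP.
  by move=> n _; apply: finite_set_countable; exact: finite_seq.
by apply/seteqP; split => // y _; have [n yn] := ball_ex x y; exists n.
Qed.

Definition aut_id : graph_aut e :=
  @GraphAut V e id id (fun=> erefl) (fun=> erefl) (fun _ _ => erefl).

Definition aut_rev (g : graph_aut e) : graph_aut e.
Proof.
exists (aut_inv g) g; [exact: aut_invK | exact: aut_funK |].
by move=> x y; rewrite -(aut_adj g) !aut_invK.
Defined.

Definition aut_comp (g h : graph_aut e) : graph_aut e.
Proof.
exists (g \o h) (aut_inv h \o aut_inv g).
- by move=> x /=; rewrite !aut_funK.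
- by move=> x /=; rewrite !aut_invK.
- by move=> x y /=; rewrite !aut_adj.
Defined.

Lemma aut_inj (g : graph_aut e) : injective g.
Proof. exact: can_inj (aut_funK g). Qed.

Lemma aut_bij (g : graph_aut e) : bijective g.
Proof. by exists (aut_inv g); [exact: aut_funK | exact: aut_invK]. Qed.

Lemma ball_aut_imp (g : graph_aut e) n x y :
  y \in ball_seq n x -> g y \in ball_seq n (g x).
Proof.
elim: n y => [|n IH] y; first by rewrite !inE => /eqP ->.
move=> /ball_ind[yb|[t tb ety]]; first by apply/ball_leS/IH.
by apply: ball_step (IH _ tb) _; rewrite aut_adj.
Qed.

Lemma ball_aut (g : graph_aut e) n x y :
  (g y \in ball_seq n (g x)) = (y \in ball_seq n x).
Proof.
apply/idP/idP; last exact: ball_aut_imp.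
by move/(@ball_aut_imp (aut_rev g)); rewrite /= !aut_funK.
Qed.

(** A connected bipartite graph has only one bipartition, so an automorphism
    preserves both sides as soon as it preserves the side of one vertex. *)
Lemma side_preserved (c : V -> bool) (g : graph_aut e) (x : V) :
  (forall a b, e a b -> c a != c b) -> c (g x) = c x ->
  forall y, c (g y) = c y.
Proof.
move=> hc gx y; have [n] := ball_ex x y; elim: n y => [|n IH] y.
  by rewrite inE => /eqP ->.
move=> /ball_ind[/IH //|[t /IH tb ety]].
have := hc _ _ ety; have := hc (g t) (g y); rewrite aut_adj => /(_ ety).
by rewrite tb; case: (c t); case: (c y); case: (c (g y)).
Qed.

End Balls.

(** * Sums of finitely supported functions *)

Section FiniteSums.
Variables (R : realType) (V : choiceType).
Implicit Types (F G : V -> R) (s : seq V).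

Definition sumV F : R := \sum_(x \in [set: V]) F x.

Definition supported F s := forall x, F x != 0 -> x \in s.

Lemma eq_sumV F G : F =1 G -> sumV F = sumV G.
Proof. by move=> /funext ->. Qed.

Lemma sumV_seq F s : uniq s -> supported F s -> sumV F = \sum_(x <- s) F x.
Proof.
move=> us hs; rewrite /sumV (fsbig_seq _ _ us); apply/esym.
apply: fsbig_widen => // x [_ /= xs].
by apply: contra_notP xs => /eqP/hs.
Qed.

Lemma supported_undup F s : supported F s -> supported F (undup s).
Proof. by move=> h x /h; rewrite mem_undup. Qed.

Lemma sumV_undup F s : supported F s -> sumV F = \sum_(x <- undup s) F x.
Proof. by move=> hs; apply: sumV_seq (undup_uniq s) (supported_undup hs). Qed.

Lemma sumVD F G s : supported F s -> supported G s ->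
  sumV (fun x => F x + G x) = sumV F + sumV G.
Proof.
move=> hF hG; rewrite (sumV_undup hF) (sumV_undup hG) -big_split /=.
apply: sumV_undup => x.
by apply: contraNT => xs; rewrite (contraNeq (hF x)) ?(contraNeq (hG x)) ?addr0.
Qed.

Lemma sumVZ a F : sumV (fun x => a * F x) = a * sumV F.
Proof. by rewrite /sumV mulr_fsumr. Qed.

Lemma sumV0 F : (forall x, F x = 0) -> sumV F = 0.
Proof. by move=> h; apply: fsbig1. Qed.

Lemma sumV_big (I : eqType) (r : seq I) (F : I -> V -> R) s :
  (forall i, i \in r -> supported (F i) s) ->
  sumV (fun x => \sum_(i <- r) F i x) = \sum_(i <- r) sumV (F i).
Proof.
elim: r => [|i r IH] h.
  by rewrite big_nil; apply: sumV0 => x; rewrite big_nil.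
have hr j : j \in r -> supported (F j) s by move=> jr; apply: h; rewrite inE jr orbT.
rewrite big_cons -IH // -(@sumVD _ _ s); last 2 first.
- by apply: h; exact: mem_head.
- move=> x; apply: contraNT => xs; apply/eqP/big1_seq => j /= jr.
  by apply: contraNeq xs => /(hr j jr).
by apply: eq_sumV => x; rewrite big_cons.
Qed.

Lemma sumV_exchange (F : V -> V -> R) s s' :
  (forall x y, F x y != 0 -> x \in s /\ y \in s') ->
  sumV (fun x => sumV (F x)) = sumV (fun y => sumV (F^~ y)).
Proof.
move=> h.
have h1 x : supported (F x) s' by move=> y /h[].
have h2 y : supported (F^~ y) s by move=> x /h[].
rewrite (@eq_sumV _ (fun x => \sum_(y <- undup s') F x y)); last first.
  by move=> x; apply: sumV_undup.
rewrite (@sumV_big _ _ (fun y x => F x y) s); last by move=> y _; exact: h2.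
apply/esym.
apply: sumV_undup => y; apply: contraNT => ys; apply/eqP/sumV0 => x.
by apply: contraNeq ys => /h[].
Qed.

Lemma sumV_reindex (h : V -> V) F : bijective h -> sumV F = sumV (F \o h).
Proof. exact: reindex_fsbigT. Qed.

Lemma sumV1 F x : (forall y, y != x -> F y = 0) -> sumV F = F x.
Proof.
move=> h; rewrite (@sumV_seq _ [:: x]) ?big_seq1 // => y.
by rewrite inE; apply: contraNT => /h ->.
Qed.

Lemma sumV_ge0 F : (forall x, 0 <= F x) -> 0 <= sumV F.
Proof. by move=> h; apply: fsumr_ge0 => x _; exact: h. Qed.

Lemma sumV_ge F s x : supported F s -> (forall y, 0 <= F y) -> F x <= sumV F.
Proof.
move=> hs F0; have [->|Fx] := eqVneq (F x) 0; first exact: sumV_ge0.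
rewrite (sumV_undup hs) (bigD1_seq x) ?undup_uniq //= ?mem_undup ?hs // lerDl.
exact: sumr_ge0.
Qed.

End FiniteSums.

(** * Modular weights and the mass transport principle *)

Section MassTransport.
Variables (R : realType) (V : choiceType) (e : rel V) (c : V -> bool).
Hypotheses (e_sym : symmetric e) (e_conn : connected_graph e)
  (e_lf : locally_finite e) (e_unim : unimodular e) (e_qt : quasi_transitive e)
  (e_col : forall x y, e x y -> c x != c y).

Definition stab2 (x y y' : V) : bool :=
  `[< exists g : graph_aut e, g x = x /\ g y = y' >].

Definition stab3 (x y z y' z' : V) : bool :=
  `[< exists g : graph_aut e, [/\ g x = x, g y = y' & g z = z'] >].

(** The sizes of the orbits of [y] under the stabilizer of [x], and of [z]
    under the common stabilizer of [x] and [y]. *)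
Definition stab_size (x y : V) : R := sumV (fun y' => (stab2 x y y')%:R).
Definition stab_size2 (x y z : V) : R := sumV (fun z' => (stab3 x y z y z')%:R).

Lemma stab2_ball n x y y' : y \in ball_seq e n x -> stab2 x y y' ->
  y' \in ball_seq e n x.
Proof.
by move=> yb /asboolP[g [gx <-]]; rewrite -[X in ball_seq _ _ X]gx ball_aut.
Qed.

Lemma stab_size_gt0 x y : 0 < stab_size x y.
Proof.
have [n yn] := ball_ex e_conn e_lf x y.
apply: lt_le_trans (@sumV_ge R V _ (ball_seq e n x) y _ _) => //.
  by rewrite (_ : stab2 x y y = true) ?ltr01 //; apply/asboolP; exists (aut_id e).
by move=> y'; rewrite pnatr_eq0 eqb0 negbK; exact: stab2_ball.
Qed.

Lemma stab_size2_gt0 x y z : 0 < stab_size2 x y z.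
Proof.
have [n yn] := ball_ex e_conn e_lf x z.
apply: lt_le_trans (@sumV_ge R V _ (ball_seq e n x) z _ _) => //.
  by rewrite (_ : stab3 x y z y z = true) ?ltr01 //; apply/asboolP; exists (aut_id e).
move=> y'; rewrite pnatr_eq0 eqb0 negbK => /asboolP[g [gx _ gz]].
by apply: (stab2_ball yn); apply/asboolP; exists g.
Qed.

Lemma stab_size2C x y z : stab_size2 x y z = stab_size2 y x z.
Proof.
apply: eq_sumV => z'; congr (_%:R); congr (nat_of_bool _).
by apply/asboolP/asboolP => -[g [gx gy gz]]; exists g.
Qed.

(** Orbit-stabilizer for pairs: the orbit of [(y, z)] under the stabilizer of
    [x] fibres over the orbit of [y], and all fibres are translates of each
    other. *)
Lemma stab_size_pair x y z :
  sumV (fun y' => sumV (fun z' => (stab3 x y z y' z')%:R)) =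
  stab_size x y * stab_size2 x y z.
Proof.
rewrite /stab_size mulrC -sumVZ; apply: eq_sumV => y'.
case: (boolP (stab2 x y y')) => [/asboolP[h [hx hy]]|/asboolP hn]; last first.
  rewrite mulr0; apply: sumV0 => z'; rewrite (_ : stab3 _ _ _ _ _ = false) //.
  by apply/asboolP => -[g [gx gy _]]; apply: hn; exists g.
rewrite mulr1 (sumV_reindex _ (aut_bij h)); apply: eq_sumV => z'.
congr (_%:R); congr (nat_of_bool _); apply/asboolP/asboolP.
- move=> [g [gx gy gz]]; exists (aut_comp (aut_rev h) g); split => /=.
  + by rewrite gx -{1}hx aut_funK.
  + by rewrite gy -hy aut_funK.
  + by rewrite gz aut_funK.
- move=> [g [gx gy gz]]; exists (aut_comp h g); split => /=.
  + by rewrite gx.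
  + by rewrite gy.
  + by rewrite gz.
Qed.

(** Both sides count the orbit of the pair [(y, z)] under the stabilizer of
    [x]. *)
Lemma stab_size_swap x y z : stab_size x y * stab_size2 x y z = stab_size x z * stab_size2 x z y.
Proof.
have [n yn] := ball_ex e_conn e_lf x y; have [m zm] := ball_ex e_conn e_lf x z.
rewrite -!stab_size_pair (@sumV_exchange R V _ (ball_seq e n x) (ball_seq e m x)).
  apply: eq_sumV => z'; apply: eq_sumV => y'.
  congr (_%:R); congr (nat_of_bool _).
  by apply/asboolP/asboolP => -[g [gx gy gz]]; exists g.
move=> y' z'; rewrite pnatr_eq0 eqb0 negbK => /asboolP[g [gx gy gz]].
by split; [apply: (stab2_ball yn) | apply: (stab2_ball zm)];
  apply/asboolP; exists g.
Qed.

(** The ratio [stab_size x y / stab_size y x] is the modular cocycle of the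
    automorphism group, hence multiplicative along triangles. *)
Lemma stab_size_cocycle x y z :
  stab_size x y * stab_size y z * stab_size z x = stab_size y x * stab_size z y * stab_size x z.
Proof.
have h1 := stab_size_swap x y z; have h2 := stab_size_swap y z x; have h3 := stab_size_swap z x y.
have E1 : stab_size2 y z x = stab_size2 z y x by exact: stab_size2C.
have E2 : stab_size2 y x z = stab_size2 x y z by exact: stab_size2C.
have E3 : stab_size2 z x y = stab_size2 x z y by exact: stab_size2C.
rewrite E1 E2 in h2; rewrite E3 in h3.
have p1 := stab_size2_gt0 x y z; have p2 := stab_size2_gt0 z y x; have p3 := stab_size2_gt0 x z y.
apply: (mulIf (lt0r_neq0 (mulr_gt0 (mulr_gt0 p1 p2) p3))).
transitivity ((stab_size x y * stab_size2 x y z) *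
  (stab_size y z * stab_size2 z y x) * (stab_size z x * stab_size2 x z y)).
  by ring.
by rewrite h1 h2 h3; ring.
Qed.

Lemma stab_size_aut (g : graph_aut e) x y : stab_size (g x) (g y) = stab_size x y.
Proof.
rewrite /stab_size (sumV_reindex _ (aut_bij g)); apply: eq_sumV => z.
congr (_%:R); congr (nat_of_bool _); apply/asboolP/asboolP => -[h [hx hy]].
- exists (aut_comp (aut_rev g) (aut_comp h g)) => /=.
  by rewrite hx hy !aut_funK.
- exists (aut_comp g (aut_comp h (aut_rev g))) => /=.
  by rewrite !aut_funK hx hy.
Qed.

Lemma stab_sizeE x y : stab_size x y = \sum_(y' \in stab_orbit e x y) (1 : R).
Proof.
rewrite [RHS]fsbig_mkcond; apply: eq_sumV => y'.
rewrite /patch; case: (boolP (stab2 x y y')) => [/asboolP|/asboolP] h.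
  by rewrite mem_set //; case: h => g [gx gy]; exists g.
by rewrite memNset // => -[g gx gy]; apply: h; exists g.
Qed.

(** The only use of unimodularity. *)
Lemma stab_size_unimodular (g : graph_aut e) x : stab_size x (g x) = stab_size (g x) x.
Proof.
have og : aut_orbit e x (g x) by exists g.
have fin a b : finite_set (stab_orbit e a b).
  have [n bn] := ball_ex e_conn e_lf a b.
  apply: (@sub_finite_set _ _ [set` ball_seq e n a]); last exact: finite_seq.
  by move=> y' [h ha <-]; apply: (stab2_ball bn); apply/asboolP; exists h.
have /(fcard_eq (fin _ _) (fin _ _)) := e_unim og.
rewrite !stab_sizeE !fsbig_finite // !big_const_seq !count_predT.
by move=> ->.
Qed.

(** Fix a base vertex [b] and compare the stabilizers of [x] and [b]: the
    weight is inversely proportional to the Haar measure of the stabilizer of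
    [x]. The last property is the cocycle identity, and unimodularity makes
    the weight constant on orbits. *)
Lemma modular_weight : exists w : V -> R,
  [/\ forall x, 0 < w x, forall (g : graph_aut e) x, w (g x) = w x &
      forall x y, w x * stab_size x y = w y * stab_size y x].
Proof.
have [[b _]|VP] := pselect (exists x : V, True); last first.
  by exists (fun=> 1); split=> // x; case: VP; exists x.
pose w x := stab_size b x / stab_size x b; have size0 x y := lt0r_neq0 (stab_size_gt0 x y).
have wE x y : w x * stab_size x y = w y * stab_size y x.
  have := stab_size_cocycle b x y; rewrite /w => h.
  have -> : stab_size b x / stab_size x b * stab_size x y =
    (stab_size b x * stab_size x y * stab_size y b) / (stab_size x b * stab_size y b).
    by field; rewrite !size0.
  by rewrite h; field; rewrite !size0.
exists w; split => [x|g x|//]; first by rewrite divr_gt0 ?stab_size_gt0.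
have := wE (g x) x; rewrite -(stab_size_unimodular g x) => /mulIf; apply; exact: size0.
Qed.

Definition side_pres (g : graph_aut e) := forall x, c (g x) = c x.

Lemma side_pres_comp g h : side_pres g -> side_pres h -> side_pres (aut_comp g h).
Proof. by move=> hg hh x /=; rewrite hg hh. Qed.

Lemma side_pres_rev g : side_pres g -> side_pres (aut_rev g).
Proof. by move=> hg x /=; rewrite -[RHS](congr1 c (aut_invK g x)) hg. Qed.

Lemma side_pres_stab (g : graph_aut e) x : c (g x) = c x -> side_pres g.
Proof. exact: side_preserved e_conn e_lf _ _ _ e_col. Qed.

(** Finitely many orbits of the full automorphism group split into at most
    twice as many orbits of the side-preserving automorphisms. *)
Lemma representatives : exists (rep : V -> V) (O : seq V),
  [/\ uniq O, forall x, rep x \in O, forall o, o \in O -> rep o = o,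
      forall x, exists2 g, side_pres g & g (rep x) = x &
      forall g x, side_pres g -> rep (g x) = rep x].
Proof.
pose cls x := [set y | exists2 g, side_pres g & g x = y].
have clsx x : cls x x by exists (aut_id e).
have cls_tr x y : cls x y -> cls y = cls x.
  move=> [g sg gx]; apply/seteqP; split => z [h sh hz].
    by exists (aut_comp h g); [exact: side_pres_comp | rewrite /= gx].
  exists (aut_comp h (aut_rev g)); first exact/side_pres_comp/side_pres_rev.
  by rewrite /= -gx aut_funK.
pose rep x := xget x (cls x).
have repP x : cls x (rep x) by rewrite /rep; case: xgetP => [y -> //|/(_ x)/(_ (clsx x))].
have rep_eq x y : cls x = cls y -> rep x = rep y.
  move=> E; rewrite /rep E /xget; case: pselect => // -[].
  by exists y; apply/asboolP.
have rep_aut g x : side_pres g -> rep (g x) = rep x.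
  by move=> sg; apply/rep_eq/cls_tr; exists g.
have rep_ex x : exists2 g, side_pres g & g (rep x) = x.
  have [g sg gx] := repP x; exists (aut_rev g); first exact: side_pres_rev.
  by rewrite /= -gx aut_funK.
have rep_full x y : aut_orbit e x = aut_orbit e y -> c x = c y -> rep x = rep y.
  move=> oxy cxy; have : aut_orbit e x y by rewrite oxy; exists (aut_id e).
  move=> [g _ gx]; rewrite -gx rep_aut //.
  by apply: (@side_pres_stab g x); rewrite gx.
have finrep : finite_set (range rep).
  have fin2 : finite_set ([set aut_orbit e x | x in [set: V]] `*` [set: bool]).
    by apply: finite_setX => //; exact: finite_finset.
  pose F (p : set V * bool) : seq V :=
    if pselect (exists x, aut_orbit e x = p.1 /\ c x = p.2) is left h
    then [:: rep (projT1 (cid h))] else [::].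
  apply: (@sub_finite_set _ _ (\bigcup_(p in
    [set aut_orbit e x | x in [set: V]] `*` [set: bool]) [set` F p])).
    move=> _ [x _ <-]; exists (aut_orbit e x, c x); first by split => //; exists x.
    rewrite /F; case: pselect => [h|[]]; last by exists x.
    case: (cid h) => y /= [oy cy]; rewrite inE; apply/eqP; exact: rep_full.
  by apply: bigcup_finite => // p _; exact: finite_seq.
exists rep, (fset_set (range rep)); split => //.
- by move=> x; rewrite in_fset_set // inE; exists x.
- by move=> o; rewrite in_fset_set // inE => -[x _ <-]; have [g sg {2}<-] := rep_ex x; rewrite rep_aut.
Qed.

Variables (rep : V -> V) (O : seq V) (w : V -> R).
Hypotheses (O_uniq : uniq O) (rep_O : forall x, rep x \in O)
  (O_rep : forall b, b \in O -> rep b = b)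
  (rep_ex : forall x, exists2 g, side_pres g & g (rep x) = x)
  (rep_aut : forall g x, side_pres g -> rep (g x) = rep x).
Hypotheses (w_aut : forall (g : graph_aut e) x, w (g x) = w x)
  (w_size : forall x y, w x * stab_size x y = w y * stab_size y x).

(** With several orbits mass transport only holds for an average over orbits
    weighted by [w], inversely to the Haar measures of the stabilizers. *)
Definition mean (f : V -> R) : R := \sum_(b <- O) w b * f b.

Definition diag_inv (t : V -> V -> R) :=
  forall g x y, side_pres g -> t (g x) (g y) = t x y.

Definition finite_range (t : V -> V -> R) :=
  exists n, forall x y, t x y != 0 -> y \in ball_seq e n x.

(** Both sides are weighted counts of the pairs [(y, x)] such that some
    side-preserving automorphism moves [(a, y)] to [(x, b)]. For a given [y]
    the possible [x] form an orbit of the stabilizer of [y], and for a given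
    [x] the possible [y] form an orbit of the stabilizer of [x]; the identity
    satisfied by [w] compensates for the sizes of these orbits. *)
Lemma transport_between (t : V -> V -> R) a b :
  diag_inv t -> finite_range t -> rep a = a -> rep b = b ->
  w a * sumV (fun y => (rep y == b)%:R * t a y) =
  w b * sumV (fun x => (rep x == a)%:R * t x b).
Proof.
move=> tinv [n tn] ra rb.
pose K y x : bool := `[< exists g, [/\ side_pres g, g a = x & g y = b] >].
have KE y : sumV (fun x => (K y x)%:R) = (rep y == b)%:R * stab_size y a.
  have [ryb|ryb] := eqVneq (rep y) b; last first.
    rewrite mul0r; apply: sumV0 => x; rewrite (_ : K y x = false) //.
    apply/asboolP => -[g [sg ga gy]]; move: ryb.
    by rewrite -(rep_aut y sg) gy rb eqxx.
  rewrite mul1r; have [h sh hy] := rep_ex y; rewrite ryb in hy.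
  rewrite /stab_size [RHS](sumV_reindex _ (aut_bij h)); apply: eq_sumV => x /=.
  congr (_%:R); congr (nat_of_bool _); apply/asboolP/asboolP.
    move=> [g [sg ga gy]]; exists (aut_comp h g) => /=.
    by rewrite gy ga hy.
  move=> [k [ky ka]]; exists (aut_comp (aut_rev h) k); split => /=.
  - apply: side_pres_comp; first exact: side_pres_rev.
    by apply: (@side_pres_stab k y); rewrite ky.
  - by rewrite ka aut_funK.
  - by rewrite ky -{1}hy aut_funK.
have KE' x : sumV (fun y => (K y x)%:R) = (rep x == a)%:R * stab_size x b.
  have [rxa|rxa] := eqVneq (rep x) a; last first.
    rewrite mul0r; apply: sumV0 => y; rewrite (_ : K y x = false) //.
    apply/asboolP => -[g [sg ga gy]]; move: rxa.
    by rewrite -ga rep_aut // ra eqxx.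
  rewrite mul1r; have [h sh hx] := rep_ex x; rewrite rxa in hx.
  rewrite /stab_size [RHS](sumV_reindex _ (aut_bij h)); apply: eq_sumV => y /=.
  congr (_%:R); congr (nat_of_bool _); apply/asboolP/asboolP.
    move=> [g [sg ga gy]]; exists (aut_comp h (aut_rev g)) => /=.
    by rewrite -{1}ga -gy !aut_funK.
  move=> [k [kx kb]]; exists (aut_comp (aut_rev k) h); split => /=.
  - apply: side_pres_comp => //; apply: side_pres_rev.
    by apply: (@side_pres_stab k x); rewrite kx.
  - by rewrite hx -{1}kx aut_funK.
  - by rewrite -kb aut_funK.
have size0 x y := lt0r_neq0 (stab_size_gt0 x y).
transitivity (w a * sumV (fun y => sumV (fun x => (K y x)%:R * (t x b / stab_size b x)))).
  congr (_ * _); apply: eq_sumV => y.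
  transitivity (sumV (fun x => t a y / stab_size y a * (K y x)%:R)).
    rewrite sumVZ KE mulrCA -mulrA; congr (_ * _).
    by rewrite mulVf ?mulr1.
  apply: eq_sumV => x; rewrite mulrC.
  case: (boolP (K y x)) => [/asboolP[g [sg ga gy]]|_]; last by rewrite !mul0r.
  by rewrite -(tinv g a y) // -(stab_size_aut g y a) ga gy.
rewrite (@sumV_exchange _ _ _ (ball_seq e n a) (ball_seq e n b)); last first.
  move=> y x; case: (boolP (K y x)) => [/asboolP[g [sg ga gy]]|_]; last by rewrite !mul0r eqxx.
  rewrite mul1r mulf_eq0 negb_or => /andP[txb _]; split.
    by apply: tn; rewrite -(tinv g) // ga gy.
  by apply: (ball_sym e_sym e_lf); apply: tn.
rewrite -!sumVZ; apply: eq_sumV => x.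
transitivity (w a * (t x b / stab_size b x * sumV (fun y => (K y x)%:R))).
  by congr (_ * _); rewrite -sumVZ; apply: eq_sumV => y; rewrite mulrC.
rewrite KE'; have [rxa|_] := eqVneq (rep x) a; last by rewrite !(mul0r, mulr0).
have -> : w a = w x by have [h _ <-] := rep_ex x; rewrite w_aut rxa.
rewrite !mul1r.
transitivity (w x * stab_size x b * t x b / stab_size b x); first by field.
by rewrite w_size; field.
Qed.

Lemma sum_rep x : \sum_(b <- O) (rep x == b)%:R = 1 :> R.
Proof.
rewrite (bigD1_seq (rep x)) ?rep_O //= eqxx big1 ?addr0 // => b.
by rewrite eq_sym => /negbTE ->.
Qed.

(** Splits the mass according to the orbits of its source and its target. *)
Theorem mass_transport (t : V -> V -> R) : diag_inv t -> finite_range t ->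
  mean (fun x => sumV (t x)) = mean (fun y => sumV (t^~ y)).
Proof.
move=> tinv [n tn]; have fr : finite_range t by exists n.
have tn' x y : t x y != 0 -> x \in ball_seq e n y by move/tn/(ball_sym e_sym e_lf).
transitivity (\sum_(a <- O) \sum_(b <- O) w a * sumV (fun y => (rep y == b)%:R * t a y)).
  apply: eq_bigr => a _; rewrite -big_distrr /=; congr (_ * _).
  rewrite -(@sumV_big _ _ _ _ _ (ball_seq e n a)).
    by apply: eq_sumV => y; rewrite -big_distrl /= sum_rep mul1r.
  by move=> b _ y; rewrite mulf_eq0 negb_or => /andP[_ /tn].
transitivity (\sum_(a <- O) \sum_(b <- O) w b * sumV (fun x => (rep x == a)%:R * t x b)).
  apply: eq_big_seq => a aO; apply: eq_big_seq => b bO.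
  by apply: transport_between => //; apply: O_rep.
rewrite exchange_big /=; apply: eq_bigr => b _.
rewrite -big_distrr /=; congr (_ * _).
rewrite -(@sumV_big _ _ _ _ _ (ball_seq e n b)).
  by apply: eq_sumV => y; rewrite -big_distrl /= sum_rep mul1r.
by move=> a _ x; rewrite mulf_eq0 negb_or => /andP[_ /tn'].
Qed.

End MassTransport.

(** All that is used below of unimodularity and quasi-transitivity. *)
Lemma mass_transport_exists (R : realType) (V : choiceType) (e : rel V) (c : V -> bool) :
  symmetric e -> connected_graph e -> locally_finite e -> unimodular e ->
  quasi_transitive e -> (forall x y, e x y -> c x != c y) ->
  exists (rep : V -> V) (orbs : seq V) (w : V -> R),
  [/\ forall b, 0 < w b, forall x, rep x \in orbs,
      forall x, exists2 g : graph_aut e, side_pres c g & g (rep x) = x,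
      forall (g : graph_aut e) x, side_pres c g -> rep (g x) = rep x &
      forall t, diag_inv e c t -> finite_range e t ->
        mean orbs w (fun x => sumV (t x)) = mean orbs w (fun y => sumV (t^~ y))].
Proof.
move=> e_sym e_conn e_lf e_unim e_qt e_col.
have [rep [orbs [Ou repO Orep repex repaut]]] := representatives e_conn e_lf e_qt e_col.
have [w [w0 waut wsize]] := modular_weight R e_conn e_lf e_unim.
exists rep, orbs, w; split => //.
exact: (mass_transport e_sym e_conn e_lf e_col Ou repO Orep repex repaut waut wsize).
Qed.

(** * Events and expectations of bounded functions *)

Section Expectation.
Context (d : measure_display) (T : measurableType d) (R : realType).
Variable u : probability T R.
Implicit Types (P Q : T -> Prop) (h k : T -> R).

(** Events are given by predicates, so that proofs of measurability follow the
    logical structure of the predicate. *)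
Definition event P : Prop := measurable [set f | P f].

Lemma event_not P : event P -> event (fun f => ~ P f).
Proof. exact: measurableC. Qed.

Lemma event_and P Q : event P -> event Q -> event (fun f => P f /\ Q f).
Proof. exact: measurableI. Qed.

Lemma event_or P Q : event P -> event Q -> event (fun f => P f \/ Q f).
Proof. exact: measurableU. Qed.

Lemma event_cst (p : Prop) : event (fun=> p).
Proof.
rewrite /event; have [hp|hp] := pselect p.
  by rewrite (_ : [set _ | _] = setT) ?measurableT //; apply/seteqP; split.
by rewrite (_ : [set _ | _] = set0) ?measurable0 //; apply/seteqP; split.
Qed.

Lemma event_ext P Q : (forall f, P f <-> Q f) -> event P -> event Q.
Proof. by move=> PQ; have -> : P = Q by apply/funext => f; apply/propext. Qed.

Lemma event_imp P Q : event P -> event Q -> event (fun f => P f -> Q f).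
Proof.
move=> eP eQ; apply: (@event_ext (fun f => ~ P f \/ Q f)).
  by move=> f; split => [[]//|PQ]; have [/PQ|] := pselect (P f); [right|left].
exact: event_or (event_not eP) eQ.
Qed.

Lemma event_ex (I : Type) (P : I -> T -> Prop) : countable [set: I] ->
  (forall i, event (P i)) -> event (fun f => exists i, P i f).
Proof.
move=> /countable_injP[g ginj] eP.
apply: (@event_ext (fun f => (\bigcup_n
   [set f | exists2 i, g i = n & P i f]) f)).
  by move=> f; split => [[n _ [i _ Pi]]|[i Pi]]; [exists i|exists (g i) => //; exists i].
apply: bigcupT_measurable => n; have [[i gi]|gn] := pselect (exists i, g i = n).
  apply: (@event_ext (P i)) (eP i) => f; split => [Pi|[j gj Pj]]; first by exists i.
  by rewrite (_ : i = j) //; apply: ginj; rewrite ?inE // gi gj.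
apply: (@event_ext (fun=> False)) (event_cst _) => f.
by split => // -[i gi _]; apply: gn; exists i.
Qed.

Lemma event_all (I : Type) (P : I -> T -> Prop) : countable [set: I] ->
  (forall i, event (P i)) -> event (fun f => forall i, P i f).
Proof.
move=> cI eP; apply: (@event_ext (fun f => ~ exists i, ~ P i f)).
  move=> f; split => [nP i|nP [i]]; last exact.
  by apply: contrapT => nPi; apply: nP; exists i.
by apply/event_not/event_ex => // i; apply/event_not.
Qed.

Definition bounded_rv h : Prop :=
  measurable_fun setT h /\ exists M, forall f, `|h f| <= M.

Definition Ex h : R := \int[u]_f h f.
Definition ind P : T -> R := fun f => (`[< P f >])%:R.
Definition Pr P : R := Ex (ind P).

Lemma ind_ge0 P f : 0 <= ind P f. Proof. exact: ler0n. Qed.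
Lemma ind_le1 P f : ind P f <= 1. Proof. by rewrite lern1 leq_b1. Qed.

Lemma ind_indic P : ind P = \1_[set f | P f].
Proof. by apply/funext => f; rewrite indicE /ind. Qed.

Lemma bounded_rv_ind P : event P -> bounded_rv (ind P).
Proof.
move=> eP; split; first by rewrite ind_indic; exact: measurable_indic.
by exists 1 => f; rewrite ger0_norm ?ind_ge0 ?ind_le1.
Qed.

Lemma bounded_rv_cst (a : R) : bounded_rv (fun=> a).
Proof. by split; [exact: measurable_cst | exists `|a|]. Qed.

Lemma bounded_rvD h k : bounded_rv h -> bounded_rv k ->
  bounded_rv (fun f => h f + k f).
Proof.
move=> [mh [M hM]] [mk [N kN]]; split; first exact: measurable_funD.
by exists (M + N) => f; apply: le_trans (ler_normD _ _) _; apply: lerD.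
Qed.

Lemma bounded_rvM h k : bounded_rv h -> bounded_rv k ->
  bounded_rv (fun f => h f * k f).
Proof.
move=> [mh [M hM]] [mk [N kN]]; split; first exact: measurable_funM.
by exists (M * N) => f; rewrite normrM; apply: ler_pM.
Qed.

Lemma bounded_rvZ a h : bounded_rv h -> bounded_rv (fun f => a * h f).
Proof. by move=> bh; apply: bounded_rvM => //; exact: bounded_rv_cst. Qed.

Lemma bounded_rvB h k : bounded_rv h -> bounded_rv k ->
  bounded_rv (fun f => h f - k f).
Proof.
move=> bh bk; have := bounded_rvD bh (bounded_rvZ (-1) bk).
by rewrite (_ : (fun f => _) = (fun f => h f - k f)) //; apply/funext => f; rewrite mulN1r.
Qed.

Lemma bounded_rv_norm h : bounded_rv h -> bounded_rv (fun f => `|h f|).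
Proof.
move=> [mh [M hM]]; split; first exact: measurableT_comp.
by exists M => f; rewrite normr_id.
Qed.

Lemma bounded_rv_sum (I : Type) (r : seq I) (F : I -> T -> R) :
  (forall i, bounded_rv (F i)) -> bounded_rv (fun f => \sum_(i <- r) F i f).
Proof.
move=> bF; elim: r => [|i r IH].
  rewrite (_ : (fun f => _) = (fun=> 0)); first exact: bounded_rv_cst.
  by apply/funext => f; rewrite big_nil.
rewrite (_ : (fun f => _) = (fun f => F i f + \sum_(j <- r) F j f)).
  exact: bounded_rvD.
by apply/funext => f; rewrite big_cons.
Qed.

Lemma bounded_rv_integrable h : bounded_rv h -> u.-integrable setT (EFin \o h).
Proof.
move=> [mh [M hM]]; apply: measurable_bounded_integrable => //.
  by rewrite (le_lt_trans (probability_le1 _ _)) ?ltry.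
exists M; split; first exact: num_real.
by move=> N MN f _; apply: le_trans (hM f) (ltW MN).
Qed.

Lemma ExD h k : bounded_rv h -> bounded_rv k ->
  Ex (fun f => h f + k f) = Ex h + Ex k.
Proof. by move=> bh bk; apply: RintegralD => //; exact: bounded_rv_integrable. Qed.

Lemma ExZ a h : bounded_rv h -> Ex (fun f => a * h f) = a * Ex h.
Proof. by move=> bh; apply: RintegralZl => //; exact: bounded_rv_integrable. Qed.

Lemma ExB h k : bounded_rv h -> bounded_rv k ->
  Ex (fun f => h f - k f) = Ex h - Ex k.
Proof. by move=> bh bk; apply: RintegralB => //; exact: bounded_rv_integrable. Qed.

Lemma Ex_cst a : Ex (fun=> a) = a.
Proof.
rewrite /Ex Rintegral_cst //.
rewrite -[RHS]mulr1; congr (_ * _).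
exact: (congr1 fine (probability_setT u)).
Qed.

Lemma Ex_ge0 h : (forall f, 0 <= h f) -> 0 <= Ex h.
Proof. by move=> h0; apply: Rintegral_ge0 => f _. Qed.

Lemma Ex_le h k : bounded_rv h -> bounded_rv k -> (forall f, h f <= k f) ->
  Ex h <= Ex k.
Proof.
by move=> bh bk hk; apply: le_Rintegral => //; exact: bounded_rv_integrable.
Qed.

Lemma Ex_sum (I : Type) (r : seq I) (F : I -> T -> R) :
  (forall i, bounded_rv (F i)) ->
  Ex (fun f => \sum_(i <- r) F i f) = \sum_(i <- r) Ex (F i).
Proof.
move=> bF; elim: r => [|i r IH].
  rewrite big_nil -[RHS]Ex_cst; congr Ex.
  by apply/funext => f; rewrite big_nil.
rewrite big_cons -IH -ExD //; last exact: bounded_rv_sum.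
by congr Ex; apply/funext => f; rewrite big_cons.
Qed.

Lemma Ex_norm h : bounded_rv h -> `|Ex h| <= Ex (fun f => `|h f|).
Proof. by move=> bh; apply: le_normr_Rintegral => //; exact: bounded_rv_integrable. Qed.

Lemma PrE P : event P -> (Pr P)%:E = u [set f | P f].
Proof.
move=> eP; rewrite /Pr /Ex ind_indic /Rintegral integral_indic // setIT fineK //.
exact: fin_num_measure.
Qed.

Lemma Pr_ge0 P : 0 <= Pr P.
Proof. by apply: Ex_ge0 => f; exact: ind_ge0. Qed.

Lemma Pr_le P Q : event P -> event Q -> (forall f, P f -> Q f) -> Pr P <= Pr Q.
Proof.
move=> eP eQ PQ; apply: Ex_le; [exact: bounded_rv_ind..|].
move=> f; rewrite /ind; case: (asboolP (P f)) => [/PQ Qf|_]; last exact: ler0n.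
by rewrite (asboolT Qf).
Qed.

Lemma Pr_le1 P : event P -> Pr P <= 1.
Proof.
move=> eP; rewrite -[leRHS](Ex_cst 1); apply: Ex_le => //.
- exact: bounded_rv_ind.
- exact: bounded_rv_cst.
- exact: ind_le1.
Qed.

Lemma Pr_false P : (forall f, ~ P f) -> Pr P = 0.
Proof.
move=> nP; rewrite /Pr -[RHS](Ex_cst 0); congr Ex; apply/funext => f.
by rewrite /ind asboolF.
Qed.

Lemma eq_Pr P Q : (forall f, P f <-> Q f) -> Pr P = Pr Q.
Proof. by move=> PQ; have -> : P = Q by apply/funext => f; apply/propext. Qed.

Lemma Pr_not P : event P -> Pr (fun f => ~ P f) = 1 - Pr P.
Proof.
move=> eP; rewrite /Pr -[X in X - _](Ex_cst 1) -ExB.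
- congr Ex; apply/funext => f; rewrite /ind asbool_neg.
  by case: (asbool (P f)); rewrite ?subr0 ?subrr.
- exact: bounded_rv_cst.
- exact: bounded_rv_ind.
Qed.

Lemma Pr_or P Q : event P -> event Q -> Pr (fun f => P f \/ Q f) <= Pr P + Pr Q.
Proof.
move=> eP eQ; rewrite /Pr -ExD; [|exact: bounded_rv_ind..].
apply: Ex_le; first by apply/bounded_rv_ind/event_or.
  by apply: bounded_rvD; exact: bounded_rv_ind.
move=> f; rewrite /ind asbool_or.
by case: (asbool (P f)); case: (asbool (Q f)); rewrite ?addr0 ?add0r ?lerDl.
Qed.

Lemma Pr_has (I : eqType) (s : seq I) (P : I -> T -> Prop) :
  (forall i, event (P i)) ->
  event (fun f => exists2 i, i \in s & P i f) /\
  Pr (fun f => exists2 i, i \in s & P i f) <= \sum_(i <- s) Pr (P i).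
Proof.
move=> eP; elim: s => [|a s [evs IH]].
  rewrite big_nil Pr_false; last by move=> f [].
  by split => //; apply: (@event_ext (fun=> False)); [move=> f; split => // -[] | exact: event_cst].
have E f : (P a f \/ exists2 i, i \in s & P i f) <-> (exists2 i, i \in a :: s & P i f).
  split => [[Pa|[i si Pi]]|[i]]; first by exists a; rewrite ?mem_head.
    by exists i => //; rewrite inE si orbT.
  by rewrite inE => /orP[/eqP ->|si] Pi; [left|right; exists i].
rewrite -(eq_Pr E) big_cons; split.
  by apply: event_ext E _; apply: event_or.
by apply: le_trans (Pr_or (eP a) evs) _; rewrite lerD2l.
Qed.

End Expectation.

(** * The product measure on labels *)

Section Labels.
Variables (R : realType) (V : choiceType).
Local Notation Om := (label_config R V).

Definition box (S : {fset V}) (B : V -> set R) : set Om :=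
  [set f : Om | forall v, v \in S -> B v (f v)%:num].

Definition boxes (A : set V) : set (set Om) :=
  [set E | exists (S : {fset V}) (B : V -> set R),
     [/\ [set` S] `<=` A, forall v, measurable (B v) & E = box S B]].

(** The events that only depend on the labels of the vertices of [A]. *)
Definition cyl (A : set V) : set (set Om) := <<s boxes A >>.

Lemma event_label v (B : set R) : measurable B ->
  event (fun f : Om => B (f v)%:num).
Proof. by move=> mB; apply: sub_sigma_algebra; exists v, B. Qed.

Lemma measurable_box S B : (forall v, measurable (B v)) -> measurable (box S B).
Proof.
move=> mB; rewrite (_ : box S B = \big[setI/setT]_(v <- S) [set f : Om | B v (f v)%:num]).
  by apply: bigsetI_measurable => v _; exact: event_label.
rewrite -bigcap_seq; apply/seteqP; split => f /= hf v; exact: hf.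
Qed.

Lemma boxes_measurable A : boxes A `<=` measurable.
Proof. by move=> _ [S [B [_ mB ->]]]; exact: measurable_box. Qed.

Lemma cyl_measurable A : cyl A `<=` measurable.
Proof.
apply: smallest_sub; last exact: boxes_measurable.
split; [exact: measurable0 | by move=> E mE; rewrite setTD; exact: measurableC|].
by move=> F mF; exact: bigcupT_measurable.
Qed.

Lemma cylT : cyl setT = measurable.
Proof.
apply/seteqP; split; first exact: cyl_measurable.
apply: smallest_sub; first exact: smallest_sigma_algebra.
move=> _ [v [B [mB ->]]]; apply: sub_sigma_algebra.
exists [fset v]%fset, (fun=> B); split => //.
apply/seteqP; split => f /=; first by move=> Bf v'; rewrite inE => /eqP ->.
by apply; rewrite inE.
Qed.

Lemma setI_boxes A : setI_closed (boxes A).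
Proof.
move=> _ _ [S [B [SA mB ->]]] [S' [B' [SA' mB' ->]]].
exists (S `|` S')%fset, (fun v => (if v \in S then B v else setT) `&`
                                (if v \in S' then B' v else setT)); split.
- by move=> v /=; rewrite inE => /orP[/SA|/SA'].
- by move=> v; apply: measurableI; case: ifP.
apply/seteqP; split => f /=.
  by move=> [hf hf'] v; rewrite inE => _; split; case: ifP => // ?; [apply: hf|apply: hf'].
move=> hf; split=> v vS.
  by have := hf v; rewrite inE vS => /(_ isT)[].
by have := hf v; rewrite inE vS orbT => /(_ isT)[].
Qed.

Lemma boxesT A : boxes A setT.
Proof.
exists fset0, (fun=> setT); split => //.
by apply/seteqP; split => // f _ v; rewrite inE.
Qed.

(** Boxes are closed under intersection, so Dynkin's theorem applies. *)
Lemma cyl_measure_unique A (m1 m2 : {measure set Om -> \bar R}) :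
  (m1 setT < +oo)%E -> (forall E, boxes A E -> m1 E = m2 E) ->
  forall E, cyl A E -> m1 E = m2 E.
Proof.
move=> m1oo m12; apply: (g_sigma_algebra_measure_unique (boxes A) _ (fun=> setT)) => //.
- exact: boxes_measurable.
- by move=> _; exact: boxesT.
- by rewrite bigcup_const.
- exact: setI_boxes.
Qed.

Lemma cyl_sub A A' : A `<=` A' -> cyl A `<=` cyl A'.
Proof.
move=> AA'; apply: smallest_sub; first exact: smallest_sigma_algebra.
move=> _ [S [B [SA mB ->]]]; apply: sub_sigma_algebra.
by exists S, B; split => // v /SA/AA'.
Qed.

Lemma cyl_depends A C : cyl A C ->
  forall f f' : Om, (forall v, A v -> f v = f' v) -> C f -> C f'.
Proof.
suff: cyl A `<=` [set C : set Om |
    forall f f' : Om, (forall v, A v -> f v = f' v) -> C f <-> C f'].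
  by move=> h hC f f' ff'; have [+ _] := h C hC f f' ff'.
apply: smallest_sub; first split => //.
- by move=> E hE f f' ff'; have := hE f f' ff'; rewrite /setD /=; tauto.
- move=> F hF f f' ff'; split => -[n _ Fn]; exists n => //.
    by apply/(hF n f f' ff').
  by apply/(hF n f f' ff').
move=> _ [S [B [SA _ ->]]] f f' ff'.
by split => hf v vS; have := hf v vS; rewrite ff' //; exact: SA.
Qed.

Variable e : rel V.
Local Notation act := (@act_label_config R V e).

Lemma cyl_act (g : graph_aut e) A C : cyl A C ->
  cyl (aut_inv g @` A) (act g @^-1` C).
Proof.
suff: cyl A `<=` [set C : set Om | cyl (aut_inv g @` A) (act g @^-1` C)] by apply.
apply: smallest_sub.
  have [c0 cD cU] := smallest_sigma_algebra setT (boxes (aut_inv g @` A)).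
  split => //=.
    by move=> E hE; rewrite setTD preimage_setC -setTD; exact: cD.
  by move=> F hF; rewrite preimage_bigcup; exact: cU.
move=> _ [S [B [SA mB ->]]]; apply: sub_sigma_algebra.
exists [fset aut_inv g v | v in S]%fset, (B \o g); split => //.
- by move=> _ /imfsetP[v /= vS ->]; exists v => //; exact: SA.
- by move=> v; exact: mB.
apply/seteqP; split => f /=; rewrite /box /act_label_config /=.
  by move=> hf _ /imfsetP[v /= vS ->]; rewrite aut_invK; exact: hf.
move=> hf v vS; rewrite -{1}(aut_invK g v); apply: hf.
by apply/imfsetP; exists v.
Qed.

Lemma measurable_act (g : graph_aut e) : measurable_fun setT (act g).
Proof.
move=> _ C mC; rewrite setTI -cylT.
have: cyl (aut_inv g @` setT) (act g @^-1` C) by apply: cyl_act; rewrite cylT.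
by apply: cyl_sub.
Qed.

Variable u : probability Om R.
Hypothesis u_prod : product_of_uniform u.

Lemma box_act (g : graph_aut e) S B : (forall v, measurable (B v)) ->
  u (act g @^-1` box S B) = u (box S B).
Proof.
move=> mB; have -> : act g @^-1` box S B = box [fset aut_inv g v | v in S]%fset (B \o g).
  apply/seteqP; split => f /=; rewrite /box /act_label_config /=.
    by move=> hf _ /imfsetP[v /= vS ->]; rewrite aut_invK; exact: hf.
  move=> hf v vS; rewrite -{1}(aut_invK g v); apply: hf.
  by apply/imfsetP; exists v.
rewrite /box !u_prod //= big_imfset /=; last first.
  by move=> v v' _ _; move=> /= E; exact: (can_inj (aut_invK g) E).
by apply: eq_bigr => v _; rewrite aut_invK.
Qed.

(** An automorphism permutes the coordinates, which all have the same law, so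
    it preserves the measures of boxes. *)
Lemma act_invariant (g : graph_aut e) (E : set Om) : measurable E ->
  u (act g @^-1` E) = u E.
Proof.
move=> mE; pose phi : {mfun Om >-> Om} :=
  HB.pack (act g) (isMeasurableFun.Build _ _ _ _ _ (measurable_act g)).
have := @cyl_measure_unique setT (pushforward u phi) u _ _ E.
rewrite cylT => h; apply: h => //.
- by apply: le_lt_trans (probability_le1 u (@measurableT _ Om)) _; rewrite ltry.
- by move=> _ [S [B [_ mB ->]]]; exact: box_act.
Qed.

Lemma Ex_act (g : graph_aut e) (h : Om -> R) : bounded_rv h ->
  Ex u (h \o act g) = Ex u h.
Proof.
move=> bh; pose phi : {mfun Om >-> Om} :=
  HB.pack (act g) (isMeasurableFun.Build _ _ _ _ _ (measurable_act g)).
rewrite /Ex /Rintegral; congr fine.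
transitivity (\int[pushforward u phi]_f (h f)%:E)%E.
  have mh : measurable_fun setT (fun f => (h f)%:E) by apply/measurable_EFinP; exact: bh.1.
rewrite integral_pushforward //=; first exact: measurable_act.
rewrite preimage_setT; apply: (@bounded_rv_integrable _ _ _ u (h \o act g)).
split; first by apply: measurableT_comp; [exact: bh.1 | exact: measurable_act].
by have [M hM] := bh.2; exists M => f; exact: hM.
by apply: eq_measure_integral => E mE _; exact: act_invariant.
Qed.

Lemma box_indep S S' B B' : (forall v, measurable (B v)) ->
  (forall v, measurable (B' v)) -> [disjoint S & S']%fset ->
  u (box S B `&` box S' B') = (u (box S B) * u (box S' B'))%E.
Proof.
move=> mB mB' dS.
have -> : box S B `&` box S' B' =
    box (S `|` S')%fset (fun v => if v \in S then B v else B' v).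
  apply/seteqP; split => f /=.
    move=> [hf hf'] v; rewrite inE; case: ifP => [vS _|_ /= vS']; first exact: hf.
    exact: hf'.
  move=> hf; split => v vS; have := hf v; rewrite inE vS ?orbT => /(_ isT) //.
  by case: ifP => // vS1; have := fdisjointP dS v vS1; rewrite vS.
have mB2 v : measurable (if v \in S then B v else B' v) by case: ifP.
rewrite /box (u_prod (S `|` S')%fset mB2) !u_prod //.
rewrite [LHS](perm_big (S ++ S')) /=; last first.
  rewrite uniq_perm ?fset_uniq // ?cat_uniq ?fset_uniq /= ?andbT.
    by apply/hasPn => v vS'; have := fdisjointP dS v; case: (v \in S) => // /(_ isT); rewrite vS'.
  by move=> v; rewrite mem_cat inE.
rewrite big_cat /=; congr (_ * _)%E; apply: eq_big_seq => v vS.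
  by rewrite vS.
by case: ifP => // vS1; have := fdisjointP dS v vS1; rewrite vS.
Qed.

Lemma cyl_indep_box A (E' : set Om) : measurable E' ->
  (forall E, boxes A E -> u (E `&` E') = (u E * u E')%E) ->
  forall E, cyl A E -> u (E `&` E') = (u E * u E')%E.
Proof.
move=> mE' h E cE.
pose r : {nonneg R} := NngNum (fine_ge0 (measure_ge0 u E')).
have rE : (r%:num)%:E = u E' by rewrite /= fineK //; exact: fin_num_measure.
have -> : (u E * u E')%E = mscale r u E by rewrite /mscale /= -rE muleC.
have -> : u (E `&` E') = mrestr u mE' E by [].
apply: (@cyl_measure_unique A) => //.
  by apply: le_lt_trans (probability_le1 u (measurableI _ _ measurableT mE')) _; rewrite ltry.
move=> F bF; transitivity (u (F `&` E')) => //.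
by rewrite h // -rE muleC.
Qed.

(** When one event is fixed, both sides are finite measures of the other one,
    so that it suffices to compare them on boxes, in one argument after the
    other. *)
Lemma cyl_indep A A' E E' : A `&` A' = set0 -> cyl A E -> cyl A' E' ->
  u (E `&` E') = (u E * u E')%E.
Proof.
move=> AA' cE cE'; apply: (@cyl_indep_box A) => //; first exact: cyl_measurable cE'.
move=> F bF; rewrite setIC muleC; apply: (@cyl_indep_box A') => //.
  exact: boxes_measurable bF.
move=> F' [S' [B' [SA' mB' ->]]]; case: bF => S [B [SA mB ->]].
apply: box_indep => //; apply/fdisjointP => v vS'; apply/negP => vS.
by have : (A `&` A') v by [split; [exact: SA|exact: SA']]; rewrite AA'.
Qed.

End Labels.

Section NullEvents.
Context (d : measure_display) (T : measurableType d) (R : realType).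
Variable u : probability T R.

Lemma Pr_ex_null (I : Type) (P : I -> T -> Prop) : countable [set: I] ->
  (forall i, event (P i)) -> (forall i, Pr u (P i) = 0) ->
  Pr u (fun f => exists i, P i f) = 0.
Proof.
move=> cI eP P0; have eU := event_ex cI eP.
have null i : u.-negligible [set f | P i f].
  apply/negligibleP; first exact: eP.
  by have := PrE u (eP i); rewrite P0 => /esym.
have : u.-negligible [set f | exists i, P i f].
  have /countable_injP[g ginj] := cI.
  suff H : u.-negligible (\bigcup_n [set f | exists2 i, g i = n & P i f]).
    by apply: negligibleS H => f [i Pi]; exists (g i) => //; exists i.
  apply: negligible_bigcup => n; have [[i gi]|gn] := pselect (exists i, g i = n).
    apply: negligibleS (null i) => f [j gj Pj].
    by rewrite (_ : i = j) //; apply: ginj; rewrite ?inE // gi gj.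
  by apply: negligibleS (negligible_set0 _) => f [i gi _]; apply: gn; exists i.
move/(negligibleP u eU) => U0.
by have := PrE u eU; rewrite [RHS]U0 => -[].
Qed.

Lemma Pr_small P : (forall eps : R, 0 < eps -> Pr u P <= eps) -> Pr u P = 0.
Proof.
move=> h; apply/le_anti; rewrite Pr_ge0 andbT.
by apply/ler_addgt0Pr => eps e0; rewrite add0r; exact: h.
Qed.

End NullEvents.

Lemma countable_seq (T : Type) : countable [set: T] -> countable [set: seq T].
Proof.
move=> /countable_injP[g ginj]; apply/countable_injP.
exists (fun s => choice.pickle (map g s)) => s s' _ _ /(pcan_inj choice.pickleK).
by apply: inj_map => x y; apply: ginj; rewrite inE.
Qed.

Section Approximation.
Variables (R : realType) (V : choiceType).
Local Notation Om := (label_config R V).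
Variable u : probability Om R.

(** The probability of the symmetric difference. *)
Definition dist_ev (E C : set Om) : R := Ex u (fun f => `|ind R E f - ind R C f|).

Lemma bounded_rv_dist E C : measurable E -> measurable C ->
  bounded_rv (fun f : Om => `|ind R E f - ind R C f|).
Proof.
by move=> mE mC; apply/bounded_rv_norm/bounded_rvB; exact: bounded_rv_ind.
Qed.

(** Every event is approximated by events that depend on finitely many labels:
    the events with this property form a sigma-algebra. *)
Lemma approx_cyl (E : set Om) : measurable E -> forall eps : R, 0 < eps ->
  exists (S : {fset V}) (C : set Om), cyl [set` S] C /\ dist_ev E C < eps.
Proof.
pose good E := measurable E /\ forall eps : R, 0 < eps ->
  exists (S : {fset V}) (C : set Om), cyl [set` S] C /\ dist_ev E C < eps.
suff: measurable `<=` good by move=> h /h[].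
have dist_refl C : dist_ev C C = 0.
  by rewrite /dist_ev -[RHS](Ex_cst u 0); congr Ex; apply/funext => f; rewrite subrr normr0.
have goodU A B : good A -> good B -> good (A `|` B).
  move=> [mA hA] [mB hB]; split; first exact: measurableU.
  move=> eps e0; have e2 : 0 < eps / 2 by rewrite divr_gt0.
  have [S [C [cC dC]]] := hA _ e2; have [S' [C' [cC' dC']]] := hB _ e2.
  exists (S `|` S')%fset, (C `|` C'); split.
    have sS : [set` S] `<=` [set` (S `|` S')%fset] by move=> v /= vS; rewrite inE vS.
    have sS' : [set` S'] `<=` [set` (S `|` S')%fset] by move=> v /= vS; rewrite inE vS orbT.
    have [_ cD cU] := smallest_sigma_algebra setT (@boxes R V [set` (S `|` S')%fset]).
    rewrite -bigcup2E; apply: cU => -[|[|n]] /=.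
    - exact: cyl_sub sS _ cC.
    - exact: cyl_sub sS' _ cC'.
    - by case: (smallest_sigma_algebra setT (@boxes R V [set` (S `|` S')%fset])).
  have mC := cyl_measurable cC; have mC' := cyl_measurable cC'.
  apply: (@le_lt_trans _ _ (dist_ev A C + dist_ev B C')); last by rewrite (splitr eps) ltrD.
  rewrite /dist_ev -ExD; [|exact: bounded_rv_dist..].
  apply: Ex_le; first by apply: bounded_rv_dist; exact: measurableU.
    by apply: bounded_rvD; exact: bounded_rv_dist.
  move=> f; rewrite /ind /setU /= !asbool_or.
  case: (asbool (A f)); case: (asbool (B f)); case: (asbool (C f));
    case: (asbool (C' f)); rewrite /= ?subr0 ?sub0r ?subrr ?normr0 ?normrN ?normr1; lra.
have good0 : good set0.
  split; first exact: measurable0.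
  move=> eps e0; exists fset0, set0; rewrite dist_refl; split => //.
  by case: (smallest_sigma_algebra setT (@boxes R V [set` fset0])).
rewrite -cylT; apply: smallest_sub; first split => //.
- move=> A [mA hA]; rewrite setTD; split; first exact: measurableC.
  move=> eps /hA[S [C [cC dC]]]; exists S, (~` C); split.
    have [_ cD _] := smallest_sigma_algebra setT (@boxes R V [set` S]).
    by rewrite -setTD; exact: cD.
  apply: le_lt_trans dC; rewrite /dist_ev le_eqVlt; apply/orP; left; apply/eqP.
  congr Ex; apply/funext => f; rewrite /ind /setC /= !asbool_neg.
  by case: (asbool (A f)); case: (asbool (C f)); rewrite /= ?subr0 ?sub0r ?subrr ?normrN.
- move=> F hF; have mU : measurable (\bigcup_k F k) by apply: bigcupT_measurable => k; have [] := hF k.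
  split => // eps e0; pose D n := \big[setU/set0]_(k < n.+1) F k.
  have gD n : good (D n).
    rewrite /D; elim: n => [|n IH]; rewrite big_ord_recr /= ?big_ord0 ?set0U //.
    exact: goodU.
  have e2 : 0 < eps / 2 by rewrite divr_gt0.
  have DU : \bigcup_n D n = \bigcup_n F n by exact: bigcup_bigsetU_bigcup.
  have Dle n : D n `<=` \bigcup_k F k by exact: bigsetU_bigcup.
  have dE n : dist_ev (\bigcup_k F k) (D n) =
      Pr u (\bigcup_k F k) - Pr u (D n).
    rewrite -ExB; [|exact: bounded_rv_ind mU|exact: bounded_rv_ind (gD n).1].
    congr Ex; apply/funext => f; rewrite ger0_norm // subr_ge0 /ind.
    by case: (asboolP (D n f)) => [/Dle h|_]; [rewrite asboolT|exact: ler0n].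
  have [N hN] : exists N, dist_ev (\bigcup_k F k) (D N) < eps / 2.
    have Dnd : nondecreasing_seq D.
      apply/nondecreasing_seqP => n; rewrite /D [X in (_ <= X)%O]big_ord_recr /=.
      by apply/subsetPset; exact: subsetUl.
    have := @nondecreasing_cvg_mu _ _ _ u D (fun n => (gD n).1).
    rewrite DU => /(_ mU Dnd) cv.
    have UE := PrE u (mU : event (\bigcup_k F k)).
    have : fine (u (D n)) @[n --> \oo] --> Pr u (\bigcup_k F k).
      by apply: fine_cvg; rewrite UE.
    move/cvgrPdist_lt => /(_ _ e2)[N _ hN]; exists N; rewrite dE.
    have := hN N (leqnn N); rewrite -[u (D N)](PrE u ((gD N).1 : event (D N))) /=.
    exact: le_lt_trans (ler_norm _).
  have [_ /(_ _ e2)[S [C [cC dC]]]] := gD N; exists S, C; split => //.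
  have mC := cyl_measurable cC; have mD := (gD N).1.
  apply: (@le_lt_trans _ _ (dist_ev (\bigcup_k F k) (D N) + dist_ev (D N) C)).
    rewrite /dist_ev -ExD; [|exact: bounded_rv_dist..].
    apply: Ex_le; first exact: bounded_rv_dist.
      by apply: bounded_rvD; exact: bounded_rv_dist.
    by move=> f; exact: ler_distD.
  by rewrite (splitr eps) ltrD.
- move=> E' bE; split; first exact: boxes_measurable bE.
  move: bE => [S [B [_ mB ->]]] eps e0; exists S, (box S B); rewrite dist_refl; split => //.
  by apply: sub_sigma_algebra; exists S, B; split.
Qed.

End Approximation.

(** * Digits of the labels *)

Section Digits.
Variables (R : realType) (V : choiceType).
Local Notation Om := (label_config R V).
Variable u : probability Om R.
Hypothesis (u_prod : product_of_uniform u) (cV : countable [set: V]).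

(** Rounded labels replace the labels in the construction of the matching,
    because there are only countably many lists of digits. *)
Definition digit n (f : Om) v : nat := Num.trunc (n.+1%:R * (f v)%:num : R).

Definition digit_set n k : set R := `[k%:R / n.+1%:R, k.+1%:R / n.+1%:R[.

Lemma digitE n f v k : digit n f v = k <-> digit_set n k (f v)%:num.
Proof.
have f0 : 0 <= n.+1%:R * ((f v)%:num : R) by rewrite mulr_ge0.
have E : (k%:R <= n.+1%:R * ((f v)%:num : R) < k.+1%:R) = (digit n f v == k).
  by rewrite /digit truncn_eq.
rewrite /digit_set /= in_itv /= ler_pdivrMr ?ltr0n // ltr_pdivlMr ?ltr0n //.
by rewrite mulrC E; split => /eqP.
Qed.

Lemma measurable_digit_set n k : measurable (digit_set n k).
Proof. exact: measurable_itv. Qed.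

Lemma event_digit n v k : event (fun f : Om => digit n f v = k).
Proof.
apply: event_ext (event_label v (measurable_digit_set n k)) => f.
by split => /digitE.
Qed.

Lemma lebesgue_digit_set n k :
  (lebesgue_measure (digit_set n k `&` `[0%R, 1%R]) <= (n.+1%:R^-1)%:E)%E.
Proof.
apply: (@le_trans _ _ (lebesgue_measure (digit_set n k))).
  apply: le_measure; rewrite ?inE; last exact: subIsetl.
    by apply: measurableI; [exact: measurable_digit_set|exact: measurable_itv].
  exact: measurable_digit_set.
rewrite /digit_set lebesgue_measure_itv /= lte_fin ltr_pM2r ?invr_gt0 ?ltr0n //.
rewrite ltr_nat ltnSn -EFinB lee_fin -mulrBl -natrB ?leqnSn // subSnn mul1r.
exact: lexx.
Qed.

Lemma Pr_digit n v k : Pr u (fun f => digit n f v = k) <= n.+1%:R^-1.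
Proof.
rewrite -lee_fin PrE; last exact: event_digit.
apply: le_trans (lebesgue_digit_set n k).
rewrite (_ : [set f | _] = box [fset v]%fset (fun=> digit_set n k)).
  rewrite /box (@u_prod [fset v]%fset (fun=> digit_set n k)) ?big_seq_fset1 //.
  by move=> _; exact: measurable_digit_set.
apply/seteqP; split => f /=.
  by move=> /digitE h v'; rewrite inE => /eqP ->.
by move=> h; apply/digitE; apply: h; rewrite inE.
Qed.

(* the label 1 has the digit n + 1 *)
Lemma digit_le n f v : (digit n f v < n.+2)%N.
Proof.
have f0 : 0 <= n.+1%:R * ((f v)%:num : R) by rewrite mulr_ge0.
have /andP[h _] := truncn_itv f0; rewrite ltnS -(ler_nat R).
by apply: le_trans h _; rewrite ler_piMr ?ler0n.
Qed.

Lemma Pr_digit_pair n v w k : v != w ->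
  Pr u (fun f => digit n f v = k /\ digit n f w = k) =
  Pr u (fun f => digit n f v = k) * Pr u (fun f => digit n f w = k).
Proof.
move=> vw; have mB : forall v : V, measurable (digit_set n k) by move=> _; exact: measurable_digit_set.
apply/EFin_inj; rewrite EFinM !PrE; try exact: event_digit; last first.
  by apply: event_and; exact: event_digit.
have E x : [set f : Om | digit n f x = k] = box [fset x]%fset (fun=> digit_set n k).
  apply/seteqP; split => f /=.
    by move=> /digitE h v'; rewrite inE => /eqP ->.
  by move=> h; apply/digitE; apply: h; rewrite inE.
rewrite !E -(box_indep u_prod mB mB); last first.
  by apply/fdisjointP => x; rewrite !inE => /eqP ->.
by rewrite -!E.
Qed.

Lemma Pr_digit_eq n v w : v != w ->
  Pr u (fun f => digit n f v = digit n f w) <= n.+1%:R^-1.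
Proof.
move=> vw; pose P k (f : Om) := digit n f v = k /\ digit n f w = k.
have eP k : event (P k) by apply: event_and; exact: event_digit.
have E f : (exists2 k, k \in iota 0 n.+2 & P k f) <-> digit n f v = digit n f w.
  split => [[k _ [-> ->]] //|vwE]; exists (digit n f v); last by split.
  by rewrite mem_iota /= add0n digit_le.
have [_ le_ev] := Pr_has u (iota 0 n.+2) eP.
rewrite -(eq_Pr u E); apply: le_trans le_ev _.
apply: (@le_trans _ _ (\sum_(k <- iota 0 n.+2) n.+1%:R^-1 * Pr u (fun f => digit n f w = k))).
  apply: ler_sum => k _; rewrite /P Pr_digit_pair //.
  by apply: ler_wpM2r; [exact: Pr_ge0|exact: Pr_digit].
rewrite -mulr_sumr ler_piMr ?invr_ge0 ?ler0n //.
rewrite /Pr -Ex_sum; last by move=> k; apply: bounded_rv_ind; exact: event_digit.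
rewrite -[leRHS](Ex_cst u 1); apply: Ex_le; last first.
- move=> f; rewrite (bigD1_seq (digit n f w)) ?mem_iota ?iota_uniq //=; last first.
    by rewrite add0n digit_le.
  rewrite /ind asboolT // big1 ?addr0 // => k /eqP kw.
  by rewrite asboolF // => E'; apply: kw.
- exact: bounded_rv_cst.
- by apply: bounded_rv_sum => k; apply: bounded_rv_ind; exact: event_digit.
Qed.

Definition separated (s : seq V) n (f : Om) : Prop :=
  forall v w, v \in s -> w \in s -> digit n f v = digit n f w -> v = w.

Lemma event_digit_eq n v w : event (fun f : Om => digit n f v = digit n f w).
Proof.
apply: (@event_ext _ _ (fun f => exists k, digit n f v = k /\ digit n f w = k)).
  by move=> f; split => [[k [-> ->]]//|E]; exists (digit n f w).
apply: event_ex; first exact: countableP.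
by move=> k; apply: event_and; exact: event_digit.
Qed.

Lemma event_separated s n : event (separated s n).
Proof.
apply: event_all => // v; apply: event_all => // w.
do 2 apply: (event_imp (event_cst _ _)).
by apply: event_imp; [exact: event_digit_eq | exact: event_cst].
Qed.

(** Two given labels have the same digit with probability at most
    [1 / (n + 1)], which leaves a union bound over the pairs of vertices. *)
Lemma separated_null (s : seq V) :
  event (fun f => exists n, separated s n f) /\
  Pr u (fun f => ~ exists n, separated s n f) = 0.
Proof.
pose t := [seq p <- [seq (v, w) | v <- s, w <- s] | p.1 != p.2].
pose Q n (p : V * V) (f : Om) := p.1 != p.2 /\ digit n f p.1 = digit n f p.2.
have eQ n p : event (Q n p) by apply: event_and; [exact: event_cst|exact: event_digit_eq].
have QE n f : (exists2 p, p \in t & Q n p f) <-> ~ separated s n f.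
  split.
    move=> [[v w]]; rewrite mem_filter /=.
    move=> /andP[vw /allpairsP[[a b] /= [asx bsx [E1 E2]]]] [/= _ ab] sep.
    by subst v w; move/eqP: vw; apply; exact: sep.
  move=> ns; apply: contrapT => nex; apply: ns => v w vs ws dvw.
  apply/eqP; apply: contrapT => /negP vw; apply: nex; exists (v, w); last by split.
  by rewrite mem_filter vw /=; apply/allpairsP; exists (v, w).
have PQ n p : Pr u (Q n p) <= n.+1%:R^-1.
  have [pE|pE] := eqVneq p.1 p.2.
    by rewrite Pr_false ?invr_ge0 ?ler0n // => f []; rewrite pE eqxx.
  rewrite (@eq_Pr _ _ _ _ _ (fun f => digit n f p.1 = digit n f p.2)).
    exact: Pr_digit_eq.
  by move=> f; rewrite /Q; split => // -[].
have eex : event (fun f => exists n, separated s n f).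
  by apply: event_ex => [|n]; [exact: countableP|exact: event_separated].
split => //; apply: Pr_small => eps e0.
pose M : R := (size t)%:R.
have [n hn] : exists n, M * n.+1%:R^-1 <= eps.
  exists (Num.trunc (M / eps)); rewrite ler_pdivrMr ?ltr0n // -ler_pdivrMl //.
  have /truncn_itv/andP[_ /ltW] : 0 <= M / eps by rewrite divr_ge0 ?ler0n ?ltW.
  by rewrite mulrC.
apply: le_trans hn; have [ev le_ev] := Pr_has u t (eQ n).
apply: (@le_trans _ _ (Pr u (fun f => exists2 p, p \in t & Q n p f))).
  apply: Pr_le => //; first exact: event_not.
  by move=> f nsep; apply/QE => sep; apply: nsep; exists n.
apply: le_trans le_ev _.
apply: (@le_trans _ _ (\sum_(p <- t) n.+1%:R^-1)); first by apply: ler_sum => p _; exact: PQ.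
by rewrite big_const_seq count_predT iter_addr_0 /M mulr_natl.
Qed.

End Digits.

(** * Matchings and augmenting paths *)

Section Augmenting.
Variables (V : choiceType) (e : rel V) (c : V -> bool).
Hypotheses (e_sym : symmetric e) (e_irr : irreflexive e)
  (e_conn : connected_graph e) (e_lf : locally_finite e)
  (e_col : forall x y, e x y -> c x != c y).

Implicit Types (m : V -> V) (x y : V) (ys : seq V).

(** A matching is encoded by the involution that fixes the unmatched vertices
    and exchanges the two ends of each of its edges. *)
Definition matching m := (forall x, m (m x) = x) /\ forall x, m x != x -> e x (m x).

Definition pt x ys i := nth x (x :: ys) i.

(** With [ys = [:: y_1; ...; y_n]] this is the augmenting path
    [x, y_1, m y_1, y_2, m y_2, ..., y_n]: only every other vertex is listed,
    because the matching determines the remaining ones. *)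
Definition aug m x ys : Prop :=
  [/\ (0 < size ys)%N /\ uniq (x :: ys), m x = x,
      m (pt x ys (size ys)) = pt x ys (size ys),
      forall i, (i < size ys)%N -> e (m (pt x ys i)) (pt x ys i.+1) &
      forall i, (0 < i < size ys)%N -> m (pt x ys i) != pt x ys i].

(** The edges of the path that do not belong to the matching. *)
Definition aug_edge m x ys a b : Prop :=
  exists i, [/\ (i < size ys)%N, a = m (pt x ys i) & b = pt x ys i.+1].

Definition on_path m x ys v : Prop :=
  exists2 i, (i < size ys)%N & v = m (pt x ys i) \/ v = pt x ys i.+1.

Definition path_seq m x ys : seq V :=
  [seq m (pt x ys i) | i <- iota 0 (size ys)] ++ ys.

Lemma matching_inj m : matching m -> injective m.
Proof. by move=> [mm _]; exact: can_inj mm. Qed.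

Lemma matching_side m x : matching m -> m x != x -> c (m x) != c x.
Proof. by move=> [_ me] /me /e_col; rewrite eq_sym. Qed.

Lemma on_pathP m x ys v : on_path m x ys v -> v \in path_seq m x ys.
Proof.
move=> [i ilt [->|->]]; rewrite mem_cat; last by rewrite /pt /= mem_nth ?orbT.
by apply/orP; left; apply/mapP; exists i; rewrite ?mem_iota.
Qed.

Lemma pt_inj m x ys i j : aug m x ys -> (i <= size ys)%N -> (j <= size ys)%N ->
  pt x ys i = pt x ys j -> i = j.
Proof.
by move=> [[_ us] _ _ _ _] il jl /eqP; rewrite nth_uniq ?ltnS // => /eqP.
Qed.

Lemma aug_sides m x ys i : matching m -> aug m x ys -> (i < size ys)%N ->
  c (m (pt x ys i)) = c x /\ c (pt x ys i.+1) = ~~ c x.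
Proof.
move=> mm [[s0 us] mx _ ed mz]; elim: i => [|i IH] il.
  rewrite /pt /= mx; split => //; have := e_col (ed 0%N il).
  by rewrite /pt /= mx; case: (c x); case: (c _).
have [_ h] := IH (ltnW il).
have := matching_side mm (mz i.+1 il); rewrite h => h'.
have h2 : c (m (pt x ys i.+1)) = c x by case: (c x) (c (m _)) h' => [] [].
by split => //; have := e_col (ed i.+1 il); rewrite h2; case: (c x); case: (c _).
Qed.

Section OnePath.
Variables (m : V -> V) (x : V) (ys : seq V).
Hypotheses (mm : matching m) (mxy : aug m x ys).

Lemma aug_edge_fun a b b' : aug_edge m x ys a b -> aug_edge m x ys a b' -> b = b'.
Proof.
move=> [i [il -> ->]] [j [jl /(matching_inj mm) E ->]].
by rewrite (pt_inj mxy (ltnW il) (ltnW jl) E).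
Qed.

Lemma aug_edge_inj a a' b : aug_edge m x ys a b -> aug_edge m x ys a' b -> a = a'.
Proof.
by move=> [i [il -> ->]] [j [jl -> /(pt_inj mxy il jl)[->]]].
Qed.

Lemma aug_edge_disj a b d : aug_edge m x ys a b -> aug_edge m x ys b d -> False.
Proof.
move=> [i [il _ ->]] [j [jl E _]].
have := (aug_sides mm mxy il).2; have := (aug_sides mm mxy jl).1.
by rewrite E => ->; case: (c x).
Qed.

Lemma aug_edge_adj a b : aug_edge m x ys a b -> e a b.
Proof. by case: mxy => _ _ _ ed _ [i [il -> ->]]; exact: ed. Qed.

Lemma on_path_edge a : on_path m x ys a ->
  exists b, aug_edge m x ys a b \/ aug_edge m x ys b a.
Proof.
move=> [i il [->|->]]; first by exists (pt x ys i.+1); left; exists i.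
by exists (m (pt x ys i)); right; exists i.
Qed.

Lemma aug_edge_on a b : aug_edge m x ys a b -> on_path m x ys a /\ on_path m x ys b.
Proof. by move=> [i [il -> ->]]; split; exists i => //; [left|right]. Qed.

Lemma on_path_mate a : on_path m x ys (m a) -> on_path m x ys a.
Proof.
case: mm => mK _; case: mxy => [[s0 _] mx my _ _] [i il [/(matching_inj mm) ->|E]].
  case: i il => [|i] il; last by exists i; [exact: ltnW|right].
  by exists 0%N => //; left; rewrite /pt /= mx.
have aE : a = m (pt x ys i.+1) by rewrite -E mK.
move: il; rewrite leq_eqVlt => /orP[/eqP isz|il]; last by exists i.+1 => //; left.
by exists i; [rewrite isz|right; rewrite aE isz my].
Qed.

Lemma aug_start_on : on_path m x ys x.
Proof. by case: mxy => [[s0 _] mx _ _ _]; exists 0%N => //; left; rewrite /pt /= mx. Qed.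

Lemma mate_ball a : m a \in ball_seq e 1 a.
Proof.
by have [->|/(proj2 mm)/(ball1 e_lf)//] := eqVneq (m a) a; exact: ball0.
Qed.

Lemma pt_ball i : (i <= size ys)%N -> pt x ys i \in ball_seq e i.*2 x.
Proof.
case: mxy => _ mx _ ed _; elim: i => [|i IH] il; first by rewrite /pt /= inE.
rewrite doubleS -addn2; apply: (ball_trans e_lf (IH (ltnW il))).
by apply: (ball_trans (n := 1) (m := 1) e_lf (mate_ball _)); apply/(ball1 e_lf)/ed.
Qed.

Lemma on_path_ball a : on_path m x ys a -> a \in ball_seq e (size ys).*2 x.
Proof.
move=> [i il [->|->]].
  apply: (@ball_le _ _ (i.*2 + 1)); first by lia.
  by apply: (ball_trans e_lf (pt_ball (ltnW il))); exact: mate_ball.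
by apply: (@ball_le _ _ i.+1.*2); [rewrite leq_double|exact: pt_ball].
Qed.

End OnePath.

Lemma aug_local m m' x ys : {in x :: ys, m =1 m'} -> aug m x ys -> aug m' x ys.
Proof.
move=> E [[s0 us] mx my ed mz].
have ptin i : (i <= size ys)%N -> pt x ys i \in x :: ys by move=> il; rewrite mem_nth.
split => //; first by rewrite -E ?mem_head.
- by rewrite -E ?ptin.
- by move=> i il; rewrite -E ?ptin 1?ltnW // ed.
- by move=> i /andP[i0 il]; rewrite -E ?ptin 1?ltnW // mz ?i0.
Qed.

Lemma aug_edge_local m m' x ys a b : {in x :: ys, m =1 m'} ->
  aug_edge m x ys a b -> aug_edge m' x ys a b.
Proof.
move=> E [i [il -> ->]]; exists i; split => //; apply: E.
by rewrite mem_nth //= ltnS ltnW.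
Qed.

Definition conj_aut (g : graph_aut e) m : V -> V := fun v => g (m (aut_inv g v)).

Lemma pt_aut (g : graph_aut e) x ys i : (i <= size ys)%N ->
  pt (g x) (map g ys) i = g (pt x ys i).
Proof. by move=> il; rewrite /pt -map_cons (nth_map x). Qed.

Lemma aug_aut (g : graph_aut e) m x ys : aug m x ys ->
  aug (conj_aut g m) (g x) (map g ys).
Proof.
move=> [[s0 us] mx my ed mz]; split; rewrite ?size_map.
- by split => //; rewrite -map_cons map_inj_uniq //; exact: aut_inj.
- by rewrite /conj_aut aut_funK mx.
- by rewrite pt_aut // /conj_aut aut_funK my.
- by move=> i il; rewrite (pt_aut g x (ltnW il)) (pt_aut g x il) /conj_aut aut_funK aut_adj ed.
- move=> i /andP[i0 il]; rewrite (pt_aut g x (ltnW il)) /conj_aut aut_funK.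
  by rewrite (inj_eq (@aut_inj _ _ g)) mz ?i0.
Qed.

Lemma aug_edge_aut (g : graph_aut e) m x ys a b : aug_edge m x ys a b ->
  aug_edge (conj_aut g m) (g x) (map g ys) (g a) (g b).
Proof.
move=> [i [il -> ->]]; exists i; rewrite size_map; split => //.
  by rewrite pt_aut 1?ltnW // /conj_aut aut_funK.
by rewrite pt_aut.
Qed.

Lemma on_path_aut (g : graph_aut e) m x ys v : on_path m x ys v ->
  on_path (conj_aut g m) (g x) (map g ys) (g v).
Proof.
move=> [i il h]; exists i; rewrite ?size_map // (pt_aut g x (ltnW il)) (pt_aut g x il).
by rewrite /conj_aut aut_funK; case: h => ->; [left|right].
Qed.

Lemma conj_rev (g : graph_aut e) m : conj_aut (aut_rev g) (conj_aut g m) = m.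
Proof. by apply/funext => v; rewrite /conj_aut /= !aut_funK. Qed.

Lemma conj_matching (g : graph_aut e) m : matching m -> matching (conj_aut g m).
Proof.
move=> [mK me]; split => v; rewrite /conj_aut; first by rewrite aut_funK mK aut_invK.
move=> h; rewrite -{1}(aut_invK g v) aut_adj; apply: me.
by apply: contraNneq h => ->; rewrite aut_invK.
Qed.

(** * Flipping disjoint augmenting paths *)

Section Flip.
Variables (sel : V -> seq V -> Prop).

Definition flip_edge m a b : Prop := exists x ys, [/\ aug m x ys, sel x ys &
  aug_edge m x ys a b \/ aug_edge m x ys b a].

(** Exchanges matching and non-matching edges on all selected augmenting paths
    at once. On these paths the new mate is given by the non-matching edges. *)
Definition flip m a : V := xget (m a) [set b | flip_edge m a b].

(** Selected paths that meet are equal, so that their flips do not interfere. *)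
Definition sel_disjoint m := forall x ys x' ys' v,
  aug m x ys -> sel x ys -> on_path m x ys v ->
  aug m x' ys' -> sel x' ys' -> on_path m x' ys' v -> x = x' /\ ys = ys'.

Variable m : V -> V.
Hypotheses (mm : matching m) (dis : sel_disjoint m).

Lemma flip_edge_fun a b b' : flip_edge m a b -> flip_edge m a b' -> b = b'.
Proof.
move=> [x [ys [axy sxy h]]] [x' [ys' [axy' sxy' h']]].
have o1 : on_path m x ys a by case: h => /aug_edge_on[].
have o2 : on_path m x' ys' a by case: h' => /aug_edge_on[].
have [? ?] := dis axy sxy o1 axy' sxy' o2; subst x' ys'.
case: h h' => h [] h'.
- exact: aug_edge_fun mm axy _ _ _ h h'.
- by case: (aug_edge_disj mm axy h' h).
- by case: (aug_edge_disj mm axy h h').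
- exact: aug_edge_inj axy _ _ _ h h'.
Qed.

Lemma flip_edge_sym a b : flip_edge m a b -> flip_edge m b a.
Proof. by move=> [x [ys [? ? []]]]; exists x, ys; split => //; [right|left]. Qed.

Lemma flip_edge_adj a b : flip_edge m a b -> e a b.
Proof.
by move=> [x [ys [axy _ []]]] /(aug_edge_adj axy) //; rewrite e_sym.
Qed.

Lemma flipE a b : flip m a = b <->
  flip_edge m a b \/ (~ exists b', flip_edge m a b') /\ m a = b.
Proof.
rewrite /flip; split.
  case: xgetP => [y -> hy <-|no]; first by left.
  by move=> <-; right; split => // -[b' hb']; exact: (no b').
case=> [h|[no <-]]; last by case: xgetP => // y _ hy; case: no; exists y.
case: xgetP => [y -> hy|/(_ b)/(_ h) //]; exact: flip_edge_fun hy h.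
Qed.

Lemma flip_edge_mate a b : flip_edge m (m a) b -> exists b', flip_edge m a b'.
Proof.
move=> [x [ys [axy sxy h]]].
have /(on_path_mate mm axy)/on_path_edge[b' hb'] : on_path m x ys (m a).
  by case: h => /aug_edge_on[].
by exists b', x, ys.
Qed.

Lemma flip_matching : matching (flip m).
Proof.
case: (mm) => mK me; split=> a.
  case/flipE: (erefl (flip m a)) => [h|[no <-]].
    by apply/flipE; left; exact: flip_edge_sym.
  apply/flipE; right; split; last exact: mK.
  by move=> [b /flip_edge_mate].
case/flipE: (erefl (flip m a)) => [/flip_edge_adj //|[no <-]]; exact: me.
Qed.

Lemma flip_matched a : m a != a -> flip m a != a.
Proof.
move=> ma; case/flipE: (erefl (flip m a)) => [/flip_edge_adj|[no <-] //].
by apply: contraTneq => ->; rewrite e_irr.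
Qed.

Lemma flip_on_path x ys v : aug m x ys -> sel x ys -> on_path m x ys v ->
  flip m v != v.
Proof.
move=> axy sxy /on_path_edge[b hb].
have fe : flip_edge m v b by exists x, ys.
have -> : flip m v = b by apply/flipE; left.
by apply: contraTneq (flip_edge_adj fe) => ->; rewrite e_irr.
Qed.

Lemma flip_changed a : flip m a != m a ->
  exists x ys, [/\ aug m x ys, sel x ys & on_path m x ys a].
Proof.
case/flipE: (erefl (flip m a)) => [|[_ <-]]; last by rewrite eqxx.
move=> [x [ys [axy sxy h]]] _; exists x, ys; split => //.
by case: h => /aug_edge_on[].
Qed.

End Flip.

Lemma flip_aut (g : graph_aut e) (sel sel' : V -> seq V -> Prop) m :
  matching m -> sel_disjoint sel m ->
  (forall x ys, sel x ys <-> sel' (g x) (map g ys)) ->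
  flip sel' (conj_aut g m) = conj_aut g (flip sel m).
Proof.
move=> mm dis ss.
have fwd m1 (h : graph_aut e) (s s' : V -> seq V -> Prop) a b : (forall x ys, s x ys -> s' (h x) (map h ys)) ->
    flip_edge s m1 a b -> flip_edge s' (conj_aut h m1) (h a) (h b).
  move=> hs [x [ys [axy sxy hab]]]; exists (h x), (map h ys); split.
  - exact: aug_aut.
  - exact: hs.
  - by case: hab => /(aug_edge_aut h); [left|right].
have bwd a b : flip_edge sel' (conj_aut g m) (g a) b -> flip_edge sel m a (aut_inv g b).
  move/(@fwd _ (aut_rev g) sel' sel); rewrite conj_rev /= aut_funK; apply.
  move=> x ys h; apply/ss; rewrite aut_invK -map_comp.
  by rewrite (eq_map (fun z => aut_invK g z)) map_id.
apply/funext => v; rewrite -[v](aut_invK g); move: (aut_inv g v) => a.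
rewrite {2}/conj_aut aut_funK.
have fwd' a' b : flip_edge sel m a' b -> flip_edge sel' (conj_aut g m) (g a') (g b).
  by apply: fwd => x ys /ss.
rewrite /flip {1}/conj_aut aut_funK.
case: (xgetP _ [set b | flip_edge sel m a b]) => [y _ hy|no].
  case: xgetP => [z _ hz|/(_ (g y))]; last by case; exact: fwd'.
  by rewrite -(flip_edge_fun mm dis (bwd _ _ hz) hy) aut_invK.
by case: xgetP => // z _ /bwd /no.
Qed.

End Augmenting.

(** * Removing all short augmenting paths *)

Lemma count_lt (T : eqType) (P Q : pred T) (r : seq T) a :
  (forall v, P v -> Q v) -> a \in r -> Q a -> ~~ P a ->
  (count P r < count Q r)%N.
Proof.
move=> PQ ar Qa nPa; elim: r ar => //= b r IH.
have le : (count P r <= count Q r)%N by apply: sub_count.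
rewrite inE => /orP[/eqP <-|/IH lt].
  by rewrite Qa (negbTE nPa) add0n add1n ltnS.
have := PQ b; case: (P b) => [/(_ isT) ->|_]; first by rewrite !add1n ltnS.
by rewrite add0n; apply: leq_trans lt _; exact: leq_addl.
Qed.

Lemma nonincreasing_settles (F : nat -> nat) : (forall t, F t.+1 <= F t)%N ->
  exists T, forall t, (T <= t)%N -> F t = F T.
Proof.
move=> dF; have mono T k : (F (T + k) <= F T)%N.
  by elim: k => [|k IH]; rewrite ?addn0 // addnS; exact: leq_trans (dF _) IH.
have exF : exists n, `[< exists T, F T = n >] by exists (F 0%N); apply/asboolP; exists 0%N.
have [n /asboolP[T FT] nmin] := ex_minnP exF; exists T => t Tt.
apply/eqP; rewrite eqn_leq -{1}(subnKC Tt) mono FT /=.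
by apply: nmin; apply/asboolP; exists t.
Qed.

Section PointwiseLimit.
Variable V : choiceType.
Implicit Types (s : nat -> V -> V) (a b : V).

Definition settles s a b := exists T, forall t, (T <= t)%N -> s t a = b.

(** Defaults to [a] where the sequence does not settle. *)
Definition lim_map s a : V := xget a [set b | settles s a b].

Lemma settles_fun s a b b' : settles s a b -> settles s a b' -> b = b'.
Proof.
move=> [T hT] [T' hT']; rewrite -(hT (maxn T T')) ?leq_maxl //.
by rewrite hT' ?leq_maxr.
Qed.

Lemma lim_mapE s a b : settles s a b -> lim_map s a = b.
Proof.
rewrite /lim_map => h; case: xgetP => [y _ hy|/(_ b)/(_ h) //].
exact: settles_fun hy h.
Qed.

Lemma settles_seq s (f : V -> V) (r : seq V) :
  (forall a, settles s a (f a)) ->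
  exists T, forall t, (T <= t)%N -> {in r, s t =1 f}.
Proof.
move=> h; elim: r => [|a r [T hT]]; first by exists 0%N.
have [T' hT'] := h a; exists (maxn T T') => t; rewrite geq_max => /andP[Tt Tt'] b.
by rewrite inE => /orP[/eqP ->|br]; [exact: hT'|exact: hT].
Qed.

End PointwiseLimit.

(** A schedule that runs infinitely often through all pairs of a precision and
    a list of digits. *)
Definition code (t : nat) : nat * seq nat :=
  if choice.unpickle t is Some p then (p : nat * (nat * seq nat)).2 else (0%N, [::]).

Lemma code_often (cd : nat * seq nat) T : exists2 t, (T <= t)%N & code t = cd.
Proof.
pose h (j : nat) : nat := choice.pickle (j, cd).
have hinj : injective h by move=> i j /(pcan_inj choice.pickleK)[].
have codeh j : code (h j) = cd by rewrite /code /h choice.pickleK.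
have [[j hj]|no] := pselect (exists j, (T <= h j)%N); first by exists (h j).
have lt j : (h j < T)%N by rewrite ltnNge; apply/negP => hj; apply: no; exists j.
pose F (i : 'I_T.+1) : 'I_T := Ordinal (lt i).
have Finj : injective F by move=> i j [/hinj /val_inj].
by have := leq_card F Finj; rewrite !card_ord ltnn.
Qed.

Section Stage.
Variables (R : realType) (V : choiceType) (e : rel V) (c : V -> bool).
Hypotheses (e_sym : symmetric e) (e_irr : irreflexive e)
  (e_conn : connected_graph e) (e_lf : locally_finite e)
  (e_col : forall x y, e x y -> c x != c y).
Local Notation Om := (label_config R V).
Local Notation act := (@act_label_config R V e).

Implicit Types (m : V -> V) (x y v : V) (ys : seq V) (f : Om) (l : nat).

(** The digits of the labels select at most one path near any given vertex,
    as they are pairwise distinct on a large ball around the path. *)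
Definition sel_code l f (cd : nat * seq nat) x ys : Prop :=
  [/\ (size ys <= l)%N, separated (ball_seq e (6 * l) x) cd.1 f &
      map (digit cd.1 f) (x :: ys) = cd.2].

Lemma map_separated (s : seq V) n f (r r' : seq V) : separated s n f ->
  {subset r <= s} -> {subset r' <= s} -> map (digit n f) r = map (digit n f) r' ->
  r = r'.
Proof.
move=> sep; elim: r r' => [|a r IH] [|a' r'] //= sr sr' [E1 E2].
congr (_ :: _).
  by apply: sep => //; [apply: sr; exact: mem_head|apply: sr'; exact: mem_head].
by apply: IH => // v vr; [apply: sr|apply: sr']; rewrite inE vr orbT.
Qed.

Lemma aug_mem_ball m x ys v : matching e m -> aug e m x ys -> v \in x :: ys ->
  v \in ball_seq e (size ys).*2 x.
Proof.
move=> mm mxy /(nthP x)[i il <-]; rewrite /= ltnS in il.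
apply: (@ball_le _ _ i.*2); first by rewrite leq_double.
exact: (pt_ball e_lf mm mxy).
Qed.

Lemma sel_code_disjoint l f cd m : matching e m ->
  sel_disjoint e (sel_code l f cd) m.
Proof.
move=> mm x ys x' ys' v axy [sl sep dg] vp axy' [sl' sep' dg'] vp'.
have v1 := on_path_ball e_lf mm axy vp; have v2 := on_path_ball e_lf mm axy' vp'.
have sub w : w \in x :: ys -> w \in ball_seq e (6 * l) x.
  by move/(aug_mem_ball mm axy); apply: ball_le; lia.
have sub' w : w \in x' :: ys' -> w \in ball_seq e (6 * l) x.
  move/(aug_mem_ball mm axy') => w1.
  (* x' is within 4 l of x as the paths meet, and w within 2 l of x' *)
  have := ball_trans e_lf (ball_trans e_lf v1 (ball_sym e_sym e_lf v2)) w1.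
  by apply: ball_le; lia.
by have [] := map_separated sep sub sub' (etrans dg (esym dg')).
Qed.

Fixpoint run l f m0 t : V -> V :=
  if t is t'.+1 then flip e (sel_code l f (code t')) (run l f m0 t') else m0.

(** The outcome of flipping short augmenting paths until none is left. *)
Definition stage l f m0 : V -> V := lim_map (run l f m0).

Section OneStage.
Variables (l : nat) (f : Om) (m0 : V -> V).
Hypothesis mm0 : matching e m0.
Local Notation rn := (run l f m0).

Lemma run_matching t : matching e (rn t).
Proof.
elim: t => //= t IH.
by apply: (flip_matching e_sym e_col IH); exact: sel_code_disjoint.
Qed.

Lemma run_matchedS t v : rn t v != v -> rn t.+1 v != v.
Proof.
apply: (flip_matched e_sym e_irr e_col (run_matching t)).
exact/sel_code_disjoint/run_matching.
Qed.

Lemma run_matched t t' v : (t <= t')%N -> rn t v != v -> rn t' v != v.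
Proof.
move=> /subnKC <-; elim: (t' - t)%N => [|k IH]; rewrite ?addn0 //.
by rewrite addnS => /IH/run_matchedS.
Qed.

Definition flipped t x ys :=
  aug e (rn t) x ys /\ sel_code l f (code t) x ys.

Lemma run_flipped t x ys v : flipped t x ys -> on_path (rn t) x ys v ->
  rn t.+1 v != v.
Proof.
move=> [axy sxy]; apply: (flip_on_path e_sym e_irr e_col (run_matching t)) axy sxy.
exact/sel_code_disjoint/run_matching.
Qed.

Lemma run_changed t v : rn t.+1 v != rn t v ->
  exists x ys, flipped t x ys /\ on_path (rn t) x ys v.
Proof.
move/(flip_changed e_col (run_matching t)).
move=> /(_ (sel_code_disjoint (run_matching t)))[x [ys [axy sxy on]]].
by exists x, ys.
Qed.

Lemma flipped_ball t x ys v : flipped t x ys -> on_path (rn t) x ys v ->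
  x \in ball_seq e l.*2 v.
Proof.
move=> [axy [sl _ _]] /(on_path_ball e_lf (run_matching t) axy) h.
by apply: ball_sym => //; apply: ball_le h; rewrite leq_double.
Qed.

Lemma flipped_start t x ys : flipped t x ys -> rn t x = x /\ rn t.+1 x != x.
Proof.
move=> fxy; split; first by case: fxy => -[].
by apply: (run_flipped fxy); case: fxy => [axy _]; exact: aug_start_on axy.
Qed.

(** Each change at [v] matches a new vertex near [v], and there are only
    finitely many of those. *)
Lemma run_settles v : settles rn v (stage l f m0 v).
Proof.
pose F t := count (fun w => rn t w == w) (ball_seq e l.*2 v).
have leF t w : rn t.+1 w == w -> rn t w == w.
  by apply: contraLR; exact: run_matchedS.
have dF t : (F t.+1 <= F t)%N by apply: sub_count => w; exact: leF.
have [T hT] := nonincreasing_settles dF.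
have st : settles rn v (rn T v).
  exists T => t /subnKC <-; elim: (t - T)%N => [|k IH]; rewrite ?addn0 //.
  rewrite addnS -IH; apply/eqP; apply: contraT => /run_changed[x [ys [fxy on]]].
  have [sx sx'] := flipped_start fxy.
  have : (F (T + k).+1 < F (T + k))%N.
    apply: (@count_lt _ _ _ _ x) => [w|||]; first exact: leF.
    - exact: flipped_ball fxy on.
    - by rewrite sx.
    - exact: sx'.
  by rewrite -addnS !hT ?leq_addr // ltnn.
by rewrite /stage (lim_mapE st).
Qed.

Lemma stage_matching : matching e (stage l f m0).
Proof.
split=> v.
  have [T hT] := settles_seq [:: v; stage l f m0 v] run_settles.
  have h := hT T (leqnn T); rewrite -h ?inE ?eqxx ?orbT // -h ?inE ?eqxx //.
  exact: (run_matching T).1.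
have [T hT] := run_settles v; rewrite -(hT T (leqnn T)) => h.
exact: (run_matching T).2.
Qed.

Lemma stage_matched v : m0 v != v -> stage l f m0 v != v.
Proof.
have [T hT] := run_settles v; rewrite -(hT T (leqnn T)).
exact: (@run_matched 0).
Qed.

Definition good_labels := forall r x, exists n, separated (ball_seq e r x) n f.

(** A short path that is augmenting in the limit is augmenting from some time
    on. Its list of digits comes up again later, and then the path is
    flipped, which matches its first vertex for good. *)
Lemma stage_no_aug x ys : good_labels -> aug e (stage l f m0) x ys ->
  (size ys <= l)%N -> False.
Proof.
move=> gl axy sl; have [T hT] := settles_seq (x :: ys) run_settles.
have [n sep] := gl (6 * l)%N x.
have [t Tt ct] := code_often (n, map (digit n f) (x :: ys)) T.
have fxy : flipped t x ys.
  split; last by rewrite ct.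
  apply: aug_local axy => v vin; exact/esym/hT.
have [_ /negP] := flipped_start fxy; apply.
rewrite (hT t.+1 _ x) ?mem_head ?(leqW Tt) //.
by case: axy => _ ->.
Qed.

(** The first vertex of a flipped path is unmatched at the start of the stage.
    Letting it send mass to all vertices of the path bounds the density of
    the vertices that change their mate by mass transport. *)
Definition touch x v : Prop :=
  exists t ys, flipped t x ys /\ on_path (rn t) x ys v.

Lemma touch_unmatched x v : touch x v -> m0 x = x.
Proof.
move=> [t [ys [/flipped_start[sx _] _]]]; apply/eqP; apply: contraT => h.
by have := @run_matched 0 t x (leq0n t) h; rewrite sx eqxx.
Qed.

(** After a flip the first vertex of the path stays matched, so it is not the
    first vertex of another flipped path. *)
Lemma flipped_unique t ys t' ys' x : flipped t x ys -> flipped t' x ys' ->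
  t = t' /\ ys = ys'.
Proof.
have le t1 t2 r1 r2 : flipped t1 x r1 -> flipped t2 x r2 -> (t2 <= t1)%N.
  move=> /flipped_start[_ s1] /flipped_start[s2 _]; rewrite leqNgt; apply/negP => lt.
  by have := run_matched lt s1; rewrite s2 eqxx.
move=> h h'; have tE : t = t' by apply/eqP; rewrite eqn_leq !(le _ _ _ _ h h', le _ _ _ _ h' h).
split => //; subst t'; case: h h' => [axy sxy] [axy' sxy'].
have [] := sel_code_disjoint (run_matching t) axy sxy (aug_start_on axy)
  axy' sxy' (aug_start_on axy') => //.
Qed.

Lemma touch_count x : exists2 s : seq V, (size s <= l.*2)%N &
  forall v, touch x v -> v \in s.
Proof.
have [[t [ys fxy]]|no] := pselect (exists t ys, flipped t x ys); last first.
  by exists [::] => // v [t [ys [fxy _]]]; case: no; exists t, ys.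
exists (path_seq (rn t) x ys).
  by rewrite size_cat size_map size_iota addnn leq_double; case: fxy => _ [].
move=> v [t' [ys' [fxy' on]]].
have [? ?] := flipped_unique fxy fxy'; subst t' ys'; exact: on_pathP.
Qed.

Lemma touch_ball x v : touch x v -> x \in ball_seq e l.*2 v.
Proof. by move=> [t [ys [fxy on]]]; exact: flipped_ball fxy on. Qed.

Lemma stage_changed v : stage l f m0 v != m0 v -> exists x, touch x v.
Proof.
move=> ne; apply: contrapT => no.
have const t : rn t v = m0 v.
  elim: t => // t IH; rewrite -IH; apply/eqP; apply: contraT.
  by move=> /run_changed[x [ys [fxy on]]]; case: no; exists x, t, ys.
have [T hT] := run_settles v.
by move: ne; rewrite -(hT T (leqnn T)) const eqxx.
Qed.

End OneStage.

Lemma digit_act (g : graph_aut e) n f v : digit n (act g f) (g v) = digit n f v.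
Proof. by rewrite /digit /act_label_config aut_funK. Qed.

Lemma separated_act (g : graph_aut e) r n f x :
  separated (ball_seq e r (g x)) n (act g f) <-> separated (ball_seq e r x) n f.
Proof.
split => sep v w.
  move=> vb wb E; apply: (@aut_inj _ _ g); apply: sep; rewrite ?ball_aut //.
  by rewrite !digit_act.
rewrite -(aut_invK g v) -(aut_invK g w) !ball_aut // => vb wb; rewrite !digit_act => E.
by congr (g _); exact: sep.
Qed.

Lemma sel_code_act (g : graph_aut e) l f cd x ys :
  sel_code l f cd x ys <-> sel_code l (act g f) cd (g x) (map g ys).
Proof.
have E : map (digit cd.1 (act g f)) (g x :: map g ys) = map (digit cd.1 f) (x :: ys).
  rewrite -map_cons -map_comp; apply: eq_map => v; exact: digit_act.
split => -[sl sep dg]; split; rewrite ?size_map ?E // ?size_map in sl *.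
- exact/separated_act.
- by move/separated_act: sep.
- by rewrite -E.
Qed.

Lemma run_act (g : graph_aut e) l f m0 t : matching e m0 ->
  run l (act g f) (conj_aut g m0) t = conj_aut g (run l f m0 t).
Proof.
move=> mm0; elim: t => //= t ->; apply: (flip_aut e_col) => //; last 1 first.
- by move=> x ys; exact: sel_code_act.
- exact: run_matching.
- exact/sel_code_disjoint/run_matching.
Qed.

Lemma stage_act (g : graph_aut e) l f m0 : matching e m0 ->
  stage l (act g f) (conj_aut g m0) = conj_aut g (stage l f m0).
Proof.
move=> mm0; apply/funext => v; apply: lim_mapE.
have [T hT] := run_settles l f mm0 (aut_inv g v); exists T => t Tt.
by rewrite run_act // /conj_aut hT.
Qed.

Lemma act_rev (g : graph_aut e) (f : Om) : act (aut_rev g) (act g f) = f.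
Proof. by apply/funext => v; rewrite /act_label_config /= aut_funK. Qed.

Lemma touch_act_imp (g : graph_aut e) l (f : Om) m0 x v : matching e m0 ->
  touch l f m0 x v -> touch l (act g f) (conj_aut g m0) (g x) (g v).
Proof.
move=> mm0 [t [ys [[axy sxy] on]]]; exists t, (map g ys).
rewrite /flipped run_act //; split; first split.
- exact: aug_aut.
- by have [h _] := sel_code_act g l f (code t) x ys; exact: h.
- exact: on_path_aut.
Qed.

Lemma touch_act (g : graph_aut e) l (f : Om) m0 x v : matching e m0 ->
  touch l (act g f) (conj_aut g m0) (g x) (g v) <-> touch l f m0 x v.
Proof.
move=> mm0; split; last exact: touch_act_imp.
move/(@touch_act_imp (aut_rev g) _ _ _ _ _ (conj_matching g mm0)).
by rewrite act_rev conj_rev /= !aut_funK.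
Qed.

End Stage.

(** * The sequence of matchings *)

Section Measurability.
Variables (R : realType) (V : choiceType) (e : rel V) (c : V -> bool).
Hypotheses (e_sym : symmetric e) (e_irr : irreflexive e)
  (e_conn : connected_graph e) (e_lf : locally_finite e)
  (e_col : forall x y, e x y -> c x != c y).
Local Notation Om := (label_config R V).
Local Notation act := (@act_label_config R V e).

Let cV : countable [set: V] := countable_vertices e_conn e_lf.

Lemma event_map (A B : Type) (h : Om -> A -> B) (s : seq A) (bs : seq B) :
  (forall a b, event (fun f => h f a = b)) -> event (fun f => map (h f) s = bs).
Proof.
move=> eh; elim: s bs => [|a s IH] [|b bs] /=; try exact: event_cst.
  by apply: (@event_ext _ _ (fun=> False)) => [f|]; [split|exact: event_cst].
apply: (@event_ext _ _ (fun f => h f a = b /\ map (h f) s = bs)).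
  by move=> f; split => [[-> ->]|[-> ->]].
by apply: event_and.
Qed.

Definition measurable_map (m : Om -> V -> V) :=
  forall a b, event (fun f => m f a = b).

(** The mates of the vertices of [s] take countably many values. *)
Lemma event_local (m : Om -> V -> V) (s : seq V) (Q : (V -> V) -> Prop) :
  measurable_map m ->
  (forall m1 m2 : V -> V, {in s, m1 =1 m2} -> Q m1 -> Q m2) -> event (fun f => Q (m f)).
Proof.
move=> em locQ.
apply: (@event_ext _ _ (fun f => exists bs, map (m f) s = bs /\
    exists m', map m' s = bs /\ Q m')).
  move=> f; split => [[bs [<- [m' [/eq_in_map E Qm']]]]|Qf].
    exact: locQ Qm'.
  by exists (map (m f) s); split => //; exists (m f).
apply: event_ex; first exact: countable_seq.
by move=> bs; apply: event_and; [exact: event_map|exact: event_cst].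
Qed.

Lemma event_sel_code l cd x ys : event (fun f : Om => sel_code e l f cd x ys).
Proof.
apply: (@event_ext _ _ (fun f => ((size ys <= l)%N /\
  separated (ball_seq e (6 * l) x) cd.1 f) /\ map (digit cd.1 f) (x :: ys) = cd.2)).
  by move=> f; split => [[[]]|[]].
apply: event_and; last by apply: event_map => v k; exact: event_digit.
by apply: event_and; [exact: event_cst|exact: event_separated].
Qed.

Lemma on_path_local (m m' : V -> V) x ys v : {in x :: ys, m =1 m'} ->
  on_path m x ys v -> on_path m' x ys v.
Proof.
move=> E [i il h]; exists i => //; rewrite -E //.
by rewrite mem_nth //= ltnS ltnW.
Qed.

Lemma measurable_flip (m : Om -> V -> V) (sel : Om -> V -> seq V -> Prop) :
  measurable_map m -> (forall x ys, event (fun f => sel f x ys)) ->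
  (forall f, matching e (m f)) -> (forall f, sel_disjoint e (sel f) (m f)) ->
  measurable_map (fun f => flip e (sel f) (m f)).
Proof.
move=> em es mm dis.
have efe a b : event (fun f => flip_edge e (sel f) (m f) a b).
  apply: event_ex => // x; apply: event_ex; first exact: countable_seq.
  move=> ys; apply: (@event_ext _ _ (fun f => (aug e (m f) x ys /\ sel f x ys) /\
    (aug_edge (m f) x ys a b \/ aug_edge (m f) x ys b a))).
    by move=> f; split => [[[]]|[]].
  apply: event_and; first apply: event_and => //.
    apply: (@event_local m (x :: ys) (fun m' => aug e m' x ys)) => // m1 m2 E.
    exact: aug_local.
  apply: (@event_local m (x :: ys) (fun m' => aug_edge m' x ys a b \/ aug_edge m' x ys b a)) => //.
  by move=> m1 m2 E [] /(aug_edge_local E); [left|right].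
move=> a b; apply: (@event_ext _ _ (fun f => flip_edge e (sel f) (m f) a b \/
  (~ exists b', flip_edge e (sel f) (m f) a b') /\ m f a = b)).
  by move=> f; split => h; apply/(flipE e_col (mm f) (dis f)).
apply: event_or => //; apply: event_and => //.
by apply/event_not/event_ex.
Qed.

Lemma measurable_run l (m0 : Om -> V -> V) t : (forall f, matching e (m0 f)) ->
  measurable_map m0 -> measurable_map (fun f => run e l f (m0 f) t).
Proof.
move=> mm0 em; elim: t => //= t IH; apply: measurable_flip => //.
- by move=> x ys; exact: event_sel_code.
- by move=> f; exact: (run_matching e_sym e_lf e_col).
- by move=> f; apply: sel_code_disjoint => //; exact: (run_matching e_sym e_lf e_col).
Qed.

Lemma measurable_lim (s : nat -> Om -> V -> V) :
  (forall t, measurable_map (s t)) ->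
  forall a b, event (fun f => settles (fun t => s t f) a b).
Proof.
move=> es a b; apply: event_ex => [|T]; first exact: countableP.
apply: event_all => [|t]; first exact: countableP.
by apply: event_imp; [exact: event_cst|exact: es].
Qed.

Lemma measurable_stage l (m0 : Om -> V -> V) : (forall f, matching e (m0 f)) ->
  measurable_map m0 -> measurable_map (fun f => stage e l f (m0 f)).
Proof.
move=> mm0 em a b.
apply: (@event_ext _ _ (fun f => settles (fun t => run e l f (m0 f) t) a b));
  last by apply: measurable_lim => t; exact: measurable_run.
move=> f.
split => [|<-]; last exact: (run_settles e_sym e_irr e_lf e_col).
exact: lim_mapE.
Qed.

Lemma event_touch l (m0 : Om -> V -> V) x v : (forall f, matching e (m0 f)) ->
  measurable_map m0 -> event (fun f => touch e l f (m0 f) x v).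
Proof.
move=> mm0 em; apply: event_ex => [|t]; first exact: countableP.
apply: event_ex => [|ys]; first exact: countable_seq.
have er := measurable_run l t mm0 em.
apply: event_and; first apply: event_and.
- apply: (@event_local _ (x :: ys) (fun m' => aug e m' x ys) er) => m1 m2 E.
  exact: aug_local.
- exact: event_sel_code.
- apply: (@event_local _ (x :: ys) (fun m' => on_path m' x ys v) er) => m1 m2 E.
  exact: on_path_local.
Qed.

(** Paths with up to [2 k + 1] listed vertices arise when two alternating walks
    of [k] and [k + 1] steps are joined, as in [alt_side_disjoint] below. *)
Fixpoint mseq n (f : Om) : V -> V :=
  if n is k.+1 then stage e (2 * k + 1) f (mseq k f) else id.

Lemma mseq_matching n f : matching e (mseq n f).
Proof.
elim: n => [|n IH]; first by split => // x; rewrite eqxx.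
exact: (stage_matching e_sym e_irr e_lf e_col).
Qed.

Lemma mseq_act n (g : graph_aut e) f : mseq n (act g f) = conj_aut g (mseq n f).
Proof.
elim: n => [|n /= ->]; first by apply/funext => v; rewrite /conj_aut /= aut_invK.
exact/(stage_act e_sym e_irr e_lf e_col)/mseq_matching.
Qed.

Lemma measurable_mseq n : measurable_map (mseq n).
Proof.
elim: n => [|n IH]; first by move=> a b; exact: (event_cst _ (a = b)).
by apply: measurable_stage => // f; exact: mseq_matching.
Qed.

Lemma event_good_labels : event (fun f : Om => good_labels e f).
Proof.
apply: event_all => [|r]; first exact: countableP.
apply: event_all => // x; apply: event_ex => [|n]; first exact: countableP.
exact: event_separated.
Qed.

Lemma good_labels_null (u : probability Om R) : product_of_uniform u ->
  Pr u (fun f => ~ good_labels e f) = 0.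
Proof.
move=> u_prod; pose P (p : nat * V) (f : Om) :=
  ~ exists n, separated (ball_seq e p.1 p.2) n f.
rewrite (@eq_Pr _ _ _ _ _ (fun f => exists p, P p f)).
  apply: Pr_ex_null.
  - by rewrite -setXTT; apply: countableX.
  - by move=> p; apply: event_not; have [] := separated_null u_prod cV (ball_seq e p.1 p.2).
  - by move=> p; have [] := separated_null u_prod cV (ball_seq e p.1 p.2).
move=> f; split => [nall|[[r x] h] gl]; last by apply: h; exact: gl.
by apply: contrapT => nex; apply: nall => r x; apply: contrapT => h; apply: nex; exists (r, x).
Qed.

End Measurability.

(** * Exponential decay of the transition probabilities *)

Section RandomWalk.
Variables (R : realType) (V : choiceType) (e : rel V).
Hypotheses (e_sym : symmetric e) (e_conn : connected_graph e)
  (e_lf : locally_finite e).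
Variable d : nat.
Hypothesis e_deg : forall x, degree e x = d.

Lemma sumV_nbr (F : V -> R) x :
  sumV (fun y => (e x y)%:R * F y) = \sum_(y <- nbr e x) F y.
Proof.
rewrite (@sumV_seq _ _ _ (nbr e x)) ?uniq_nbr //.
  by apply: eq_big_seq => y; rewrite (mem_nbr e_lf) => ->; rewrite mul1r.
move=> y; rewrite (mem_nbr e_lf) mulf_eq0 negb_or => /andP[+ _].
by rewrite pnatr_eq0 eqb0 negbK.
Qed.

Lemma size_nbr x : size (nbr e x) = d.
Proof. exact: e_deg. Qed.

Local Notation p := (srw R e).

Lemma srwS_deg0 n x y : d = 0%N -> p n.+1 x y = p n x y.
Proof.
move=> d0; rewrite /= /srw_step e_deg d0 eqxx.
rewrite -/(sumV _) (@sumV1 _ _ _ x) ?eqxx ?mul1r // => z /negbTE.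
by rewrite eq_sym => ->; rewrite mul0r.
Qed.

Lemma nonamenable_deg_gt0 : nonamenable R e -> (0 < d)%N.
Proof.
move=> [x [y]]; rewrite lt0n; apply: contraTneq => d0.
have yx : y = x.
  have [[|z q] [/= + <-]] := e_conn x y; first by [].
  move=> /andP[exz _]; have := mem_nbr e_lf x z.
  by have := size_nbr x; rewrite d0 exz => /size0nil ->.
have p1 n : p n x x = 1.
  by elim: n => [|n IH]; rewrite ?srwS_deg0 // /= eqxx.
rewrite -leNgt yx /spectral_radius.
under [X in limn_esup X]eq_fun do rewrite p1 powR1.
by rewrite (cvg_limn_einf_sup (cvg_cst _)).2.
Qed.

Hypothesis d0 : (0 < d)%N.

Lemma srwS n x y : p n.+1 x y = d%:R^-1 * \sum_(z <- nbr e x) p n z y.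
Proof.
rewrite /= /srw_step e_deg (gtn_eqF d0) -/(sumV _) -sumV_nbr -sumVZ.
by apply: eq_sumV => z; rewrite mulrCA mulrA.
Qed.

Lemma srw_ge0 n x y : 0 <= p n x y.
Proof.
elim: n x => [|n IH] x; first exact: ler0n.
by rewrite srwS mulr_ge0 ?invr_ge0 ?ler0n // sumr_ge0.
Qed.

Lemma srw_le1 n x y : p n x y <= 1.
Proof.
elim: n x => [|n IH] x; first by rewrite /= lern1 leq_b1.
rewrite srwS mulrC ler_pdivrMr ?ltr0n // mul1r.
apply: (@le_trans _ _ (\sum_(z <- nbr e x) 1)); first by apply: ler_sum => z _.
by rewrite big_const_seq count_predT iter_addr_0 size_nbr.
Qed.

Lemma srw_ball n x y : p n x y != 0 -> y \in ball_seq e n x.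
Proof.
elim: n x => [|n IH] x.
  by rewrite /= pnatr_eq0 eqb0 negbK inE eq_sym.
rewrite srwS; apply: contraNT => yb; rewrite big1_seq ?mulr0 // => z.
rewrite (mem_nbr e_lf) /= => exz; apply: contraNeq yb => /IH yz.
by rewrite -add1n; apply: (ball_trans e_lf (ball1 e_lf exz) yz).
Qed.

Lemma srwD n m x y z : p n x z * p m z y <= p (n + m) x y.
Proof.
elim: n x => [|n IH] x.
  rewrite add0n /=; have [->|_] := eqVneq x z; first by rewrite mul1r.
  by rewrite mul0r srw_ge0.
rewrite addSn !srwS -mulrA ler_wpM2l ?invr_ge0 ?ler0n // mulr_suml.
by apply: ler_sum => t _.
Qed.

Lemma srw_gt0 x y : exists n, 0 < p n x y.
Proof.
have [q [+ <-]] := e_conn x y; elim: q x => [|z q IH] x /=.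
  by move=> _; exists 0%N; rewrite /= eqxx ltr01.
move=> /andP[exz /IH[n pn]]; exists n.+1; rewrite srwS mulr_gt0 ?invr_gt0 ?ltr0n //.
apply: lt_le_trans pn _.
rewrite (bigD1_seq z) ?uniq_nbr //=; last by rewrite (mem_nbr e_lf).
by rewrite lerDl sumr_ge0 // => t _; exact: srw_ge0.
Qed.

(** By connectedness the exponential decay at one pair of vertices, which is
    what non-amenability provides, holds at all of them. *)
Lemma srw_decay : nonamenable R e ->
  exists2 r : R, 0 < r < 1 & forall x y, exists C, forall n, p n x y <= C * r ^+ n.
Proof.
move=> [x0 [y0 rho]].
have [r [r0 r1] [N hN]] : exists2 r : R, 0 < r /\ r < 1 &
    exists N, forall n, (N <= n)%N -> p n x0 y0 <= r ^+ n.
  set a := fun n => (p n x0 y0 `^ n%:R^-1)%:E in rho.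
  have := rho; rewrite /spectral_radius -/a limn_esup_lim.
  rewrite (cvg_lim _ (@cvg_esups_inf _ a)) // => /ereal_inf_lt[_ [N _ <-]] lt1.
  have le_sup k : (N <= k)%N -> (a k <= esups a N)%E.
    by move=> Nk; apply: ereal_sup_ubound; exists k.
  have [s sE] : exists s, esups a N = s%:E.
    move: lt1 (le_sup N (leqnn N)); rewrite /a; case: (esups a N) => [s||] //.
    by exists s.
  rewrite sE lte_fin in lt1; have s0 : 0 <= s.
    by have := le_sup N (leqnn N); rewrite sE lee_fin; apply: le_trans; exact: powR_ge0.
  exists ((s + 1) / 2); first by split; lra.
  exists N.+1 => k Nk; have k0 : k%:R != 0 :> R by rewrite pnatr_eq0; lia.
  have := le_sup k (ltnW Nk); rewrite sE lee_fin => ak.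
  have -> : p k x0 y0 = (p k x0 y0 `^ k%:R^-1) ^+ k.
    by rewrite -powR_mulrn ?powR_ge0 // -powRrM mulVf // powRr1 // srw_ge0.
  by rewrite lerXn2r ?nnegrE ?powR_ge0 //; lra.
exists r; first by rewrite r0.
move=> x y; have [k pk] := srw_gt0 x0 x; have [l pl] := srw_gt0 y y0.
exists ((p k x0 x * p l y y0)^-1 + r ^- N) => n.
have rn n' : 0 < r ^+ n' by exact: exprn_gt0.
have [le|lt] := leqP N (k + n + l).
  apply: (@le_trans _ _ ((p k x0 x * p l y y0)^-1 * r ^+ n)); last first.
    by rewrite ler_wpM2r ?lerDl ?invr_ge0 // ltW.
  rewrite ler_pdivlMl ?mulr_gt0 //.
  have -> : p k x0 x * p l y y0 * p n x y = p k x0 x * p n x y * p l y y0 by ring.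
  apply: (@le_trans _ _ (p (k + n + l) x0 y0)).
    apply: le_trans (srwD _ _ _ _ y); rewrite ler_wpM2r ?srw_ge0 //; exact: srwD.
  apply: le_trans (hN _ le) _; apply: ler_wiXn2l; rewrite ?ltW //; lia.
apply: (@le_trans _ _ (r ^- N * r ^+ n)); last first.
  by rewrite ler_wpM2r ?lerDr ?invr_ge0 ?mulr_ge0 // ltW.
rewrite ler_pdivlMl // mulrC.
apply: (@le_trans _ _ (1 * r ^+ N)); first by rewrite ler_wpM2r ?srw_le1 // ltW.
by rewrite mul1r; apply: ler_wiXn2l; rewrite ?ltW //; lia.
Qed.

End RandomWalk.

(** * The Markov operator on invariant processes *)

(** Closes the goals asking for the boundedness of algebraic expressions in
    bounded random variables. *)
Ltac bounded := repeat first
  [ done | apply: bounded_rv_cst | apply: bounded_rvM | apply: bounded_rvB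
  | apply: bounded_rvD | apply: bounded_rv_norm
  | apply: bounded_rv_sum => ? ].

Lemma discriminant_le (R : realType) (a b k : R) : 0 <= k ->
  (forall s : R, 0 <= a + s * (2%:R * b) + s ^+ 2 * k) -> b ^+ 2 <= a * k.
Proof.
rewrite le_eqVlt => /orP[/eqP <- h|k0 h].
  have [->|b0] := eqVneq b 0; first by rewrite expr0n mulr0.
  have := h (- (a + 1) / (2%:R * b)).
  rewrite mulr0 addr0 divfK ?mulf_neq0 ?pnatr_eq0 //.
  by rewrite (_ : a + - (a + 1) = -1) ?oppr_ge0 ?ler10 //; ring.
have := h (- b / k); rewrite -ler_pdivrMr //.
rewrite (_ : a + - b / k * (2%:R * b) + (- b / k) ^+ 2 * k = a - b ^+ 2 / k) ?subr_ge0 //.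
by field; rewrite gt_eqF.
Qed.

Lemma geometric_small (R : realType) (C q eps : R) : 0 <= q -> q < 1 -> 0 < eps ->
  exists n, C * q ^+ n < eps.
Proof.
move=> q0 q1 eps0; have cv : (fun n => C * q ^+ n) @ \oo --> (C * 0 : R).
  by apply: cvgMr; apply: cvg_expr; rewrite ger0_norm.
rewrite mulr0 in cv; have /cvgrPdist_lt/(_ eps eps0)[n _ hn] := cv.
exists n; have := hn n (leqnn n); rewrite sub0r normrN; apply: le_lt_trans; exact: ler_norm.
Qed.

(** By log-convexity the ratios [a n.+1 / a n] are nondecreasing, so a first
    ratio above [q] would contradict the bound on the growth. *)
Lemma log_convex_first_step (R : realType) (a : nat -> R) (C q : R) : 0 < q ->
  (forall n, 0 <= a n) -> (forall n, a n.+1 ^+ 2 <= a n * a n.+2) ->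
  (forall n, a n <= C * q ^+ n) -> a 1%N <= q * a 0%N.
Proof.
move=> q0 a0 lc ub; rewrite leNgt; apply/negP => lt.
have a00 : 0 < a 0%N.
  rewrite lt_def a0 andbT; apply/eqP => E; have := lc 0%N; rewrite E mul0r.
  have a1 : 0 < a 1%N by move: lt; rewrite E mulr0.
  by rewrite leNgt exprn_gt0.
pose r := a 1%N / a 0%N; have qr : q < r by rewrite ltr_pdivlMr.
have r0 : 0 < r := lt_trans q0 qr.
have step n : 0 < a n /\ r * a n <= a n.+1.
  elim: n => [|n [an ran]]; first by rewrite divfK ?gt_eqF.
  have an1 : 0 < a n.+1 by apply: lt_le_trans ran; rewrite mulr_gt0.
  split => //; rewrite -(ler_pM2l an); apply: le_trans (lc n).
  rewrite expr2 mulrCA mulrA; apply: ler_wpM2r => //; exact: ltW.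
have lower n : r ^+ n * a 0%N <= a n.
  elim: n => [|n IH]; first by rewrite expr0 mul1r.
  apply: le_trans (step n).2; rewrite exprS -mulrA ler_pM2l //.
have qr1 : q / r < 1 by rewrite ltr_pdivrMr // mul1r.
have [n] := geometric_small C (divr_ge0 (ltW q0) (ltW r0)) qr1 a00.
rewrite expr_div_n mulrA ltr_pdivrMr ?exprn_gt0 // ltNge mulrC.
by rewrite (le_trans (lower n) (ub n)).
Qed.

Section Mean.
Variables (R : realType) (V : choiceType) (orbs : seq V) (w : V -> R).
Hypothesis w_gt0 : forall b, 0 < w b.
Local Notation mn := (mean orbs w).
Implicit Types (f g : V -> R).

Lemma eq_mean f g : f =1 g -> mn f = mn g.
Proof. by move=> /funext ->. Qed.

Lemma meanD f g : mn (fun x => f x + g x) = mn f + mn g.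
Proof. by rewrite /mean -big_split /=; apply: eq_bigr => b _; rewrite mulrDr. Qed.

Lemma meanZ a f : mn (fun x => a * f x) = a * mn f.
Proof. by rewrite /mean mulr_sumr; apply: eq_bigr => b _; rewrite mulrCA. Qed.

Lemma meanB f g : mn (fun x => f x - g x) = mn f - mn g.
Proof.
rewrite -[- mn g]mulN1r -meanZ -meanD; apply: eq_mean => x.
by rewrite mulN1r.
Qed.

Lemma mean_le f g : (forall b, b \in orbs -> f b <= g b) -> mn f <= mn g.
Proof.
move=> fg; rewrite /mean big_seq [leRHS]big_seq; apply: ler_sum => b bo.
by rewrite ler_pM2l ?fg.
Qed.

Lemma mean_ge0 f : (forall b, b \in orbs -> 0 <= f b) -> 0 <= mn f.
Proof.
move=> f0; rewrite /mean big_seq; apply: sumr_ge0 => b bo.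
by rewrite mulr_ge0 ?f0 // ltW.
Qed.

Lemma mean_ge f b : b \in orbs -> (forall b, 0 <= f b) -> w b * f b <= mn f.
Proof.
move=> bo f0; rewrite /mean.
elim: orbs bo => // a s IH; rewrite inE big_cons => /orP[/eqP ->|/IH le].
  by rewrite lerDl sumr_ge0 // => b' _; rewrite mulr_ge0 // ltW.
by apply: le_trans le _; rewrite lerDr mulr_ge0 // ltW.
Qed.

End Mean.

Section Operator.
Variables (R : realType) (V : choiceType) (e : rel V) (c : V -> bool).
Hypotheses (e_sym : symmetric e) (e_conn : connected_graph e)
  (e_lf : locally_finite e) (e_col : forall x y, e x y -> c x != c y).
Variable d : nat.
Hypotheses (e_deg : forall x, degree e x = d) (d0 : (0 < d)%N).
Variables (rep : V -> V) (orbs : seq V) (w : V -> R).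
Hypotheses (w_gt0 : forall b, 0 < w b) (rep_orbs : forall x, rep x \in orbs)
  (rep_ex : forall x, exists2 g : graph_aut e, side_pres c g & g (rep x) = x)
  (mtp : forall t, diag_inv e c t -> finite_range e t ->
     mean orbs w (fun x => sumV (t x)) = mean orbs w (fun y => sumV (t^~ y))).
Local Notation mn := (mean orbs w).
Local Notation Om := (label_config R V).
Local Notation act := (@act_label_config R V e).
Variable u : probability Om R.
Hypothesis u_prod : product_of_uniform u.
Local Notation E := (Ex u).

(** The Markov operator of simple random walk on functions; [walk] is the same
    operator on random functions. *)
Definition avg (q : V -> R) x : R := d%:R^-1 * \sum_(y <- nbr e x) q y.

Lemma edge_transport (k : V -> V -> R) : diag_inv e c k ->
  mn (fun x => \sum_(y <- nbr e x) k x y) = mn (fun x => \sum_(y <- nbr e x) k y x).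
Proof.
move=> kinv; pose t x y := (e x y)%:R * k x y.
transitivity (mn (fun x => sumV (t x))).
  by apply: eq_mean => x; rewrite -sumV_nbr.
rewrite mtp.
- apply: eq_mean => x; rewrite -sumV_nbr //; apply: eq_sumV => y.
  by rewrite /t e_sym.
- by move=> g x y sg; rewrite /t aut_adj kinv.
- exists 1%N => x y; rewrite mulf_eq0 negb_or pnatr_eq0 eqb0 negbK.
  by move=> /andP[/(ball1 e_lf)].
Qed.

Definition invariant (q : V -> R) :=
  forall (g : graph_aut e) x, side_pres c g -> q (g x) = q x.

Lemma mean_avg q : invariant q -> mn (avg q) = mn q.
Proof.
move=> qinv; rewrite meanZ (@edge_transport (fun _ y => q y)); last first.
  by move=> g x y sg; exact: qinv.
rewrite -meanZ; apply: eq_mean => x.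
rewrite big_const_seq count_predT iter_addr_0 (size_nbr e_deg) -[q x *+ d]mulr_natl mulrA.
by rewrite mulVf ?mul1r // pnatr_eq0 -lt0n.
Qed.

(** Only invariance under side-preserving automorphisms is required, so that
    the process may depend on the side. *)
Definition process (X : V -> Om -> R) : Prop :=
  (forall x, bounded_rv (X x)) /\
  forall (g : graph_aut e) x f, side_pres c g -> X (g x) (act g f) = X x f.

Definition walk (X : V -> Om -> R) : V -> Om -> R := fun x f => avg (X^~ f) x.

Definition cov (X Y : V -> Om -> R) x y : R := E (fun f => X x f * Y y f).

(** The invariant processes form a pre-Hilbert space, in which averaging over
    the neighbours is self-adjoint by mass transport. *)
Definition ip X Y : R := mn (fun x => cov X Y x x).

Lemma sum_nbr_aut (g : graph_aut e) (F : V -> R) x :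
  \sum_(y <- nbr e (g x)) F y = \sum_(y <- nbr e x) F (g y).
Proof.
rewrite -!sumV_nbr // (sumV_reindex _ (aut_bij g)); apply: eq_sumV => y /=.
by rewrite aut_adj.
Qed.

Lemma bounded_rv_walk X x : (forall y, bounded_rv (X y)) -> bounded_rv (walk X x).
Proof. by move=> bX; apply: bounded_rvZ; exact: bounded_rv_sum. Qed.

Lemma process_walk X : process X -> process (walk X).
Proof.
move=> [bX iX]; split => [x|g x f sg]; first exact: bounded_rv_walk.
rewrite /walk /avg sum_nbr_aut; congr (_ * _); apply: eq_bigr => y _.
exact: iX.
Qed.

Lemma cov_inv X Y : process X -> process Y -> diag_inv e c (cov X Y).
Proof.
move=> [bX iX] [bY iY] g x y sg.
rewrite /cov -(Ex_act u_prod g); last exact: bounded_rvM.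
by congr (E _); apply/funext => f /=; rewrite iX // iY.
Qed.

Lemma covC X Y x y : cov X Y x y = cov Y X y x.
Proof. by congr (E _); apply/funext => f; rewrite mulrC. Qed.

Lemma cov_walkr X Y x z : (forall x, bounded_rv (X x)) -> (forall x, bounded_rv (Y x)) ->
  cov X (walk Y) x z = avg (cov X Y x) z.
Proof.
move=> bX bY; rewrite /cov /avg -Ex_sum; last by move=> y; exact: bounded_rvM.
rewrite -ExZ; last by apply: bounded_rv_sum => y; exact: bounded_rvM.
congr (E _); apply/funext => f; rewrite /walk /avg mulrCA; congr (_ * _).
by rewrite mulr_sumr.
Qed.

Lemma ip_walk X Y : process X -> process Y -> ip (walk X) Y = ip X (walk Y).
Proof.
move=> pX pY; rewrite /ip.
transitivity (mn (fun x => d%:R^-1 * \sum_(y <- nbr e x) cov Y X x y)).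
  by apply: eq_mean => x; rewrite covC cov_walkr ?pX.1 ?pY.1 //; case: pX; case: pY.
rewrite meanZ edge_transport; last exact: cov_inv.
rewrite -meanZ; apply: eq_mean => x; rewrite cov_walkr; last 2 first.
- by case: pX.
- by case: pY.
by congr (_ * _); apply: eq_bigr => y _; rewrite covC.
Qed.

Lemma ip_ge0 X : 0 <= ip X X.
Proof. by apply: mean_ge0 => // b _; apply: Ex_ge0 => f; rewrite -expr2 sqr_ge0. Qed.

Lemma ip_cauchy_schwarz X Y : process X -> process Y ->
  ip X Y ^+ 2 <= ip X X * ip Y Y.
Proof.
move=> [bX _] [bY _]; apply: discriminant_le => [|s]; first exact: ip_ge0.
have := ip_ge0 (fun x f => X x f + s * Y x f); congr (_ <= _).
rewrite /ip.
transitivity (mn (fun x => cov X X x x + s * (2%:R * cov X Y x x) + s ^+ 2 * cov Y Y x x)).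
  apply: eq_mean => x; rewrite /cov -!ExZ; try by bounded.
  rewrite -!ExD; try by bounded.
  by congr (E _); apply/funext => f; ring.
by rewrite !meanD !meanZ.
Qed.

Lemma process_iter X n : process X -> process (iter n walk X).
Proof. by move=> pX; elim: n => //= n; exact: process_walk. Qed.

Lemma iter_walkE X n x f :
  iter n walk X x f = sumV (fun y => srw R e n x y * X y f).
Proof.
elim: n x => [|n IH] x.
  rewrite /= (@sumV1 _ _ _ x) ?eqxx ?mul1r // => y; rewrite eq_sym => /negbTE ->.
  by rewrite mul0r.
rewrite iterS /walk /avg -/walk.
transitivity (d%:R^-1 * \sum_(y <- nbr e x) sumV (fun z => srw R e n y z * X z f)).
  by congr (_ * _); apply: eq_bigr => y _; rewrite IH.
rewrite -(@sumV_big _ _ _ _ (fun y z => srw R e n y z * X z f) (ball_seq e n.+1 x)).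
  rewrite -sumVZ; apply: eq_sumV => z.
  by rewrite (srwS R e_lf e_deg d0) -mulrA mulr_suml.
move=> y; rewrite (mem_nbr e_lf) => exy z; rewrite mulf_eq0 negb_or => /andP[+ _].
move/(srw_ball e_lf e_deg d0) => zy.
by rewrite -add1n; apply: (ball_trans e_lf (ball1 e_lf exy) zy).
Qed.

Lemma cov_iter_walk X x z n : (forall x, bounded_rv (X x)) ->
  cov X (iter n walk X) x z = sumV (fun y => srw R e n z y * cov X X x y).
Proof.
move=> bX; set s := ball_seq e n z.
have supp (F : V -> R) : supported (fun y => srw R e n z y * F y) s.
  move=> y; rewrite mulf_eq0 negb_or => /andP[+ _].
  exact: (srw_ball e_lf e_deg d0).
rewrite (sumV_undup (supp _)) /cov.
rewrite (_ : (fun f => _) =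
    (fun f => \sum_(y <- undup s) srw R e n z y * (X x f * X y f))).
  by rewrite Ex_sum; [apply: eq_bigr => y _; rewrite ExZ //|move=> y]; bounded.
apply/funext => f; rewrite iter_walkE (sumV_undup (supp _)) mulr_sumr.
by apply: eq_bigr => y _; rewrite mulrCA.
Qed.

Lemma ip_iter_walk X Y n : process X -> process Y ->
  ip (iter n walk X) Y = ip X (iter n walk Y).
Proof.
move=> pX; elim: n Y => // n IH Y pY.
rewrite [iter n.+1 walk X]iterS ip_walk //; last exact: process_iter.
by rewrite IH; [rewrite -iterSr|exact: process_walk].
Qed.

Definition norm2 X := ip X X.

(** If [X] is decorrelated at large distances then the growth rate of the
    squared norms of its iterated averages is governed by return probabilities.
    These squared norms form a log-convex sequence, because averaging is
    self-adjoint, so already the first step contracts by that rate. *)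
Lemma walk_contraction_decorrelated X K (r : R) : process X ->
  (forall x f, `|X x f| <= 1) ->
  (forall x y, y \notin ball_seq e K x -> cov X X x y = 0) -> 0 < r ->
  (forall x y, exists C, forall n, srw R e n x y <= C * r ^+ n) ->
  norm2 (walk X) <= r ^+ 2 * norm2 X.
Proof.
move=> pX X1 Xfar r0 decay; have [bX _] := pX.
have [Cf hC] : exists Cf : V * V -> R, forall p n, srw R e n p.1 p.2 <= Cf p * r ^+ n.
  exists (fun p => projT1 (cid (decay p.1 p.2))) => p.
  exact: (projT2 (cid (decay p.1 p.2))).
pose C := mn (fun b => \sum_(y <- undup (ball_seq e K b)) Cf (b, y)).
apply: (@log_convex_first_step _ (fun n => norm2 (iter n walk X)) C); first exact: exprn_gt0.
- by move=> n; exact: ip_ge0.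
- move=> n; rewrite {1}/norm2 {1}iterS ip_walk; try exact: process_iter.
  by apply: ip_cauchy_schwarz; [exact: process_iter|exact: (@process_iter X n.+2)].
move=> n; rewrite /norm2 ip_iter_walk //; last exact: process_iter.
rewrite -iterD -exprM mulnC muln2 -addnn.
rewrite [leRHS]mulrC /C -meanZ; apply: mean_le => // b _.
rewrite cov_iter_walk //.
rewrite (@sumV_undup _ _ _ (ball_seq e K b)); last first.
  by move=> y; apply: contraNT => /Xfar ->; rewrite mulr0.
rewrite mulr_sumr; apply: ler_sum => y _.
rewrite [leRHS]mulrC; apply: le_trans (hC (b, y) _).
apply: ler_piMr; first exact: (srw_ge0 R e_lf e_deg d0).
rewrite -[leRHS](Ex_cst u 1); apply: Ex_le; try by bounded.
move=> f; apply: le_trans (ler_norm _) _; rewrite normrM.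
by rewrite -[leRHS]mulr1; apply: ler_pM.
Qed.

(** * Approximation of invariant events by block factors *)

Definition ev_process (A : V -> Om -> Prop) : Prop :=
  (forall x, event (A x)) /\
  forall (g : graph_aut e) x f, side_pres c g -> A (g x) (act g f) <-> A x f.

Definition centered (A : V -> Om -> Prop) x f : R := ind R (A x) f - Pr u (A x).

Lemma process_ind A : ev_process A -> process (fun x => ind R (A x)).
Proof.
move=> [eA iA]; split => [x|g x f sg]; first exact: bounded_rv_ind.
by rewrite /ind (asbool_equiv_eq (iA g x f sg)).
Qed.

Lemma process_mean X : process X -> invariant (fun x => E (X x)).
Proof.
move=> [bX iX] g x sg; rewrite -(Ex_act u_prod g) //.
by congr (E _); apply/funext => f /=; rewrite iX.
Qed.

Lemma process_center X : process X -> process (fun x f => X x f - E (X x)).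
Proof.
move=> pX; have [bX iX] := pX; split => [x|g x f sg]; first by bounded.
by rewrite iX // process_mean.
Qed.

Lemma process_centered A : ev_process A -> process (centered A).
Proof. by move=> /process_ind/process_center. Qed.

Lemma finite_seqs (B : seq V) n :
  finite_set [set s : seq V | size s = n /\ {subset s <= B}].
Proof.
elim: n => [|n IH].
  apply: (@sub_finite_set _ _ [set [::]]); last exact: finite_set1.
  by move=> s [/size0nil -> _].
have fin : finite_set ([set` B] `*` [set s : seq V | size s = n /\ {subset s <= B}]).
  by apply: finite_setX => //; exact: finite_seq.
apply: sub_finite_set (finite_image (fun p => p.1 :: p.2) fin).
move=> [|v s] [//= [sz] sub]; exists (v, s) => //; split => /=.
  by apply: sub; exact: mem_head.
by split => // z zs; apply: sub; rewrite inE zs orbT.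
Qed.

Section BlockFactor.
Variables (S : V -> seq V) (C : V -> set Om) (K : nat).
Hypotheses (C_cyl : forall b, cyl [set` S b] (C b))
  (S_ball : forall b, b \in orbs -> {subset S b <= ball_seq e K b})
  (rep_aut : forall (g : graph_aut e) x, side_pres c g -> rep (g x) = rep x).

(** The events [C b] depend on finitely many labels but are not invariant
    under the stabilizer of [b]. Averaging over the images of [C (rep x)]
    under all automorphisms that move [rep x] to [x] restores equivariance.
    There are finitely many images of the list [S (rep x)], and each of them
    determines the image of the event. *)
Definition copies x : set (seq V) :=
  [set s | exists h : graph_aut e, [/\ side_pres c h, h (rep x) = x &
     s = map h (S (rep x))]].

Definition block_event b s (f : Om) : Prop :=
  exists f', C b f' /\ map f' (S b) = map f s.

Definition copy_event x s (f : Om) : Prop :=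
  copies x s /\ block_event (rep x) s f.

Lemma block_eventE b (h : graph_aut e) f :
  block_event b (map h (S b)) f <-> C b (act (aut_rev h) f).
Proof.
have E1 : map f (map h (S b)) = map (act (aut_rev h) f) (S b) by rewrite -map_comp.
rewrite /block_event E1; split => [[f' [Cf' /eq_in_map ff']]|Cf]; last by exists (act (aut_rev h) f).
by apply: (cyl_depends (@C_cyl b) _ Cf') => v vS; exact: ff'.
Qed.

Lemma copies_ball x s : copies x s -> {subset s <= ball_seq e K x}.
Proof.
move=> [h [sh hx ->]] _ /mapP[v vS ->].
by rewrite -hx ball_aut //; exact: S_ball.
Qed.

Lemma finite_copies x : finite_set (copies x).
Proof.
apply: sub_finite_set (finite_seqs (ball_seq e K x) (size (S (rep x)))) => s cs.
split; last exact: copies_ball.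
by case: cs => h [_ _ ->]; rewrite size_map.
Qed.

Lemma copies_aut (g : graph_aut e) x s : side_pres c g ->
  copies (g x) (map g s) <-> copies x s.
Proof.
move=> sg; rewrite /copies /= rep_aut //; split.
  move=> [h [sh hx E1]]; exists (aut_comp (aut_rev g) h); split.
  - by apply: side_pres_comp => //; exact: side_pres_rev.
  - by rewrite /= hx aut_funK.
  - apply: (inj_map (@aut_inj _ _ g)); rewrite E1 -map_comp.
    by apply: eq_map => v /=; rewrite aut_invK.
move=> [h [sh hx ->]]; exists (aut_comp g h); split.
- exact: side_pres_comp.
- by rewrite /= hx.
- by rewrite -map_comp.
Qed.

Definition copy_seq x : seq (seq V) := fset_set (copies x).

Lemma mem_copy_seq x s : (s \in copy_seq x) = `[< copies x s >].
Proof.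
rewrite /copy_seq in_fset_set; last exact: finite_copies.
by apply/idP/idP => [/set_mem/asboolP|/asboolP/mem_set].
Qed.

Lemma cyl_copy_event x s : copies x s -> cyl [set` s] (copy_event x s).
Proof.
move=> cs; have [h [sh hx sE]] := cs.
have -> : copy_event x s = act (aut_rev h) @^-1` C (rep x).
  apply/seteqP; split => f; rewrite /copy_event /= sE.
    by move=> [_ /block_eventE].
  by move=> /block_eventE; split => //; rewrite -sE.
have := @cyl_act R V e (aut_rev h) _ _ (@C_cyl (rep x)); apply: cyl_sub.
by move=> _ [v vS <-] /=; rewrite sE; apply/mapP; exists v.
Qed.

Lemma event_copy x s : event (copy_event x s).
Proof.
have [cs|ncs] := pselect (copies x s); first exact: cyl_measurable (cyl_copy_event cs).
by apply: (@event_ext _ _ (fun=> False)); [move=> f; split => // -[] | exact: event_cst].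
Qed.

Definition block x (f : Om) : R :=
  (size (copy_seq x))%:R^-1 * \sum_(s <- copy_seq x) ind R (copy_event x s) f.

Lemma size_copy_seq x : (0 < size (copy_seq x))%N.
Proof.
have [g sg gx] := rep_ex x.
have : map g (S (rep x)) \in copy_seq x by rewrite mem_copy_seq; apply/asboolP; exists g.
by case: (copy_seq x).
Qed.

Lemma block_bounds x f : 0 <= block x f <= 1.
Proof.
have s0 : 0 < (size (copy_seq x))%:R :> R by rewrite ltr0n size_copy_seq.
apply/andP; split.
  by apply: mulr_ge0; [rewrite invr_ge0 ltW | apply: sumr_ge0 => s _; exact: ind_ge0].
rewrite /block mulrC ler_pdivrMr // mul1r.
apply: (@le_trans _ _ (\sum_(s <- copy_seq x) 1)); first by apply: ler_sum => s _; exact: ind_le1.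
by rewrite big_const_seq count_predT iter_addr_0.
Qed.

Lemma process_block : process block.
Proof.
split=> [x|g x f sg].
  apply: bounded_rvZ; apply: bounded_rv_sum => s.
  by apply: bounded_rv_ind; exact: event_copy.
have P : perm_eq (copy_seq (g x)) (map (map g) (copy_seq x)).
  apply: uniq_perm; first exact: fset_uniq.
    by rewrite map_inj_uniq ?fset_uniq //; apply: inj_map; exact: aut_inj.
  move=> s; rewrite mem_copy_seq; apply/asboolP/mapP.
    move=> cs; have sE : s = map g (map (aut_inv g) s).
      by rewrite -map_comp -[LHS]map_id; apply: eq_map => v /=; rewrite aut_invK.
    exists (map (aut_inv g) s) => //; rewrite mem_copy_seq; apply/asboolP.
    by move: cs; rewrite {1}sE => /(@copies_aut g x _ sg).
  by move=> [t]; rewrite mem_copy_seq => /asboolP ct ->; apply/copies_aut.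
rewrite /block (perm_size P) size_map (perm_big _ P) big_map.
congr (_ * _); apply: eq_bigr => s _; rewrite /ind; congr (_%:R); congr nat_of_bool.
apply: asbool_equiv_eq; rewrite /copy_event copies_aut // rep_aut //.
rewrite /block_event -map_comp (@eq_map _ _ (act g f \o g) f) //.
by move=> v; rewrite /act_label_config /= aut_funK.
Qed.

(** By invariance each of the averaged events is as close to [A x] as [C (rep x)]
    is to [A (rep x)]. *)
Lemma block_approx A eps x : ev_process A -> 0 <= eps ->
  (forall b, dist_ev u (A b) (C b) <= eps) ->
  E (fun f => `|ind R (A x) f - block x f|) <= eps.
Proof.
move=> [eA iA] eps0 hC.
have s0 : 0 < (size (copy_seq x))%:R :> R by rewrite ltr0n size_copy_seq.
have bA := bounded_rv_ind R (eA x).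
have bD s : bounded_rv (ind R (copy_event x s)) by apply: bounded_rv_ind; exact: event_copy.
have bb : bounded_rv (block x) by case: process_block.
pose avgd f := (size (copy_seq x))%:R^-1 *
  \sum_(s <- copy_seq x) `|ind R (A x) f - ind R (copy_event x s) f|.
have bds s : bounded_rv (fun f => `|ind R (A x) f - ind R (copy_event x s) f|) by bounded.
apply: (@le_trans _ _ (E avgd)).
  apply: Ex_le; [by bounded| |move=> f].
    by apply: bounded_rvZ; apply: bounded_rv_sum => s; exact: bds.
  have -> : ind R (A x) f - block x f = (size (copy_seq x))%:R^-1 *
      \sum_(s <- copy_seq x) (ind R (A x) f - ind R (copy_event x s) f).
    rewrite sumrB mulrBr big_const_seq count_predT iter_addr_0 /block.
    by rewrite -[ind R (A x) f *+ _]mulr_natl mulKf // gt_eqF.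
  rewrite /avgd normrM ger0_norm; last by rewrite invr_ge0 ltW.
  rewrite ler_pM2l ?invr_gt0 //.
  exact: ler_norm_sum.
rewrite ExZ; last by apply: bounded_rv_sum => s; exact: bds.
rewrite Ex_sum // mulrC ler_pdivrMr //.
apply: (@le_trans _ _ (\sum_(s <- copy_seq x) eps)); last first.
  by rewrite big_const_seq count_predT iter_addr_0 mulr_natr.
rewrite big_seq [leRHS]big_seq; apply: ler_sum => s.
rewrite mem_copy_seq => /asboolP cs; have [h [sh hx sE]] := cs.
apply: le_trans (hC (rep x)); rewrite /dist_ev.
rewrite -[leRHS](Ex_act u_prod (aut_rev h)); last first.
  by apply: bounded_rv_dist; [exact: eA|exact: cyl_measurable (@C_cyl _)].
rewrite le_eqVlt; apply/orP; left; apply/eqP; congr (E _); apply/funext => f /=.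
have rx : aut_rev h x = rep x by rewrite /= -[in LHS]hx aut_funK.
have <- : ind R (A x) f = ind R (A (rep x)) (act (aut_rev h) f).
  rewrite /ind -rx; congr (_%:R); congr nat_of_bool; apply: asbool_equiv_eq.
  by apply: iff_sym; apply: iA; exact: side_pres_rev.
congr (`|_ - _|); rewrite /ind; congr (_%:R); congr nat_of_bool.
apply: asbool_equiv_eq; rewrite /copy_event sE block_eventE -sE; tauto.
Qed.

Lemma block_indep x y : y \notin ball_seq e (K + K) x ->
  E (fun f => block x f * block y f) = E (block x) * E (block y).
Proof.
move=> far; have bD z s : bounded_rv (ind R (copy_event z s)).
  by apply: bounded_rv_ind; exact: event_copy.
have bS z : bounded_rv (fun f => \sum_(s <- copy_seq z) ind R (copy_event z s) f) by bounded.
rewrite /block !ExZ // !Ex_sum //.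
transitivity ((size (copy_seq x))%:R^-1 * (size (copy_seq y))%:R^-1 *
  E (fun f => \sum_(s <- copy_seq x) \sum_(t <- copy_seq y)
      ind R (copy_event x s) f * ind R (copy_event y t) f)).
  rewrite -ExZ; last by bounded.
  by congr (E _); apply/funext => f; rewrite mulrACA big_distrlr.
rewrite mulrACA; congr (_ * _); rewrite Ex_sum; last by move=> s; bounded.
rewrite big_distrlr /=; rewrite big_seq [RHS]big_seq; apply: eq_bigr => s.
rewrite mem_copy_seq => /asboolP cs; rewrite Ex_sum; last by move=> t; bounded.
rewrite big_seq [RHS]big_seq; apply: eq_bigr => t.
rewrite mem_copy_seq => /asboolP ct.
have dis : [set` s] `&` [set` t] = set0.
  apply/seteqP; split => // v [/= /(copies_ball cs) vx /(copies_ball ct) vy].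
  by move/negP: far; apply; apply: (ball_trans e_lf vx); exact: ball_sym.
have es := event_copy x s; have et := event_copy y t.
transitivity (Pr u (fun f => copy_event x s f /\ copy_event y t f)).
  congr (E _); apply/funext => f; rewrite /ind asbool_and.
  by case: asbool; case: asbool; rewrite ?mulr1 ?mulr0.
apply: EFin_inj; rewrite PrE; last exact: event_and.
rewrite EFinM -/(Pr u _) -/(Pr u _) !PrE //.
exact: (cyl_indep u_prod dis (cyl_copy_event cs) (cyl_copy_event ct)).
Qed.

End BlockFactor.

Section Contraction.
Hypothesis rep_aut : forall (g : graph_aut e) x, side_pres c g -> rep (g x) = rep x.

Lemma E_abs_le X eps : bounded_rv X -> E (fun f => `|X f|) <= eps -> `|E X| <= eps.
Proof. by move=> bX; apply: le_trans (Ex_norm u bX). Qed.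

Lemma Ex_center (h k : Om -> R) : bounded_rv h -> bounded_rv k ->
  E (fun f => (h f - E h) * (k f - E k)) = E (fun f => h f * k f) - E h * E k.
Proof.
move=> bh bk.
transitivity (E (fun f => h f * k f - E h * k f - (E k * h f - E h * E k))).
  by congr (E _); apply/funext => f; ring.
rewrite !ExB; try by bounded.
rewrite !ExZ; try by bounded.
by rewrite !Ex_cst; ring.
Qed.

(** The approximation is a centered block factor. *)
Lemma centered_approx A eps : ev_process A -> 0 < eps ->
  exists (X : V -> Om -> R) (K : nat),
    [/\ process X, forall x f, `|X x f| <= 1,
        forall x y, y \notin ball_seq e K x -> cov X X x y = 0 &
        forall x, E (fun f => `|centered A x f - X x f|) <= eps].
Proof.
move=> pA eps0; have [eA iA] := pA.
have e2 : 0 < eps / 2 by rewrite divr_gt0.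
have ap b := approx_cyl u (eA b) e2.
pose S b : seq V := projT1 (cid (ap b)).
pose C b : set Om := projT1 (cid (projT2 (cid (ap b)))).
have CP b : cyl [set` S b] (C b) /\ dist_ev u (A b) (C b) < eps / 2.
  exact: (projT2 (cid (projT2 (cid (ap b))))).
have C_cyl b : cyl [set` S b] (C b) by have [] := CP b.
have [K S_ball] := ball_seqs_common e_conn e_lf orbs S.
have pB := process_block C_cyl S_ball rep_aut.
have [bB _] := pB; set B := block S C in pB bB.
have B01 := block_bounds C S_ball; have bA x := bounded_rv_ind R (eA x).
have EB x : 0 <= E (B x) <= 1.
  apply/andP; split; first by apply: Ex_ge0 => f; have /andP[] := B01 x f.
  rewrite -[leRHS](Ex_cst u 1); apply: Ex_le => //; first exact: bounded_rv_cst.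
  by move=> f; have /andP[] := B01 x f.
exists (fun x f => B x f - E (B x)), (K + K)%N; split.
- exact: process_center.
- move=> x f; have /andP[b0 b1] := B01 x f; have /andP[e0 e1] := EB x.
  by rewrite ler_norml -/(B x f) in b0 b1 *; apply/andP; split; lra.
- move=> x y far; rewrite /cov.
  transitivity (E (fun f => B x f * B y f) - E (B x) * E (B y)).
    exact: Ex_center.
  apply/eqP; rewrite subr_eq0; apply/eqP.
  exact: (block_indep C_cyl S_ball far).
move=> x; have ab := block_approx C_cyl S_ball rep_aut x pA (ltW e2)
  (fun b => ltW (CP b).2); rewrite -/(B x) in ab.
apply: (@le_trans _ _ (E (fun f => `|ind R (A x) f - B x f| + `|E (fun f => ind R (A x) f - B x f)|))).
  apply: Ex_le; [by rewrite /centered; bounded|by bounded|move=> f].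
  rewrite ExB // -/(Pr u _) /centered.
  have -> : ind R (A x) f - Pr u (A x) - (B x f - E (B x)) =
    (ind R (A x) f - B x f) - (Pr u (A x) - E (B x)) by ring.
  exact: ler_normB.
have bAB : bounded_rv (fun f => ind R (A x) f - B x f) by bounded.
rewrite (ExD u (bounded_rv_norm bAB) (bounded_rv_cst _ _)).
by rewrite Ex_cst [leRHS]splitr lerD // E_abs_le.
Qed.

Lemma avg_le (q q' : V -> R) x : (forall y, q y <= q' y) -> avg q x <= avg q' x.
Proof. by move=> qq'; rewrite ler_wpM2l ?invr_ge0 ?ler0n // ler_sum. Qed.

Lemma avgDc (q : V -> R) k x : avg (fun y => q y + k) x = avg q x + k.
Proof.
rewrite /avg big_split /= big_const_seq count_predT iter_addr_0 (size_nbr e_deg).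
by rewrite mulrDr -[k *+ d]mulr_natl mulKf // pnatr_eq0 -lt0n.
Qed.

Lemma norm2_walk X : (forall x, bounded_rv (X x)) ->
  norm2 (walk X) = mn (fun x => avg (fun y => avg (cov X X y) x) x).
Proof.
move=> bX; apply: eq_mean => x; have bW z := bounded_rv_walk z bX.
rewrite cov_walkr //; congr (_ * _); apply: eq_bigr => y _.
by rewrite covC cov_walkr.
Qed.

Lemma cov_close X Y eps x y : (forall x, bounded_rv (X x)) ->
  (forall x, bounded_rv (Y x)) -> (forall x f, `|X x f| <= 1) ->
  (forall x f, `|Y x f| <= 1) ->
  (forall x, E (fun f => `|X x f - Y x f|) <= eps) ->
  cov X X x y <= cov Y Y x y + eps * 2%:R.
Proof.
move=> bX bY X1 Y1 h.
apply: (@le_trans _ _ (E (fun f => Y x f * Y y f +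
    (`|X x f - Y x f| + `|X y f - Y y f|)))).
  apply: Ex_le; [by bounded|by bounded|move=> f].
  have -> : X x f * X y f = Y x f * Y y f + ((X x f - Y x f) * X y f + Y x f * (X y f - Y y f)) by ring.
  rewrite lerD2l; apply: le_trans (ler_norm _) _; apply: le_trans (ler_normD _ _) _.
  rewrite !normrM; apply: lerD.
    by rewrite -[leRHS]mulr1 ler_wpM2l.
  by rewrite -[leRHS]mul1r ler_wpM2r.
rewrite !ExD; try by bounded.
by rewrite lerD2l mulr_natr mulr2n lerD.
Qed.

Lemma centered_le1 A x f : ev_process A -> `|centered A x f| <= 1.
Proof.
move=> [eA _]; have := ind_ge0 R (A x) f; have := ind_le1 R (A x) f.
have := Pr_ge0 u (A x); have := Pr_le1 u (eA x).
by rewrite /centered ler_norml; move=> *; apply/andP; split; lra.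
Qed.

(** The contraction passes from decorrelated processes to their limits. *)
Lemma centered_contraction A (r : R) : ev_process A -> 0 < r -> r < 1 ->
  (forall x y, exists C, forall n, srw R e n x y <= C * r ^+ n) ->
  norm2 (walk (centered A)) <= r ^+ 2 * norm2 (centered A).
Proof.
move=> pA r0 r1 decay; set W := mn (fun=> 1).
have W0 : 0 <= W by apply: mean_ge0.
apply/ler_addgt0Pr => delta delta0.
pose eps := delta / (4%:R * W + 1).
have k0 : 0 < 4%:R * W + 1 by rewrite ltr_wpDl // mulr_ge0.
have eps0 : 0 < eps by rewrite divr_gt0.
have [X [K [pX X1 far close]]] := centered_approx pA eps0.
have pY := process_centered pA; have Y1 x f := centered_le1 x f pA.
have [bX _] := pX; have [bY _] := pY.
have le1 : norm2 (walk (centered A)) <= norm2 (walk X) + eps * 2%:R * W.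
  rewrite !norm2_walk // -meanZ -meanD; apply: mean_le => // b _.
  rewrite mulr1 -avgDc; apply: avg_le => y; rewrite -avgDc; apply: avg_le => z.
  exact: cov_close.
have le2 : norm2 X <= norm2 (centered A) + eps * 2%:R * W.
  rewrite /norm2 /ip -meanZ -meanD; apply: mean_le => // b _.
  rewrite mulr1; apply: cov_close => // x.
  by rewrite (_ : (fun f => _) = (fun f => `|centered A x f - X x f|)) //; apply/funext => f; rewrite distrC.
have le3 := walk_contraction_decorrelated pX X1 far r0 decay.
have rr : r ^+ 2 <= 1 by rewrite expr_le1 // ltW.
apply: le_trans le1 _.
apply: (@le_trans _ _ (r ^+ 2 * norm2 (centered A) + eps * (4%:R * W))).
  have : r ^+ 2 * norm2 X <= r ^+ 2 * (norm2 (centered A) + eps * 2%:R * W).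
    by rewrite ler_wpM2l // exprn_ge0 // ltW.
  have : r ^+ 2 * (eps * 2%:R * W) <= eps * 2%:R * W.
    by apply: ler_piMl => //; apply: mulr_ge0 => //; apply: mulr_ge0 => //; exact: ltW.
  rewrite mulrDr; lra.
rewrite lerD2l -[leRHS](divfK (lt0r_neq0 k0)) -/eps ler_pM2l //.
by rewrite lerDl.
Qed.

End Contraction.

(** * Spectral gap of the orbit chain *)

(** The variance of [q] over the neighbours of [x] is the normalized sum of all
    squared differences, of which [(q y - q z) ^+ 2] is one term. *)
Lemma avg_variance (q : V -> R) x y z : e x y -> e x z ->
  (q y - q z) ^+ 2 / (2%:R * d%:R ^+ 2) <= avg (fun y => q y ^+ 2) x - avg q x ^+ 2.
Proof.
move=> exy exz; have dR : 0 < d%:R :> R by rewrite ltr0n.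
set s := nbr e x; have sy : y \in s by rewrite (mem_nbr e_lf).
have sz : z \in s by rewrite (mem_nbr e_lf).
have S2 : \sum_(a <- s) \sum_(b <- s) (q a - q b) ^+ 2 =
    2%:R * d%:R * \sum_(a <- s) q a ^+ 2 - 2%:R * (\sum_(a <- s) q a) ^+ 2.
  transitivity (\sum_(a <- s) (d%:R * q a ^+ 2 + \sum_(b <- s) q b ^+ 2 -
      2%:R * q a * \sum_(b <- s) q b)).
    apply: eq_bigr => a _; rewrite mulr_sumr.
    transitivity (\sum_(b <- s) (q a ^+ 2 + q b ^+ 2 - 2%:R * q a * q b)).
      by apply: eq_bigr => b _; ring.
    rewrite sumrB big_split /= big_const_seq count_predT iter_addr_0 (size_nbr e_deg).
    by rewrite -[q a ^+ 2 *+ d]mulr_natl.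
  rewrite sumrB big_split /= -mulr_sumr big_const_seq count_predT iter_addr_0.
  rewrite (size_nbr e_deg) -mulr_natl -mulr_suml -mulr_sumr; ring.
have le : (q y - q z) ^+ 2 <= \sum_(a <- s) \sum_(b <- s) (q a - q b) ^+ 2.
  rewrite (bigD1_seq y) ?uniq_nbr //= (bigD1_seq z) ?uniq_nbr //= -addrA lerDl.
  by rewrite addr_ge0 // sumr_ge0 // => a _; rewrite ?sumr_ge0 // => *; exact: sqr_ge0.
rewrite S2 in le.
rewrite ler_pdivrMr; last by rewrite mulr_gt0 // exprn_gt0.
apply: le_trans le _; rewrite /avg -/s le_eqVlt; apply/orP; left; apply/eqP.
by field; rewrite gt_eqF.
Qed.

Lemma avg_variance_ge0 (q : V -> R) x :
  0 <= avg (fun y => q y ^+ 2) x - avg q x ^+ 2.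
Proof.
have : (0 < size (nbr e x))%N by rewrite (size_nbr e_deg).
case E1 : (nbr e x) => [//|t r] _.
have ext : e x t by rewrite -(mem_nbr e_lf) E1 mem_head.
by apply: le_trans (avg_variance q ext ext); rewrite subrr expr0n mul0r.
Qed.

Section Poincare.
Variables (s : bool) (q : V -> R) (eta : R) (D : nat).
Hypotheses (eta0 : 0 < eta) (eta_w : forall b, b \in orbs -> eta <= w b)
  (diam : forall b b', b \in orbs -> b' \in orbs -> b' \in ball_seq e D b)
  (q_inv : invariant q) (q_supp : forall x, c x != s -> q x = 0) (q_mean : mn q = 0).

Let energy := mn (fun x => q x ^+ 2) - mn (fun x => avg q x ^+ 2).
Let delta := Num.sqrt (2%:R * d%:R ^+ 2 * energy / eta).

Lemma energyE :
  energy = mn (fun x => avg (fun y => q y ^+ 2) x - avg q x ^+ 2).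
Proof. by rewrite meanB mean_avg // => h v sh; rewrite q_inv. Qed.

Lemma energy_ge0 : 0 <= energy.
Proof. by rewrite energyE; apply: mean_ge0 => // b _; exact: avg_variance_ge0. Qed.

Lemma energy_ge x y z : e x y -> e x z ->
  eta * ((q y - q z) ^+ 2 / (2%:R * d%:R ^+ 2)) <= energy.
Proof.
have [g sg gx] := rep_ex x; rewrite -gx -(aut_invK g y) -(aut_invK g z) !aut_adj.
rewrite !q_inv //; move: (aut_inv g y) (aut_inv g z) (rep_orbs x) => y' z' bo.
move: (rep x) bo => b bo eby ebz.
rewrite energyE.
apply: le_trans (mean_ge w_gt0 bo (avg_variance_ge0 q)).
apply: (@le_trans _ _ (w b * ((q y' - q z') ^+ 2 / (2%:R * d%:R ^+ 2)))).
  by rewrite ler_wpM2r ?eta_w // divr_ge0 ?sqr_ge0 // mulr_ge0 // exprn_ge0.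
by rewrite ler_pM2l //; exact: avg_variance.
Qed.

Lemma step_le x y z : e x y -> e x z -> `|q y - q z| <= delta.
Proof.
move=> exy exz; have dR : 0 < d%:R :> R by rewrite ltr0n.
rewrite -sqrtr_sqr; apply: ler_wsqrtr; rewrite ler_pdivlMr //.
have k0 : 0 < 2%:R * d%:R ^+ 2 :> R by rewrite mulr_gt0 // exprn_gt0.
by rewrite mulrC [leRHS]mulrC -ler_pdivrMr // -mulrA (energy_ge exy exz).
Qed.

(** Steps of two edges stay on one side, and [q] changes by at most [delta]
    along each of them. If [y] lies on the other side then the bound holds at
    its neighbours instead. *)
Lemma oscillation_le n x y : y \in ball_seq e n x ->
  (c y = c x -> `|q y - q x| <= n%:R * delta) /\
  (c y != c x -> forall z, e y z -> `|q z - q x| <= n%:R * delta).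
Proof.
have delta0 : 0 <= delta by exact: sqrtr_ge0.
elim: n y => [|n IH] y.
  by rewrite inE => /eqP ->; split; rewrite ?subrr ?normr0 ?mul0r // eqxx.
have weak a : a <= n%:R * delta -> a <= n.+1%:R * delta.
  by move=> h; apply: le_trans h _; rewrite ler_wpM2r // ler_nat.
move=> /(ball_ind e_lf)[/IH[h1 h2]|[t /IH[h1 h2] ety]].
  by split=> [/h1/weak|/h2 h z /h/weak].
have cty := e_col ety; split => [cyx|cyx z eyz].
  by apply/weak/h2 => //; rewrite -cyx.
have ctx : c t = c x by case: (c t) (c y) (c x) cty cyx => [] [] [].
rewrite -natr1 mulrDl mul1r.
rewrite (_ : q z - q x = (q t - q x) + (q z - q t)); last by ring.
apply: le_trans (ler_normD _ _) _; apply: lerD; first exact: h1.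
by apply: (@step_le y) => //; rewrite e_sym.
Qed.

(** As [q] has mean zero, its value at a vertex of its side is an average of
    differences, which the oscillation bound controls. *)
Lemma sqr_mean_le_energy :
  mn (fun x => q x ^+ 2) <= mn (fun=> 1) * D%:R ^+ 2 * 2%:R * d%:R ^+ 2 / eta * energy.
Proof.
have delta0 : 0 <= delta by exact: sqrtr_ge0.
have Dd0 : 0 <= D%:R * delta by rewrite mulr_ge0.
have qb b : b \in orbs -> `|q b| <= D%:R * delta.
  move=> bo; have [cb|cb] := eqVneq (c b) s; last by rewrite q_supp // normr0.
  pose L := mn (fun x => (c x == s)%:R).
  have L0 : 0 < L.
    apply: lt_le_trans (mean_ge w_gt0 bo (f := fun x => (c x == s)%:R) _) => [|x]; last exact: ler0n.
    by rewrite cb eqxx mulr1.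
  rewrite -(ler_pM2l L0) -[X in X * `|_|]gtr0_norm // -normrM.
  have LE : L * q b = mn (fun x => (c x == s)%:R * (q b - q x)).
    transitivity (mn (fun x => q b * (c x == s)%:R - q x)).
      by rewrite meanB meanZ q_mean subr0 mulrC.
    apply: eq_mean => x; have [cx|cx] := eqVneq (c x) s; first by rewrite mulr1 mul1r.
    by rewrite (q_supp cx) subr0 mulr0 mul0r.
  have bnd x : x \in orbs -> `|(c x == s)%:R * (q b - q x)| <= (D%:R * delta) * (c x == s)%:R.
    move=> xo; have [cx|cx] := eqVneq (c x) s; last by rewrite mul0r normr0 mulr0.
    rewrite mul1r mulr1; apply: (oscillation_le (diam xo bo)).1.
    by rewrite cb cx.
  have -> : L * (D%:R * delta) = mn (fun x => D%:R * delta * (c x == s)%:R).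
    by rewrite meanZ mulrC.
  rewrite LE ler_norml; apply/andP; split.
    rewrite -mulN1r -meanZ; apply: mean_le => // x /bnd.
    by rewrite ler_norml mulN1r => /andP[].
  by apply: mean_le => // x /bnd; rewrite ler_norml => /andP[].
have energy0 := energy_ge0.
have deltaE : delta ^+ 2 = 2%:R * d%:R ^+ 2 * energy / eta.
  rewrite sqr_sqrtr //; apply: divr_ge0 (ltW eta0).
  by rewrite !mulr_ge0 // exprn_ge0.
apply: (@le_trans _ _ (mn (fun=> (D%:R * delta) ^+ 2 * 1))).
  apply: mean_le => // b /qb h; rewrite mulr1 -[q b ^+ 2]real_normK ?num_real //.
  by rewrite lerXn2r // nnegrE.
rewrite meanZ exprMn deltaE le_eqVlt; apply/orP; left; apply/eqP.
by field; rewrite gt_eqF.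
Qed.

End Poincare.

Lemma orbit_weight_min : exists2 eta, 0 < eta & forall b, b \in orbs -> eta <= w b.
Proof.
elim: (orbs) => [|b r [eta eta0 IH]]; first by exists 1.
exists (Num.min eta (w b)); first by rewrite lt_min eta0 w_gt0.
move=> b'; rewrite inE ge_min => /orP[/eqP ->|/IH ->//]; first by rewrite lexx orbT.
Qed.

Lemma orbit_diameter :
  exists D, forall b b', b \in orbs -> b' \in orbs -> b' \in ball_seq e D b.
Proof.
have [D hD] := ball_seqs_common e_conn e_lf orbs (fun=> orbs).
by exists D => b b' bo; exact: hD.
Qed.

(** The spectral gap of a finite connected chain: an invariant function that
    lives on one side is a function of finitely many orbits, and two steps of
    the walk connect them. *)
Lemma poincare : exists2 lam : R, 0 < lam < 1 & forall s q, invariant q ->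
  (forall x, c x != s -> q x = 0) -> mn q = 0 ->
  mn (fun x => avg q x ^+ 2) <= lam * mn (fun x => q x ^+ 2).
Proof.
have [eta eta0 eta_w] := orbit_weight_min; have [D diam] := orbit_diameter.
pose K := mn (fun=> 1) * D%:R ^+ 2 * 2%:R * d%:R ^+ 2 / eta.
have K0 : 0 <= K.
  rewrite /K; apply: divr_ge0 (ltW eta0).
  by rewrite !mulr_ge0 ?exprn_ge0 // mean_ge0.
have K2 : 0 < K + 2%:R by rewrite ltr_wpDl.
exists (1 - (K + 2%:R)^-1).
  apply/andP; split; last by rewrite gtrBl invr_gt0.
  by rewrite subr_gt0 invf_lt1 // ltr_wpDl // ltr1n.
move=> s q qi qs qm; have := sqr_mean_le_energy eta0 eta_w diam qi qs qm.
rewrite -/K; set a := mn _; set b := mn _ => h.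
have a0 : 0 <= a by apply: mean_ge0 => // x _; exact: sqr_ge0.
have ab : 0 <= a - b by exact: (energy_ge0 qi).
have : a <= (K + 2%:R) * (a - b) by rewrite mulrDl; apply: le_trans h _; rewrite lerDl mulr_ge0.
rewrite -ler_pdivrMl // mulrC mulrBl mul1r; lra.
Qed.

(** * Expansion of invariant random sets *)

Definition nbhd (A : V -> Om -> Prop) y (f : Om) : Prop := exists x, e x y /\ A x f.

Lemma ev_process_nbhd A : ev_process A -> ev_process (nbhd A).
Proof.
move=> [eA iA]; split => [y|g y f sg].
  apply: event_ex; first exact: countable_vertices e_conn e_lf.
  by move=> x; apply: event_and; [exact: event_cst|exact: eA].
split => [[x [exy Ax]]|[x [exy Ax]]].
  exists (aut_inv g x); rewrite -(aut_adj g) aut_invK; split => //.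
  by apply/(iA g) => //; rewrite aut_invK.
by exists (g x); rewrite aut_adj; split => //; apply/iA.
Qed.

Definition side s x : R := (c x == s)%:R.

Lemma side_inv s : invariant (side s).
Proof. by move=> g x sg; rewrite /side sg. Qed.

Lemma avg_const_nbr (q : V -> R) k x : (forall y, e x y -> q y = k) -> avg q x = k.
Proof.
move=> h; transitivity (avg (fun=> 0 + k) x); last first.
  by rewrite avgDc /avg big1 // mulr0 add0r.
congr (_ * _); apply: eq_big_seq => y; rewrite (mem_nbr e_lf) => /h ->.
by rewrite add0r.
Qed.

Lemma avg_side s x : avg (side s) x = side (~~ s) x.
Proof.
apply: avg_const_nbr => y exy; rewrite /side; have := e_col exy.
by case: (c x) (c y) s => [] [] [].
Qed.

Lemma mean_side s : mn (side (~~ s)) = mn (side s).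
Proof.
by rewrite -(mean_avg (side_inv s)); apply: eq_mean => x; rewrite avg_side.
Qed.

(** Subtracting from [p] its mean on the side where it lives makes the spectral
    gap applicable. The subtracted constant is moved to the other side by
    averaging, without any loss of norm. *)
Lemma mean_avg_sqr (s : bool) (p : V -> R) lam a L : invariant p ->
  (forall x, c x != s -> p x = 0) -> a = mn p -> L = mn (side s) -> 0 < L ->
  (forall q, invariant q -> (forall x, c x != s -> q x = 0) -> mn q = 0 ->
     mn (fun x => avg q x ^+ 2) <= lam * mn (fun x => q x ^+ 2)) ->
  a ^+ 2 / L <= mn (fun x => p x ^+ 2) /\
  mn (fun x => avg p x ^+ 2) <=
    lam * (mn (fun x => p x ^+ 2) - a ^+ 2 / L) + a ^+ 2 / L.
Proof.
move=> pinv psupp aE LE L0 poinc; have Ln : L != 0 by rewrite gt_eqF.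
have aval y : c y = s -> avg p y = 0.
  move=> cy; apply: avg_const_nbr => x /e_col; rewrite cy => h.
  by apply: psupp; rewrite eq_sym.
pose q x := p x - a / L * side s x.
have qinv : invariant q by move=> g x sg; rewrite /q pinv // side_inv.
have qsupp x : c x != s -> q x = 0.
  by move=> cx; rewrite /q psupp // /side (negbTE cx) mulr0 subr0.
have qmean : mn q = 0 by rewrite meanB meanZ -LE -aE divfK // subrr.
have side2 t x : side t x ^+ 2 = side t x.
  by rewrite /side; case: (_ == _); rewrite ?expr1n ?expr0n.
have q2 : mn (fun x => q x ^+ 2) = mn (fun x => p x ^+ 2) - a ^+ 2 / L.
  transitivity (mn (fun x => p x ^+ 2 - 2%:R * (a / L) * p x + (a / L) ^+ 2 * side s x)).
    apply: eq_mean => x; rewrite /q -{2}(side2 s x).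
    have : p x * side s x = p x.
      have [cx|/psupp ->] := eqVneq (c x) s; last by rewrite mul0r.
      by rewrite /side cx eqxx mulr1.
    move=> ps; have -> : 2%:R * (a / L) * p x = 2%:R * (a / L) * (p x * side s x) by rewrite ps.
    ring.
  rewrite meanD meanB !meanZ -LE -aE; field.
  by [].
have aq x : avg q x = avg p x - a / L * side (~~ s) x.
  rewrite -avg_side /avg mulrCA -mulrBr; congr (_ * _).
  by rewrite mulr_sumr -sumrB.
have aq2 : mn (fun x => avg q x ^+ 2) = mn (fun x => avg p x ^+ 2) - a ^+ 2 / L.
  transitivity (mn (fun x => avg p x ^+ 2 - 2%:R * (a / L) * avg p x +
      (a / L) ^+ 2 * side (~~ s) x)).
    apply: eq_mean => x; rewrite aq -{2}(side2 (~~ s) x).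
    have ps : avg p x * side (~~ s) x = avg p x.
      have [cx|cx] := eqVneq (c x) s; first by rewrite aval // mul0r.
      by rewrite /side (_ : (c x == ~~ s)) ?mulr1 //; case: (c x) (s) cx => [] [].
    have -> : 2%:R * (a / L) * avg p x = 2%:R * (a / L) * (avg p x * side (~~ s) x) by rewrite ps.
    ring.
  have ma : mn (fun x => avg p x) = a by rewrite aE -(mean_avg pinv).
  rewrite meanD meanB (meanZ orbs w (2%:R * (a / L)) (avg p)) meanZ mean_side -LE ma; field.
  by [].
split.
  by rewrite -subr_ge0 -q2; apply: mean_ge0 => // x _; exact: sqr_ge0.
by rewrite -lerBlDr -aq2 -q2; exact: poinc.
Qed.

Definition density (A : V -> Om -> Prop) : R := mn (fun x => Pr u (A x)).

(** Averaging the indicator of [A] gives a function supported on its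
    neighbourhood, so by Cauchy-Schwarz [a ^+ 2] is at most the squared norm
    of the average times [nu]. The indicator is the sum of its centered part,
    contracted by the decay rate of the walk, and of the function
    [p x = Pr (A x)], which differs from its mean on the side of [A] by a part
    that is contracted by the spectral gap. Hence
    [a ^+ 2 <= (k * (a - t) + t) * nu] with [t = a ^+ 2 / L]. *)
Theorem expansion :
  (forall (g : graph_aut e) x, side_pres c g -> rep (g x) = rep x) ->
  nonamenable R e ->
  exists2 k : R, 0 < k < 1 & forall s A, ev_process A ->
    (forall x f, A x f -> c x = s) ->
    (mn (side s) - density (nbhd A)) * density A <=
    k * (mn (side s) - density A) * density (nbhd A).
Proof.
move=> rep_aut nonam; have [r /andP[r0 r1] decay] := srw_decay e_conn e_lf e_deg d0 nonam.
have [lam /andP[lam0 lam1] poinc] := poincare.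
have rr1 : r ^+ 2 < 1 by rewrite expr_lt1 // ltW.
exists (Num.max (r ^+ 2) lam); first by rewrite lt_max lam0 orbT gt_max rr1 lam1.
set k := Num.max _ _; have k0 : 0 <= k by rewrite le_max (ltW lam0) orbT.
have rk : r ^+ 2 <= k by rewrite le_max lexx.
have lk : lam <= k by rewrite le_max lexx orbT.
move=> s A pA As; rewrite /density.
set L := mn (side s); set a := mn (fun x => Pr u (A x)).
set nu := mn (fun x => Pr u (nbhd A x)); pose p x := Pr u (A x).
have [eA iA] := pA; have pN := ev_process_nbhd pA; have [eN _] := pN.
have pX := process_ind pA; have [bX _] := pX; set X := fun x => ind R (A x) in pX bX.
have p0 x : 0 <= p x := Pr_ge0 u (A x).
have p1 x : p x <= 1 := Pr_le1 u (eA x).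
have pinv : invariant p := process_mean pX.
have psupp x : c x != s -> p x = 0.
  by move=> cx; apply: Pr_false => f /As cs; rewrite cs eqxx in cx.
have nu0 : 0 <= nu by apply: mean_ge0 => // b _; exact: Pr_ge0.
have a0 : 0 <= a by apply: mean_ge0 => // b _; exact: p0.
have L0 : 0 <= L by apply: mean_ge0 => // b _; exact: ler0n.
have aL : a <= L.
  apply: mean_le => // b _; have [cb|/psupp] := eqVneq (c b) s.
    by rewrite /side cb eqxx; exact: p1.
  by rewrite /p => ->; exact: ler0n.
have [a00|an0] := eqVneq a 0.
  by rewrite a00 mulr0 !mulr_ge0 // subr_ge0 -a00.
have apos : 0 < a by rewrite lt_def an0.
have Lpos : 0 < L := lt_le_trans apos aL.
have EW x : E (walk X x) = avg p x.
  by rewrite ExZ; [rewrite Ex_sum //|exact: bounded_rv_sum].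
have aE : a = ip (walk X) (fun x => ind R (nbhd A x)).
  rewrite /a -(mean_avg pinv); apply: eq_mean => x; rewrite -EW.
  congr (E _); apply/funext => f; rewrite /ind.
  have [n|nn] := pselect (nbhd A x f); first by rewrite asboolT // mulr1.
  rewrite asboolF // mulr0 /walk /avg big1_seq ?mulr0 // => y /=.
  rewrite (mem_nbr e_lf) => exy; rewrite /X /ind asboolF // => Ay.
  by apply: nn; exists y; rewrite e_sym.
have nN : ip (fun x => ind R (nbhd A x)) (fun x => ind R (nbhd A x)) = nu.
  apply: eq_mean => x; congr (E _); apply/funext => f; rewrite /ind.
  by case: asbool; rewrite ?mulr1 ?mulr0.
have CS : a ^+ 2 <= norm2 (walk X) * nu.
  rewrite -nN {1}aE; apply: ip_cauchy_schwarz; first exact: process_walk.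
  exact: process_ind.
have pC := process_centered pA; have [bC _] := pC.
have nC : norm2 (centered A) = a - mn (fun x => p x ^+ 2).
  rewrite /a -meanB; apply: eq_mean => x; rewrite /cov Ex_center //.
  rewrite expr2; congr (_ - _); congr (E _); apply/funext => f; rewrite /ind.
  by case: asbool; rewrite ?mulr1 ?mulr0.
have nW : norm2 (walk X) = norm2 (walk (centered A)) + mn (fun x => avg p x ^+ 2).
  rewrite -meanD; apply: eq_mean => x; rewrite /cov.
  have bW : bounded_rv (walk X x) by exact: bounded_rv_walk.
  have -> : walk (centered A) x = (fun f => walk X x f - E (walk X x)).
    apply/funext => f; rewrite EW /walk /avg -mulrBr -sumrB.
    by [].
  by rewrite Ex_center // EW expr2 subrK.
have cC := centered_contraction rep_aut pA r0 r1 decay.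
have [lo hi] := mean_avg_sqr pinv psupp (erefl a) (erefl L) Lpos (poinc s).
set P2 := mn (fun x => p x ^+ 2) in nC lo hi.
have P2a : P2 <= a.
  by apply: mean_le => // b _; rewrite expr2 ler_piMr.
set t := a ^+ 2 / L in lo hi.
have main : a ^+ 2 <= (k * (a - t) + t) * nu.
  apply: le_trans CS _; apply: ler_wpM2r => //; rewrite nW.
  have h1 : r ^+ 2 * (a - P2) <= k * (a - P2) by rewrite ler_wpM2r // subr_ge0.
  have h2 : lam * (P2 - t) <= k * (P2 - t) by rewrite ler_wpM2r // subr_ge0.
  have h3 : k * (a - t) = k * (a - P2) + k * (P2 - t) by ring.
  rewrite nC in cC; lra.
have tL : t * L = a ^+ 2 by rewrite /t divfK // gt_eqF.
have main2 : a * (a * L) <= a * ((k * (L - a) + a) * nu).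
  have -> : a * (a * L) = a ^+ 2 * L by ring.
  have -> : a * ((k * (L - a) + a) * nu) = (k * (a - t) + t) * nu * L.
    have -> : (k * (a - t) + t) * nu * L = (k * (a * L - t * L) + t * L) * nu by ring.
    by rewrite tL; ring.
  by rewrite ler_pM2r.
rewrite ler_pM2l // in main2; nra.
Qed.

End Operator.

(** * Alternating walks from unmatched vertices *)

Section AlternatingSets.
Variables (V : choiceType) (e : rel V) (c : V -> bool).
Hypotheses (e_sym : symmetric e) (e_col : forall x y, e x y -> c x != c y).
Variable m : V -> V.
Hypothesis mm : matching e m.

(** The vertices reached from an unmatched vertex by an alternating walk with
    [k] edges outside the matching, ending with a matching edge if [0 < k]. *)
Fixpoint alt_set k (x : V) : Prop :=
  if k is j.+1 then m x != x /\ exists z, alt_set j z /\ e z (m x)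
  else m x = x.

(** Alternating walks from an unmatched [u], which may repeat vertices. Only
    the ends of the non-matching edges are listed, as for augmenting paths. *)
Definition alt_walk n v : Prop := exists u ys,
  [/\ m u = u, path (fun a b => e (m a) b) u ys, size ys = n,
      last u ys = v & c v != c u].

Lemma alt_walk_rcons n v t : alt_walk n v -> e (m v) t -> c t = c v ->
  alt_walk n.+1 t.
Proof.
move=> [u [ys [mu pth sz lst cv]]] et ct; exists u, (rcons ys t); split => //.
- by rewrite rcons_path pth lst.
- by rewrite size_rcons sz.
- by rewrite last_rcons.
- by rewrite ct.
Qed.

Lemma side2 x y z : e x y -> e y z -> c x = c z.
Proof. by move=> /e_col + /e_col; case: (c x) (c y) (c z) => [] [] []. Qed.

Lemma mate_adj x : m x != x -> e x (m x).
Proof. by case: mm => _; apply. Qed.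

Lemma alt_set_walk k z z' : alt_set k z -> e z z' -> alt_walk k.+1 z'.
Proof.
case: (mm) => mK _; elim: k z z' => [|k IH] z z' /=.
  move=> mz ezz; exists z, [:: z']; split => //=; first by rewrite mz ezz.
  by rewrite eq_sym; exact: e_col.
move=> [mz [t [At et]]] ezz; apply: (@alt_walk_rcons _ (m z)).
- exact: IH At et.
- by rewrite mK.
- apply: (@side2 _ z); first by rewrite e_sym.
  exact: mate_adj.
Qed.

Lemma alt_walk_extend n j z' : alt_walk n z' -> alt_set j z' ->
  exists2 v, m v = v & alt_walk (n + j) v.
Proof.
elim: j n z' => [|j IH] n z' wz /=; first by move=> mz; exists z'; rewrite ?addn0.
move=> [mz [t [At et]]]; rewrite addnS -addSn; apply: IH At.
apply: alt_walk_rcons wz _ _; first by rewrite e_sym.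
apply: (@side2 _ (m z')) => //; rewrite e_sym; exact: mate_adj.
Qed.

(** Shortcutting a walk and cutting it at the first unmatched vertex. *)
Lemma aug_of_walk n v : alt_walk n v -> m v = v ->
  exists u ys, aug e m u ys /\ (size ys <= n)%N.
Proof.
move=> [u [ys [mu pth sz lst cv]]] mv.
have : last u ys != u by apply: contraNneq cv => h; rewrite -lst h.
have : m (last u ys) = last u ys by rewrite lst.
have sub_sz (r : seq V) : uniq (u :: r) -> {subset r <= ys} -> (size r <= n)%N.
  by move=> /andP[_ ur] sr; rewrite -sz; exact: uniq_leq_size.
case/shortenP: pth => r pth ur sr {}mv nv.
have {sub_sz}szr := sub_sz _ ur sr.
pose P i := (0 < i <= size r)%N && (m (pt u r i) == pt u r i).
have exP : exists i, P i.
  exists (size r); rewrite /P leqnn andbT; apply/andP; split.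
    by case: (r) nv => //=; rewrite eqxx.
  by rewrite /pt nth_last /= mv.
have [i /andP[/andP[i0 ir] /eqP mi] imin] := ex_minnP exP.
exists u, (take i r); have szi : size (take i r) = i by rewrite size_takel.
have ptE j : (j <= i)%N -> pt u (take i r) j = pt u r j.
  by case: j => // j ji; rewrite /pt /= nth_take.
split; last by rewrite szi; exact: leq_trans szr.
split; rewrite ?szi //.
- split => //; move: ur => /= /andP[un ur]; rewrite take_uniq // andbT.
  by apply: contra un; exact: mem_take.
- by rewrite ptE.
- move=> j ji; rewrite !ptE // ?(ltnW ji) //.
  exact: (pathP u pth j (leq_trans ji ir)).
- move=> j /andP[j0 ji]; rewrite ptE ?(ltnW ji) //; apply/negP => mj.
  have := imin j; rewrite /P j0 mj (leq_trans (ltnW ji) ir) /= leqNgt ji.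
  by move/(_ isT).
Qed.

(** Following one alternating walk forwards, crossing the edge and following
    the other one backwards would lead to another unmatched vertex. *)
Lemma no_aug_disjoint l k j z z' :
  (forall x ys, aug e m x ys -> (size ys <= l)%N -> False) ->
  alt_set k z -> alt_set j z' -> e z z' -> (k.+1 + j <= l)%N -> False.
Proof.
move=> noaug Az Az' ezz kj.
have [v mv wv] := alt_walk_extend (alt_set_walk Az ezz) Az'.
have [u [ys [axy sz]]] := aug_of_walk wv mv.
exact: noaug axy (leq_trans sz kj).
Qed.

End AlternatingSets.

(** * Few unmatched vertices remain *)

Section Density.
Variables (R : realType) (V : choiceType) (e : rel V) (c : V -> bool).
Hypotheses (e_sym : symmetric e) (e_irr : irreflexive e)
  (e_conn : connected_graph e) (e_lf : locally_finite e)
  (e_col : forall x y, e x y -> c x != c y).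
Variable d : nat.
Hypotheses (e_deg : forall x, degree e x = d) (d0 : (0 < d)%N).
Variables (rep : V -> V) (orbs : seq V) (w : V -> R).
Hypotheses (w_gt0 : forall b, 0 < w b) (rep_orbs : forall x, rep x \in orbs)
  (rep_ex : forall x, exists2 g : graph_aut e, side_pres c g & g (rep x) = x)
  (rep_aut : forall (g : graph_aut e) x, side_pres c g -> rep (g x) = rep x)
  (mtp : forall t, diag_inv e c t -> finite_range e t ->
     mean orbs w (fun x => sumV (t x)) = mean orbs w (fun y => sumV (t^~ y))).
Local Notation mn := (mean orbs w).
Local Notation Om := (label_config R V).
Local Notation act := (@act_label_config R V e).
Variable u : probability Om R.
Hypothesis u_prod : product_of_uniform u.
Local Notation Prb := (Pr u).
Local Notation dens := (density orbs w u).
Let cV : countable [set: V] := countable_vertices e_conn e_lf.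

Definition pair_inv (T : V -> V -> Om -> Prop) :=
  forall (g : graph_aut e) x y f, side_pres c g -> T (g x) (g y) (act g f) <-> T x y f.

Lemma Pr_act (g : graph_aut e) (P Q : Om -> Prop) : event P ->
  (forall f, P (act g f) <-> Q f) -> Prb P = Prb Q.
Proof.
move=> eP PQ; rewrite /Pr -(Ex_act u_prod g); last exact: bounded_rv_ind.
by congr (Ex u _); apply/funext => f; rewrite /ind /= (asbool_equiv_eq (PQ f)).
Qed.

Lemma pair_transport (T : V -> V -> Om -> Prop) n : (forall x y, event (T x y)) ->
  pair_inv T -> (forall x y f, T x y f -> y \in ball_seq e n x) ->
  mn (fun x => sumV (fun y => Prb (T x y))) = mn (fun y => sumV (fun x => Prb (T x y))).
Proof.
move=> eT iT rT; apply: (mtp (t := fun x y => Prb (T x y))).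
  by move=> g x y sg; apply: (Pr_act (g := g)) => // f; exact: iT.
exists n => x y; apply: contraNT => yb; apply/eqP/Pr_false => f /rT.
by apply/negP.
Qed.

(** Total probability over the finitely many possible values of [m f x]. *)
Lemma sum_Pr_value (m : Om -> V -> V) x (P : V -> Om -> Prop) :
  measurable_map m -> (forall y, event (P y)) ->
  (forall f, m f x \in ball_seq e 1 x) ->
  event (fun f => P (m f x) f) /\
  sumV (fun y => Prb (fun f => m f x = y /\ P y f)) = Prb (fun f => P (m f x) f).
Proof.
move=> em eP mb; have eQ y : event (fun f => m f x = y /\ P y f) by apply: event_and.
have E1 f : (exists y, m f x = y /\ P y f) <-> P (m f x) f.
  by split => [[y [->]]|h] //; exists (m f x).
split; first by apply: (event_ext E1); exact: event_ex.
rewrite (@sumV_undup _ _ _ (ball_seq e 1 x)); last first.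
  move=> y; apply: contraNT => yb; apply/eqP/Pr_false => f [fy _].
  by move/negP: yb; apply; rewrite -fy.
rewrite /Pr -Ex_sum; last by move=> y; apply: bounded_rv_ind; exact: eQ.
congr (Ex u _); apply/funext => f.
rewrite (bigD1_seq (m f x)) ?undup_uniq ?mem_undup ?mb //= big1 ?addr0.
  rewrite /ind; congr (_%:R); congr nat_of_bool; apply: asbool_equiv_eq.
  by split => [[]|].
by move=> y /eqP ne; rewrite /ind asboolF // => -[/esym].
Qed.

Section OneMatching.
Variables (m : Om -> V -> V) (l : nat).
Hypotheses (mm : forall f, matching e (m f)) (em : measurable_map m)
  (m_act : forall (g : graph_aut e) f, m (act g f) = conj_aut g (m f))
  (m_noaug : forall f, good_labels e f ->
     forall x ys, aug e (m f) x ys -> (size ys <= l)%N -> False).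

Let mb f x : m f x \in ball_seq e 1 x := mate_ball e_lf (mm f) x.

Lemma m_actE (g : graph_aut e) f x : m (act g f) (g x) = g (m f x).
Proof. by rewrite m_act /conj_aut aut_funK. Qed.

Lemma mate_transport P : ev_process e c P ->
  mn (fun x => Prb (fun f => P (m f x) f)) = dens P.
Proof.
move=> [eP iP]; pose T x y (f : Om) := m f x = y /\ P y f.
have eT x y : event (T x y) by apply: event_and; [exact: em|exact: eP].
have iT : pair_inv T.
  move=> g x y f sg; rewrite /T m_actE iP //.
  by split => -[+ h]; [move/aut_inj ->|move=> ->]; split.
have rT x y f : T x y f -> y \in ball_seq e 1 x by move=> [<- _]; exact: mb.
transitivity (mn (fun x => sumV (fun y => Prb (T x y)))).
  by apply: eq_mean => x; have [_ ->] := sum_Pr_value em eP (fun f => mb f x).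
rewrite (pair_transport eT iT rT); apply: eq_mean => y.
have [_ <-] := sum_Pr_value em (fun _ => eP y) (fun f => mb f y).
apply: eq_sumV => x; apply: eq_Pr => f; have [mK _] := mm f; rewrite /T.
by split => -[E h]; split => //; rewrite -E mK.
Qed.

Definition alt_side s k x (f : Om) : Prop := c x = s /\ alt_set e (m f) k x.

Lemma alt_set_act (g : graph_aut e) k x f :
  alt_set e (m (act g f)) k (g x) <-> alt_set e (m f) k x.
Proof.
elim: k x => [|k IH] x /=; rewrite m_actE; first by split => [/aut_inj|->].
split => -[mx [z [Az ez]]].
  split; first by apply: contraNneq mx => ->.
  exists (aut_inv g z); split; first by apply/IH; rewrite aut_invK.
  by rewrite -(aut_adj g) aut_invK.
split; first by rewrite (inj_eq (@aut_inj _ _ g)).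
by exists (g z); rewrite aut_adj; split => //; apply/IH.
Qed.

Lemma event_alt_set k x : event (fun f => alt_set e (m f) k x).
Proof.
elim: k x => [|k IH] x /=; first exact: em.
apply: event_and.
  apply: (@event_ext _ _ (fun f => ~ m f x = x)); last exact: event_not.
  by move=> f; split => [/eqP|/eqP].
apply: event_ex => // z; apply: event_and => //.
apply: (@event_ext _ _ (fun f => exists y, m f x = y /\ e z y)).
  by move=> f; split => [[y [-> ezy]]|ez] //; exists (m f x).
by apply: event_ex => // y; apply: event_and; [exact: em|exact: event_cst].
Qed.

Lemma alt_side_process s k : ev_process e c (alt_side s k).
Proof.
split => [x|g x f sg]; first by apply: event_and; [exact: event_cst|exact: event_alt_set].
by rewrite /alt_side sg alt_set_act.
Qed.

Lemma event_moved x : event (fun f => m f x != x).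
Proof.
apply: (@event_ext _ _ (fun f => ~ m f x = x)); last exact: event_not.
by move=> f; split => [/eqP|/eqP].
Qed.

Lemma nbhd_side s k y f : nbhd e (alt_side s k) y f -> c y = ~~ s.
Proof.
by move=> [x [exy [cx _]]]; have := e_col exy; rewrite cx; case: (c y) s {cx} => [] [].
Qed.

(** Up to the null event of bad labels. *)
Lemma Pr_split (P Q : Om -> Prop) : event P -> event Q ->
  (forall f, P f -> good_labels e f -> Q f) -> Prb P <= Prb Q.
Proof.
move=> eP eQ PQ.
have eG : event (fun f : Om => good_labels e f) by exact: event_good_labels.
have G0 := good_labels_null e_conn e_lf u_prod.
apply: (@le_trans _ _ (Prb (fun f => Q f \/ ~ good_labels e f))).
  apply: Pr_le => //; first by apply: event_or => //; exact: event_not.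
  by move=> f Pf; have [g|ng] := pselect (good_labels e f); [left; exact: PQ|right].
by apply: le_trans (Pr_or u eQ (event_not eG)) _; rewrite G0 addr0.
Qed.

(** Absent short augmenting paths, the matching injects the neighbourhood of
    an alternating set into the next alternating set. *)
Lemma alt_side_next s k : (k.+1 <= l)%N ->
  dens (nbhd e (alt_side s k)) <= dens (alt_side s k.+1).
Proof.
move=> kl; have [eN iN] := ev_process_nbhd e_conn e_lf (alt_side_process s k).
pose P y (f : Om) := nbhd e (alt_side s k) y f /\ m f y != y.
have pP : ev_process e c P.
  split=> [y|g y f sg]; first by apply: event_and; [exact: eN|exact: event_moved].
  by rewrite /P m_actE iN // (inj_eq (@aut_inj _ _ g)).
have <- : mn (fun x => Prb (fun f => P (m f x) f)) = dens (alt_side s k.+1).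
  apply: eq_mean => x.
  apply: eq_Pr => f; have [mK me] := mm f; rewrite /P /alt_side /= mK; split.
    move=> [nb mx]; rewrite eq_sym in mx; split; last first.
      by split => //; have [z [ez [_ Az]]] := nb; exists z.
    by move: (e_col (me _ mx)); rewrite (nbhd_side nb); case: (c x) (s) => [] [].
  move=> [cx [mx [z [Az ez]]]]; split; last by rewrite eq_sym.
  exists z; split => //; split => //; rewrite -cx; apply: (side2 e_col ez).
  by rewrite e_sym me.
rewrite (mate_transport pP); apply: mean_le => // y _; have [eP _] := pP.
apply: Pr_split => // f nb gl; split => //; apply/negP => /eqP my.
have [z [ezy [_ Az]]] := nb.
apply: (no_aug_disjoint e_sym e_col (mm f) (m_noaug gl) Az (_ : alt_set e (m f) 0 y) ezy) => //.
by rewrite addn0.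
Qed.

(** A vertex of both sets would join an alternating walk from each side to an
    augmenting path. *)
Lemma alt_side_disjoint s k : (k.+1 + k <= l)%N ->
  dens (alt_side s k) + dens (nbhd e (alt_side (~~ s) k)) <= mn (side R c s).
Proof.
move=> kl; rewrite /density -meanD; apply: mean_le => // x _.
have [eA _] := alt_side_process s k.
have [eN _] := ev_process_nbhd e_conn e_lf (alt_side_process (~~ s) k).
rewrite /side; have [cx|cx] := eqVneq (c x) s; last first.
  rewrite !Pr_false ?addr0 // => f; first by move/nbhd_side; rewrite negbK; apply/eqP.
  by move=> [/eqP]; rewrite (negbTE cx).
rewrite -lerBrDr.
have -> : true%:R - Prb (nbhd e (alt_side (~~ s) k) x) =
    Prb (fun f => ~ nbhd e (alt_side (~~ s) k) x f) by rewrite Pr_not.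
apply: Pr_split => //; first exact: event_not.
move=> f [_ Ax] gl [z [ezx [_ Az]]].
exact: (no_aug_disjoint e_sym e_col (mm f) (m_noaug gl) Az Ax ezx).
Qed.

(** The matching transports the matched vertices of one side onto those of the
    other, and both sides have the same density by regularity. *)
Lemma unmatched_sides s : dens (alt_side s 0) = dens (alt_side (~~ s) 0).
Proof.
pose P t y (f : Om) := c y = t /\ m f y != y.
have pP t : ev_process e c (P t).
  split=> [y|g y f sg]; first by apply: event_and; [exact: event_cst|exact: event_moved].
  by rewrite /P m_actE sg (inj_eq (@aut_inj _ _ g)).
have E1 : mn (fun x => Prb (fun f => P (~~ s) (m f x) f)) = dens (P s).
  apply: eq_mean => x.
  apply: eq_Pr => f; have [mK me] := mm f; rewrite /P mK eq_sym; split => -[+ mx].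
    by move: (e_col (me _ mx)); case: (c x) (c (m f x)) (s) => [] [] [].
  by move: (e_col (me _ mx)); case: (c x) (c (m f x)) (s) => [] [] [].
have E3 t : dens (alt_side t 0) = mn (side R c t) - dens (P t).
  rewrite /density -meanB; apply: eq_mean => x; rewrite /side.
  have [cx|cx] := eqVneq (c x) t; last first.
    rewrite !Pr_false ?subr0 // => f; last by move=> [/eqP]; rewrite (negbTE cx).
    by move=> [/eqP]; rewrite (negbTE cx).
  rewrite -Pr_not; last by case: (pP t).
  apply: eq_Pr => f; rewrite /alt_side /P /= cx; split.
    by move=> [_ ->] [_]; rewrite eqxx.
  by move=> h; split => //; apply/eqP; apply: contraT => mx; case: h.
rewrite !E3 -E1 (mate_transport (pP (~~ s))); congr (_ - _).
by rewrite -(mean_side e_sym e_lf e_col e_deg d0 mtp s).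
Qed.

Section Decay.
Variable kap : R.
Hypotheses (kap0 : 0 < kap) (kap1 : kap < 1)
  (expan : forall s A, ev_process e c A -> (forall x f, A x f -> c x = s) ->
    (mn (side R c s) - dens (nbhd e A)) * dens A <=
    kap * (mn (side R c s) - dens A) * dens (nbhd e A)).
Local Notation L s := (mn (side R c s)).

Lemma dens_ge0 A : 0 <= dens A.
Proof. by apply: mean_ge0 => // x _; exact: Pr_ge0. Qed.

Lemma dens_le_side s A : ev_process e c A -> (forall x f, A x f -> c x = s) ->
  dens A <= L s.
Proof.
move=> [eA _] As; apply: mean_le => // x _; rewrite /side.
have [cx|cx] := eqVneq (c x) s; first exact: Pr_le1.
by rewrite Pr_false // => f /As; apply/eqP.
Qed.

Lemma alt_side_le s k : dens (alt_side s k) <= L s.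
Proof. by apply: dens_le_side; [exact: alt_side_process|move=> x f []]. Qed.

(** In terms of the odds [a / (L - a)], expansion multiplies the odds of the
    alternating sets by at least [1 / kap] at each step. *)
Lemma alt_side_odds s k : (k <= l)%N ->
  (L s - dens (alt_side s k)) * dens (alt_side s 0) <=
    kap ^+ k * L s * dens (alt_side s k) /\
  (L s - dens (nbhd e (alt_side s k))) * dens (alt_side s 0) <=
    kap ^+ k.+1 * L s * dens (nbhd e (alt_side s k)).
Proof.
have L0 : 0 <= L s by apply: mean_ge0 => // x _; exact: ler0n.
have a0 := dens_ge0 (alt_side s 0); have aL := alt_side_le s 0.
have step j : (L s - dens (alt_side s j)) * dens (alt_side s 0) <=
    kap ^+ j * L s * dens (alt_side s j) ->
  (L s - dens (nbhd e (alt_side s j))) * dens (alt_side s 0) <=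
    kap ^+ j.+1 * L s * dens (nbhd e (alt_side s j)).
  have ex := expan (alt_side_process s j) (fun x f h => proj1 h).
  have b0 := dens_ge0 (nbhd e (alt_side s j)); have aj0 := dens_ge0 (alt_side s j).
  move: (dens (nbhd e _)) (dens (alt_side s j)) b0 aj0 ex => b a b0 ha ex IH.
  have kj0 : 0 <= kap ^+ j by apply/exprn_ge0/ltW.
  have [az|an] := eqVneq a 0.
    apply: (@le_trans _ _ 0); last by rewrite !mulr_ge0 // exprn_ge0 // ltW.
    by rewrite az mulr0 subr0 in IH; have : 0 <= b * dens (alt_side s 0);
      [exact: mulr_ge0|lra].
  have a1 : 0 < a by rewrite lt_neqAle eq_sym an.
  rewrite -(ler_pM2r a1).
  apply: (@le_trans _ _ (kap * (L s - a) * b * dens (alt_side s 0))).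
    by rewrite mulrAC; apply: ler_wpM2r.
  apply: (@le_trans _ _ (kap * b * (kap ^+ j * L s * a))); last by rewrite exprS; lra.
  rewrite (_ : _ * _ * _ * _ = kap * b * ((L s - a) * dens (alt_side s 0))); last by ring.
  by apply: ler_wpM2l; rewrite // mulr_ge0 // ltW.
elim: k => [|k IH] kl.
  have h : (L s - dens (alt_side s 0)) * dens (alt_side s 0) <=
    kap ^+ 0 * L s * dens (alt_side s 0) by rewrite expr0 mul1r ler_wpM2r // gerBl.
  by split => //; exact: step.
have [_ h] := IH (ltnW kl).
have h2 : (L s - dens (alt_side s k.+1)) * dens (alt_side s 0) <=
    kap ^+ k.+1 * L s * dens (alt_side s k.+1).
  have nx := alt_side_next s kl.
  apply: (le_trans (le_trans _ h)); first by rewrite ler_wpM2r // lerB.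
  by rewrite ler_wpM2l // mulr_ge0 // exprn_ge0 // ltW.
by split => //; exact: step.
Qed.

(** Two disjoint sets cannot both have more than half of the density. *)
Lemma unmatched_decay s k : (k.+1 + k <= l)%N ->
  dens (alt_side s 0) <= kap ^+ k * L s.
Proof.
move=> kl; have kl' : (k <= l)%N by lia.
have L0 : 0 <= L s by apply: mean_ge0 => // x _; exact: ler0n.
have kk : 0 <= kap ^+ k by apply/exprn_ge0/ltW.
have LE : L (~~ s) = L s by rewrite (mean_side e_sym e_lf e_col e_deg d0 mtp).
have [Lz|Ln] := eqVneq (L s) 0.
  by apply: le_trans (alt_side_le s 0) _; rewrite Lz mulr0.
have L1 : 0 < L s by rewrite lt_neqAle eq_sym Ln.
have half (a b q : R) : 0 <= q -> 0 <= b -> a <= L s / 2 -> (L s - a) * b <= q * L s * a -> b <= q * L s.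
  move=> q0 b0 ah le; rewrite -(@ler_pM2l _ (L s / 2)) ?divr_gt0 //.
  apply: (@le_trans _ _ ((L s - a) * b)); first by rewrite ler_wpM2r //; lra.
  apply: le_trans le _; rewrite mulrC ler_wpM2r // mulr_ge0 // ltW //.
have := alt_side_disjoint s kl.
have [ak|ak] := leP (dens (alt_side s k)) (L s / 2).
  by move=> _; have [h _] := alt_side_odds s kl'; apply: half ak h => //; exact: dens_ge0.
move=> dj; have [_] := alt_side_odds (~~ s) kl'; rewrite LE -unmatched_sides => h.
apply: (@le_trans _ _ (kap ^+ k.+1 * L s)).
  apply: half h; [by apply/exprn_ge0/ltW|exact: dens_ge0|lra].
by rewrite ler_wpM2r // exprS ler_piMl // ltW.
Qed.

Lemma unmatched_density k : (k.+1 + k <= l)%N ->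
  dens (fun x f => m f x = x) <= kap ^+ k * mn (fun=> 1).
Proof.
move=> kl; have sE : mn (fun=> 1) = L true + L false.
  rewrite -meanD; apply: eq_mean => x; rewrite /side.
  by case: (c x); rewrite ?addr0 ?add0r.
rewrite sE mulrDr; apply: le_trans (lerD (unmatched_decay true kl) (unmatched_decay false kl)).
rewrite /density -meanD; apply: mean_le => // x _.
have ev s : event (alt_side s 0 x) by have [] := alt_side_process s 0.
apply: le_trans (Pr_or u (ev true) (ev false)).
apply: Pr_le => //; first exact: event_or.
by move=> f mx; rewrite /alt_side; case: (c x); [left|right].
Qed.

End Decay.

End OneMatching.

(** * Almost sure convergence *)

Lemma borel_cantelli (P : nat -> Om -> Prop) (K : R) : (forall n, event (P n)) ->
  (forall N, \sum_(0 <= n < N) Prb (P n) <= K) ->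
  Prb (fun f => forall N, exists n, (N <= n)%N /\ P n f) = 0.
Proof.
move=> eP PK.
have E : event (fun f => forall N, exists n, (N <= n)%N /\ P n f).
  apply: event_all => [|N]; first exact: countableP.
  apply: event_ex => [|n]; first exact: countableP.
  by apply: event_and; [exact: event_cst|exact: eP].
apply/EFin_inj; rewrite PrE // (_ : [set f | _] = lim_sup_set (fun n => [set f | P n f])).
  apply: lim_sup_set_cvg0 => [n|]; first exact: eP.
  apply: (@le_lt_trans _ _ K%:E); last exact: ltry.
  apply: lime_le; first exact: is_cvg_nneseries.
  apply: nearW => N; rewrite (eq_bigr (fun n => (Prb (P n))%:E)); last by move=> n _; rewrite PrE.
  by rewrite sumEFin lee_fin.
apply/seteqP; split => f /=.
  by move=> h N _; have [n [Nn Pn]] := h N; exists n.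
by move=> h N; have [n /= Nn Pn] := h N I; exists n.
Qed.

Lemma Pr_exists_sumV (P : V -> Om -> Prop) (s : seq V) : (forall x, event (P x)) ->
  (forall x f, P x f -> x \in s) ->
  Prb (fun f => exists x, P x f) <= sumV (fun x => Prb (P x)).
Proof.
move=> eP Ps; rewrite (@sumV_undup _ _ _ s); last first.
  by move=> x; apply: contraNT => xs; apply/eqP/Pr_false => f /Ps; apply/negP.
have [eQ le] := Pr_has u (undup s) eP; apply: le_trans le; apply: Pr_le => //.
  exact: event_ex.
by move=> f [x Px]; exists x => //; rewrite mem_undup; exact: Ps Px.
Qed.

Lemma sumV_Pr_count (P : V -> Om -> Prop) (Q : Om -> Prop) (s : seq V) k :
  (forall x, event (P x)) -> event Q -> (forall x f, P x f -> x \in s) ->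
  (forall f, Q f -> exists2 r : seq V, (size r <= k)%N & forall x, P x f -> x \in r) ->
  (forall x f, P x f -> Q f) ->
  sumV (fun x => Prb (P x)) <= k%:R * Prb Q.
Proof.
move=> eP eQ Ps PQ Pk; rewrite (@sumV_undup _ _ _ s); last first.
  by move=> x; apply: contraNT => xs; apply/eqP/Pr_false => f /Ps; apply/negP.
rewrite /Pr -Ex_sum; last by move=> x; exact: bounded_rv_ind.
rewrite -ExZ; last exact: bounded_rv_ind.
apply: Ex_le; first by apply: bounded_rv_sum => x; exact: bounded_rv_ind.
  by apply: bounded_rvZ; exact: bounded_rv_ind.
move=> f; have [Qf|nQ] := pselect (Q f); last first.
  rewrite big1 ?mulr_ge0 ?ind_ge0 // => x _; rewrite /ind asboolF //.
  by move/Pk.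
have [r rk Pr] := PQ f Qf; rewrite {2}/ind asboolT // mulr1.
rewrite /ind -natr_sum ler_nat; apply: leq_trans rk.
rewrite (_ : (\sum_(x <- _) _)%N = count (fun x => `[< P x f >]) (undup s)); last first.
  by elim: (undup s) => [|a t IH]; rewrite ?big_nil // big_cons IH.
rewrite -size_filter; apply: uniq_leq_size; first by rewrite filter_uniq // undup_uniq.
by move=> x; rewrite mem_filter => /andP[/asboolP/Pr].
Qed.

(** The summand is the decrement of [(a * n + b) * kap ^+ n] for suitable [a]
    and [b], so that the sum telescopes. *)
Lemma sum_geometric_bounded (kap : R) : 0 < kap -> kap < 1 ->
  exists2 K, 0 <= K & forall N, \sum_(0 <= n < N) ((2 * n.+1 + 1).*2)%:R * kap ^+ n <= K.
Proof.
move=> k0 k1; have k2 : 0 < 1 - kap by rewrite subr_gt0.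
pose a := 4%:R / (1 - kap); pose b := (6%:R + kap * a) / (1 - kap).
have a0 : 0 <= a by rewrite divr_ge0 // ltW.
have b0 : 0 <= b by apply: divr_ge0 (ltW k2); rewrite addr_ge0 // mulr_ge0 // ltW.
exists b => // N.
have h n : ((2 * n.+1 + 1).*2)%:R * kap ^+ n =
    (a * n%:R + b) * kap ^+ n - (a * n.+1%:R + b) * kap ^+ n.+1.
  have -> : ((2 * n.+1 + 1).*2)%:R = 4%:R * n%:R + 6%:R :> R.
    by rewrite -natrM -natrD; congr (_%:R); lia.
  rewrite exprS -[n.+1]addn1 natrD /b /a; field; lra.
rewrite (eq_bigr _ (fun n _ => h n)).
have -> : \sum_(0 <= n < N) ((a * n%:R + b) * kap ^+ n - (a * n.+1%:R + b) * kap ^+ n.+1) =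
    b - (a * N%:R + b) * kap ^+ N.
  elim: N => [|N IH]; first by rewrite big_geq // mulr0 add0r expr0 mulr1 subrr.
  by rewrite big_nat_recr //= IH; ring.
by rewrite gerBl mulr_ge0 //; [rewrite addr_ge0 // mulr_ge0|apply/exprn_ge0/ltW].
Qed.

Section Convergence.
Variable kap : R.
Hypotheses (kap0 : 0 < kap) (kap1 : kap < 1)
  (expan : forall s A, ev_process e c A -> (forall x f, A x f -> c x = s) ->
    (mn (side R c s) - dens (nbhd e A)) * dens A <=
    kap * (mn (side R c s) - dens A) * dens (nbhd e A)).
Local Notation M := (@mseq R V e).
Let W := mn (fun=> 1).

Let mM n f : matching e (M n f) := mseq_matching e_sym e_irr e_lf e_col n f.
Let eM n : measurable_map (M n) := measurable_mseq e_sym e_irr e_conn e_lf e_col n.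

Let M_act n (g : graph_aut e) f : M n (act g f) = conj_aut g (M n f) :=
  mseq_act e_sym e_irr e_lf e_col n g f.

Lemma unmatched_mseq n : dens (fun x f => M n.+1 f x = x) <= kap ^+ n * W.
Proof.
apply: (@unmatched_density (M n.+1) (2 * n + 1)) => //.
- move=> f gl x ys; exact: (stage_no_aug e_sym e_irr e_lf e_col (mM n f) gl).
- by lia.
Qed.

Local Notation len n := (2 * n.+1 + 1)%N.
Let T n x y f := touch e (len n) f (M n.+1 f) x y.

Lemma event_T n x y : event (T n x y).
Proof. exact: (event_touch e_sym e_conn e_lf e_col (len n) x y (mM n.+1) (eM n.+1)). Qed.

Lemma event_changed n v : event (fun f => M n.+2 f v != M n.+1 f v).
Proof.
apply: (@event_ext _ _ (fun f => ~ exists a, M n.+2 f v = a /\ M n.+1 f v = a)).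
  by move=> f; split => [h|/eqP h [a [<-]]]; [apply/eqP => E; apply: h; exists (M n.+1 f v)|exact/nesym].
by apply: event_not; apply: event_ex => // a; apply: event_and; exact: eM.
Qed.

(** Each unmatched vertex starts at most one of the flipped paths, so it sends
    mass to at most twice as many vertices as the length allows. *)
Lemma changed_density n :
  dens (fun v f => M n.+2 f v != M n.+1 f v) <= ((len n).*2)%:R * (kap ^+ n * W).
Proof.
have rT x y f : T n x y f -> x \in ball_seq e (len n).*2 y.
  exact: (touch_ball e_sym e_lf e_col (mM _ f)).
have iT : pair_inv (T n).
  move=> g x y f _; rewrite /T M_act; exact: (touch_act e_sym e_lf e_col).
have rT' x y f : T n x y f -> y \in ball_seq e (len n).*2 x.
  by move/rT; exact: ball_sym.
apply: (@le_trans _ _ (mn (fun v => sumV (fun x => Prb (T n x v))))).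
  apply: mean_le => // v _.
  apply: le_trans (Pr_exists_sumV (fun x => event_T n x v) (fun x f => @rT x v f)).
  apply: Pr_le; [exact: event_changed|by apply: event_ex => // x; exact: event_T|].
  by move=> f; exact: (@stage_changed _ _ _ _ e_sym e_irr e_lf e_col (len n) f _ (mM n.+1 f) v).
rewrite -(pair_transport (event_T n) iT rT').
apply: le_trans (ler_wpM2l (ler0n _ _) (unmatched_mseq n)).
rewrite /density -meanZ; apply: mean_le => // x _.
apply: (sumV_Pr_count (s := ball_seq e (len n).*2 x)) => //.
- by move=> y; exact: event_T.
- exact: eM.
- by move=> y f; exact: rT'.
- move=> f _; exact: (touch_count e_sym e_irr e_lf e_col (len n) f (mM _ f) x).
- by move=> y f; exact: (touch_unmatched e_sym e_irr e_lf e_col (mM _ f)).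
Qed.

Lemma Pr_le_density (P : V -> Om -> Prop) v : (forall x, event (P x)) ->
  (forall (g : graph_aut e) x f, P (g x) (act g f) <-> P x f) ->
  Prb (P v) <= (w (rep v))^-1 * dens P.
Proof.
move=> eP iP; have [g _ gv] := rep_ex v.
have <- : Prb (P (rep v)) = Prb (P v).
  by apply/esym; apply: (Pr_act (g := g)) => // f; rewrite -{1}gv.
rewrite ler_pdivlMl //.
exact: (mean_ge w_gt0 (rep_orbs v) (fun x => Pr_ge0 u (P x))).
Qed.

(** The density of the vertices that change in stage [n] is summable. *)
Lemma changed_finitely_often v :
  Prb (fun f => forall N, exists n, (N <= n)%N /\ M n.+2 f v != M n.+1 f v) = 0.
Proof.
have [K K0 hK] := sum_geometric_bounded kap0 kap1.
apply: (@borel_cantelli _ ((w (rep v))^-1 * W * K)) => [n|N]; first exact: event_changed.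
have W0 : 0 <= W by apply: mean_ge0.
apply: (@le_trans _ _ ((w (rep v))^-1 * W * \sum_(0 <= n < N) (len n).*2%:R * kap ^+ n)).
  rewrite mulr_sumr; apply: ler_sum => n _.
  apply: le_trans (@Pr_le_density (fun v f => M n.+2 f v != M n.+1 f v) v _ _) _.
  - by move=> x; exact: event_changed.
  - by move=> g x f; rewrite !M_act /conj_aut aut_funK (inj_eq (@aut_inj _ _ g)).
  rewrite -!mulrA ler_pM2l ?invr_gt0 //; apply: le_trans (changed_density n) _.
  by rewrite le_eqVlt; apply/orP; left; apply/eqP; ring.
by apply: ler_wpM2l (hK N); rewrite mulr_ge0 // invr_ge0 ltW.
Qed.

(** The density of the unmatched vertices tends to zero. *)
Lemma unmatched_forever v : Prb (fun f => forall n, M n.+1 f v = v) = 0.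
Proof.
have W0 : 0 <= W by apply: mean_ge0.
apply: Pr_small => eps eps0; pose C := (w (rep v))^-1 * W.
have [n hn] := geometric_small C (ltW kap0) kap1 eps0.
apply: le_trans (ltW hn); apply: (@le_trans _ _ (Prb (fun f => M n.+1 f v = v))).
  apply: Pr_le; [|exact: eM|by move=> f].
  by apply: event_all => [|k]; [exact: countableP|exact: eM].
apply: le_trans (@Pr_le_density (fun v f => M n.+1 f v = v) v _ _) _.
- by move=> x; exact: eM.
- by move=> g x f; rewrite M_act /conj_aut aut_funK; split => [/aut_inj|->].
by rewrite /C -mulrA ler_pM2l ?invr_gt0 // mulrC; exact: unmatched_mseq.
Qed.

Lemma matched_later n k f v : M n f v != v -> M (n + k) f v != v.
Proof.
move=> h; elim: k => [|k IH]; first by rewrite addn0.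
by rewrite addnS; exact: (stage_matched e_sym e_irr e_lf e_col _ f (mM _ f) IH).
Qed.

Definition converges v (f : Om) := exists b, b != v /\ settles (fun n => M n f) v b.

Lemma event_converges v : event (converges v).
Proof.
apply: event_ex => // b; apply: event_and; first exact: event_cst.
by apply: (measurable_lim (s := fun n f => M n f)) => n; exact: eM.
Qed.

(** A vertex whose mate changes finitely often, and that is matched at some
    time, has a mate in the limit because it stays matched. *)
Lemma converges_null : Prb (fun f => ~ forall v, converges v f) = 0.
Proof.
rewrite (@eq_Pr _ _ _ _ _ (fun f => exists v, ~ converges v f)); last first.
  by move=> f; split => [/existsNP|/existsNP].
apply: Pr_ex_null => // v; first by apply: event_not; exact: event_converges.
pose P1 f := forall N, exists n, (N <= n)%N /\ M n.+2 f v != M n.+1 f v.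
pose P2 f := forall n, M n.+1 f v = v.
have e1 : event P1.
  apply: event_all => [|N]; first exact: countableP.
  apply: event_ex => [|n]; first exact: countableP.
  by apply: event_and; [exact: event_cst|exact: event_changed].
have e2 : event P2 by apply: event_all => [|n]; [exact: countableP|exact: eM].
apply/le_anti; rewrite Pr_ge0 andbT.
apply: (@le_trans _ _ (Prb P1 + Prb P2)); last first.
  by rewrite /P1 /P2 changed_finitely_often unmatched_forever addr0.
apply: le_trans (Pr_or u e1 e2); apply: Pr_le; last 1 first.
- move=> f nc; apply: contrapT => /not_orP[/existsNP[N hN] /existsNP[k hk]]; apply: nc.
  have const n : (N <= n)%N -> M n.+1 f v = M N.+1 f v.
    move=> /subnKC <-; elim: (n - N)%N => [|j IH]; first by rewrite addn0.
    rewrite addnS -IH; apply/eqP; apply: contraT => ne; case: hN.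
    by exists (N + j)%N; rewrite leq_addr.
  exists (M N.+1 f v); split.
    rewrite -(const (N + k)%N) ?leq_addr // -addSn addnC.
    by rewrite -addSnnS; apply: matched_later; apply/eqP.
  by exists N.+1 => -[//|n] Nn; exact: const.
- by apply: event_not; exact: event_converges.
- exact: event_or.
Qed.

End Convergence.

End Density.

(** * The limit matching *)

Section Limit.
Variables (R : realType) (V : choiceType) (e : rel V) (c : V -> bool).
Hypotheses (e_sym : symmetric e) (e_irr : irreflexive e)
  (e_conn : connected_graph e) (e_lf : locally_finite e)
  (e_col : forall x y, e x y -> c x != c y).
Local Notation Om := (label_config R V).
Local Notation act := (@act_label_config R V e).
Local Notation M := (@mseq R V e).
Let cV : countable [set: V] := countable_vertices e_conn e_lf.

Definition limit_domain : set Om := [set f | forall v, converges e v f].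

Definition limit_mate f v : V := lim_map (fun n => M n f) v.

Definition limit_edges f : edge_config e := [set a | exists v, a = [set v; limit_mate f v]].

Lemma measurable_limit_domain : measurable limit_domain.
Proof.
apply: (@event_all _ Om V (fun v f => converges e v f)) => // v.
exact: (event_converges e_sym e_irr e_conn e_lf e_col).
Qed.

Section OneConfiguration.
Variable f : Om.
Hypothesis Df : limit_domain f.
Local Notation mate := (limit_mate f).

Lemma limit_mate_settles v : settles (fun n => M n f) v (mate v) /\ mate v != v.
Proof. by have [b [bv sb]] := Df v; rewrite /limit_mate (lim_mapE sb). Qed.

Lemma limit_mateK v : mate (mate v) = v.
Proof.
have [[T hT] _] := limit_mate_settles v; apply: lim_mapE; exists T => t Tt.
by rewrite -(hT t Tt); exact: (mseq_matching e_sym e_irr e_lf e_col t f).1.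
Qed.

Lemma limit_mate_edge v : e v (mate v).
Proof.
have [[T hT] mv] := limit_mate_settles v; rewrite -(hT T (leqnn T)).
by apply: (mseq_matching e_sym e_irr e_lf e_col T f).2; rewrite hT.
Qed.

Lemma limit_edge_at a x : limit_edges f a -> a x -> a = [set x; mate x].
Proof. by move=> [v ->] [->//|->]; rewrite limit_mateK setUC. Qed.

Lemma limit_perfect : perfect_matching e (limit_edges f).
Proof.
split=> [_ [v ->]|x]; first by exists v, (mate v); split => //; exact: limit_mate_edge.
exists [set x; mate x]; split; first by split; [exists x|left].
by move=> a [fa ax]; rewrite (limit_edge_at fa ax).
Qed.

Lemma limit_edgesP x y : x != y -> limit_edges f [set x; y] <-> settles (fun n => M n f) x y.
Proof.
move=> xy; have [sx mx] := limit_mate_settles x; split => [fxy|sy]; last first.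
  by exists x; rewrite /limit_mate (lim_mapE sy).
have E := limit_edge_at fxy (or_introl erefl : [set x; y] x).
have [mE|mE] : [set x; y] (mate x) by rewrite E; right.
  by rewrite mE eqxx in mx.
by rewrite -mE.
Qed.

Lemma limit_mate_act (g : graph_aut e) v :
  settles (fun n => M n (act g f)) v (g (mate (aut_inv g v))).
Proof.
have [[T hT] _] := limit_mate_settles (aut_inv g v); exists T => t Tt.
by rewrite (mseq_act e_sym e_irr e_lf e_col) /conj_aut hT.
Qed.

Lemma limit_domain_act (g : graph_aut e) : limit_domain (act g f).
Proof.
move=> v; exists (g (mate (aut_inv g v))); split; last exact: limit_mate_act.
rewrite -{2}(aut_invK g v) (inj_eq (@aut_inj _ _ g)).
by case: (limit_mate_settles (aut_inv g v)).
Qed.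

Lemma limit_edges_act (g : graph_aut e) :
  limit_edges (act g f) = act_edge_config g (limit_edges f).
Proof.
have E v : limit_mate (act g f) v = g (mate (aut_inv g v)) := lim_mapE (limit_mate_act g v).
apply/seteqP; split => [a [v ->]|_ [_ [v ->] <-]].
  exists [set aut_inv g v; mate (aut_inv g v)]; first by exists (aut_inv g v).
  by rewrite image_setU !image_set1 aut_invK E.
by exists (g v); rewrite image_setU !image_set1 E aut_funK.
Qed.

End OneConfiguration.

Lemma measurable_limit_edges : measurable_fun limit_domain limit_edges.
Proof.
apply: (@measurability _ _ Om (edge_config e) _ _ (edge_events e)) => // _ [_ [a [x [y [exy ->]]] <-] <-].
have xy : x != y by apply: contraTneq exy => ->; rewrite e_irr.
rewrite (_ : _ `&` _ =
    limit_domain `&` [set f : Om | settles (fun n => M n f) x y]).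
  apply: measurableI; first exact: measurable_limit_domain.
  apply: (measurable_lim (s := fun n f => M n f)) => n.
  exact: (measurable_mseq e_sym e_irr e_conn e_lf e_col).
apply/seteqP; split => f [Df]; first by move/(limit_edgesP Df xy).
by move/(limit_edgesP Df xy).
Qed.

End Limit.

Theorem corollary3 (R : realType) (V : choiceType) (e : rel V)
  (e_sym : symmetric e) (e_irr : irreflexive e)
  (e_conn : connected_graph e) (e_lf : locally_finite e)
  (e_unim : unimodular e) (e_qt : quasi_transitive e)
  (e_nonam : nonamenable R e) (e_reg : regular_graph e)
  (e_bip : bipartite e)
  (u : probability (label_config R V) R) (u_prod : product_of_uniform u) :
  has_fiid_perfect_matching e u.
Proof.
have [d e_deg] := e_reg; have [c e_col] := e_bip.
have d0 := nonamenable_deg_gt0 e_conn e_lf e_deg e_nonam.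
have [rep [orbs [w [w0 rep_orbs rep_ex rep_aut mtp]]]] :=
  mass_transport_exists R e_sym e_conn e_lf e_unim e_qt e_col.
have [k /andP[k0 k1] expan] := expansion e_sym e_conn e_lf e_col e_deg d0 w0
  rep_orbs rep_ex mtp u_prod rep_aut e_nonam.
have mD : measurable (@limit_domain R V e) by exact: (measurable_limit_domain e_sym e_irr e_conn e_lf e_col).
exists (@limit_domain R V e), (@limit_edges R V e); split.
- split => //; rewrite -PrE; last exact: event_not.
  congr (_%:E); exact: (converges_null e_sym e_irr e_conn e_lf e_col e_deg d0 w0
    rep_orbs rep_ex mtp u_prod k0 k1 expan).
- exact: (measurable_limit_edges e_sym e_irr e_conn e_lf e_col).
- move=> g f Df; split; first exact: (limit_domain_act e_sym e_irr e_lf e_col).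
  exact: (limit_edges_act e_sym e_irr e_lf e_col).
- by move=> f Df; exact: (limit_perfect e_sym e_irr e_lf e_col).
Qed.
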